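(* Let $k$ be a positive integer, let $\alpha,\beta$ be two nonconstant inner functions, let $k\leq\dim K_\alpha$ and let $U:K_\alpha\to K_\beta$ be a bounded linear operator. Then $$S_\beta U=US_\alpha^k$$ if and only if $U\in\mathcal{S}_k(\alpha,\beta)$ and $U=U_{\varphi}^{\alpha,\beta}$ for some $$\varphi\in\overline{z}^{k-1}\tfrac{W^*_k\beta}{\gcd(\alpha,W^*_k\beta)}K_{\gcd(\alpha,W^*_k\beta)}.$$
   Context: $L^2=L^2(\mathbb{T},m)$ with $m$ normalized Lebesgue measure on the unit circle $\mathbb{T}$; $H^2\subset L^2$ is the Hardy space of the unit disk and $H^\infty=H^2\cap L^\infty$. An inner function is $\alpha\in H^\infty$ with $|\alpha|=1$ a.e. on $\mathbb{T}$; $K_\alpha=H^2\ominus\alpha H^2$ (so $K_\alpha=\{0\}$ if $\alpha$ is constant), $P_\alpha$ is the orthogonal projection of $L^2$ onto $K_\alpha$, $K_\alpha^\infty=K_\alpha\cap H^\infty$ (dense in $K_\alpha$), and $S_\alpha f=P_\alpha(zf)$, $f\in K_\alpha$, is the compressed shift. $\gcd$ denotes the greatest common inner divisor. $W_k:L^2\to L^2$ is the bounded linear operator with $W_k(z^n)=z^{n/k}$ if $k\mid n$ and $W_k(z^n)=0$ otherwise ($n\in\mathbb{Z}$); its adjoint is $W_k^*g(z)=g(z^k)$, so $W_k^*\beta$ is inner. For $\varphi\in L^2$ put $U_\varphi^{\alpha,\beta}f=P_\beta W_k(\varphi f)$, $f\in K_\alpha^\infty$. $\mathcal{S}_k(\alpha,\beta)$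 is the set of all operators $U_\varphi^{\alpha,\beta}$, $\varphi\in L^2$, that extend boundedly to $K_\alpha$ (each identified with its bounded extension $K_\alpha\to K_\beta$). *)

(* Defs.v *)
From HB Require Import structures.
From mathcomp Require Import all_boot all_order all_algebra.
From mathcomp Require Import complex.
From mathcomp Require Import all_classical all_reals all_analysis.

Set Implicit Arguments.
Unset Strict Implicit.
Unset Printing Implicit Defensive.

Import Order.TTheory GRing.Theory Num.Theory.

Local Open Scope classical_set_scope.
Local Open Scope ring_scope.
Local Open Scope complex_scope.

(* Elements of L^2(T) are represented by functions R[i] -> R[i], of which only
   the values on the unit circle matter; two of them are identified when they
   are equal almost everywhere on the circle ([aeq]).  Accordingly, spaces are
   sets of functions, operators act on functions, and every equation between
   elements of L^2(T) is stated up to [aeq].  The circle carries the image of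
   the normalized Lebesgue measure of [0, 2 pi] under [circ]. *)

Section Circle.
Context {R : realType}.
Implicit Types (f g h : R[i] -> R[i]).

Definition circ (t : R) : R[i] := cos t +i* sin t.

Definition period : set R := `[0, 2 * pi]%classic.

Definition ae_circ (P : R[i] -> Prop) : Prop :=
  {ae (@lebesgue_measure R), forall t, period t -> P (circ t)}.

Definition aeq f g : Prop := ae_circ (fun z => f z = g z).

Definition circ_measurable f : Prop :=
  measurable_fun period (fun t => complex.Re (f (circ t))) /\
  measurable_fun period (fun t => complex.Im (f (circ t))).

Definition mean (F : R -> R) : R :=
  (2 * pi)^-1 * Rintegral (@lebesgue_measure R) period F.

Definition cmean f : R[i] :=
  mean (fun t => complex.Re (f (circ t))) +i*
  mean (fun t => complex.Im (f (circ t))).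

Definition L2 : set (R[i] -> R[i]) := [set f | circ_measurable f /\
  (@lebesgue_measure R).-integrable period
    (fun t => (ComplexField.Normc.normc (f (circ t)) ^+ 2)%:E)].

Definition ip f g : R[i] := cmean (fun z => f z * (g z)^*).

Definition norm2 f : R :=
  Num.sqrt (mean (fun t => ComplexField.Normc.normc (f (circ t)) ^+ 2)).

Definition monomial (n : int) : R[i] -> R[i] := fun z => z ^ n.

Definition fourier f (n : int) : R[i] := ip f (monomial n).

Definition H2 : set (R[i] -> R[i]) :=
  [set f | L2 f /\ forall n : int, n < 0 -> fourier f n = 0].

Definition essentially_bounded f : Prop :=
  exists M : R, ae_circ (fun z => `|f z| <= M%:C).

Definition Hoo : set (R[i] -> R[i]) :=
  [set f | H2 f /\ essentially_bounded f].

Definition inner f : Prop := Hoo f /\ ae_circ (fun z => `|f z| = 1).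

Definition nonconstant f : Prop := ~ exists c : R[i], aeq f (fun=> c).

Definition inner_dvd (u v : R[i] -> R[i]) : Prop :=
  exists w, inner w /\ aeq v (fun z => u z * w z).

(* A greatest common inner divisor; it is determined up to a unimodular
   constant factor. *)
Definition is_inner_gcd (d u v : R[i] -> R[i]) : Prop :=
  [/\ inner d, inner_dvd d u, inner_dvd d v &
      forall e, inner e -> inner_dvd e u -> inner_dvd e v -> inner_dvd e d].

(* K_alpha = H^2 minus (orthogonally) alpha H^2 *)
Definition modelK (alpha : R[i] -> R[i]) : set (R[i] -> R[i]) :=
  [set f | H2 f /\ forall h, H2 h -> ip f (fun z => alpha z * h z) = 0].

Definition modelKoo (alpha : R[i] -> R[i]) : set (R[i] -> R[i]) :=
  modelK alpha `&` Hoo.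

(* k <= dim V, where V may be infinite-dimensional *)
Definition dim_ge (k : nat) (V : set (R[i] -> R[i])) : Prop :=
  exists e : 'I_k -> R[i] -> R[i], (forall i, V (e i)) /\
    forall c : 'I_k -> R[i],
      aeq (fun z => \sum_(i < k) c i * e i z) (fun=> 0) -> forall i, c i = 0.

(* Bounded linear operators from V to V'.  Linearity (up to [aeq]) and
   boundedness imply compatibility with [aeq].  The values of the operator
   outside V are irrelevant. *)
Definition bounded_linear (V V' : set (R[i] -> R[i]))
    (U : (R[i] -> R[i]) -> (R[i] -> R[i])) : Prop :=
  [/\ forall f, V f -> V' (U f),
      forall (a : R[i]) f g, V f -> V g ->
        aeq (U (fun z => a * f z + g z)) (fun z => a * U f z + U g z) &
      exists C : R, forall f, V f -> norm2 (U f) <= C * norm2 f].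

Definition op_eq (V : set (R[i] -> R[i]))
    (U U' : (R[i] -> R[i]) -> (R[i] -> R[i])) : Prop :=
  forall f, V f -> aeq (U f) (U' f).

(* Orthogonal projection onto V, with the representative of the result picked
   by choice. *)
Definition proj (V : set (R[i] -> R[i])) f : R[i] -> R[i] :=
  xget (fun=> 0)
    [set g | V g /\ forall h, V h -> ip (fun z => f z - g z) h = 0].

Definition shift_op (alpha : R[i] -> R[i]) f : R[i] -> R[i] :=
  proj (modelK alpha) (fun z => z * f z).

(* W_k is determined up to [op_eq L2] by these properties; one such operator on
   representatives is picked by choice. *)
Definition is_W (k : nat) (W : (R[i] -> R[i]) -> (R[i] -> R[i])) : Prop :=
  bounded_linear L2 L2 W /\
  forall n : int, aeq (W (monomial n))
    (if (k%:Z %| n)%Z then monomial (n %/ k%:Z)%Z else fun=> 0).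

Definition Wop (k : nat) : (R[i] -> R[i]) -> (R[i] -> R[i]) :=
  xget (idfun : (R[i] -> R[i]) -> (R[i] -> R[i])) [set W | is_W k W].

Definition Wadj (k : nat) g : R[i] -> R[i] := fun z => g (z ^+ k).

Definition Uop (k : nat) (beta phi : R[i] -> R[i]) f : R[i] -> R[i] :=
  proj (modelK beta) (Wop k (fun z => phi z * f z)).

(* U is the bounded extension to K_alpha of U_phi, initially defined on the
   dense subspace K_alpha^oo. *)
Definition is_extension (k : nat) (alpha beta phi : R[i] -> R[i])
    (U : (R[i] -> R[i]) -> (R[i] -> R[i])) : Prop :=
  [/\ L2 phi, bounded_linear (modelK alpha) (modelK beta) U &
      op_eq (modelKoo alpha) U (Uop k beta phi)].

Definition Sclass (k : nat) (alpha beta : R[i] -> R[i]) :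
    set ((R[i] -> R[i]) -> (R[i] -> R[i])) :=
  [set U | exists phi, is_extension k alpha beta phi U].

(* conj(z)^(k-1) * (W_k^* beta / d) * K_d *)
Definition symbol_space (k : nat) (beta d : R[i] -> R[i]) :
    set (R[i] -> R[i]) :=
  [set phi | exists2 g, modelK d g &
     aeq phi (fun z => (z^*) ^+ k.-1 * (Wadj k beta z / d z) * g z)].

End Circle.

(* Main.v *)
(* The operator f |-> U (P_alpha f) extends U to H^2, and U intertwines S_beta
   with S_alpha^k if and only if U P_alpha (z^k f) = P_beta (z U P_alpha f) for
   f in H^2.  Then U P_alpha is determined by u_j = U P_alpha z^j for j < k, and
   U = U_phi for phi = sum_(j < k) conj(z)^j W_k^* u_j.

   Put psi = z^(k-1) phi.  Its Fourier coefficients show that psi is in K_B for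
   B = W_k^* beta.  Since U P_alpha vanishes on alpha H^2, so does U_phi, whence
   alpha psi is in B H^2.  Write alpha = delta a1 and B = delta b1 with
   delta = gcd(alpha, B), so that a1 psi is in b1 H^2.  As in Beurling's theorem,
   the space of all such psi is theta H^2 for an inner theta, which contains b1:
   then b1 = theta w, and delta w divides both alpha and B, so that w is constant
   and psi is in b1 H^2.  Together with psi in K_B this gives psi in b1 K_delta.

   Conversely, if z^(k-1) phi is in b1 K_delta, then phi alpha H^2 is contained
   in conj(z)^(k-1) B H^2, which W_k maps into beta H^2.  So U P_alpha f =
   P_beta W_k (phi f) on monomials f, and W_k (z^k phi f) = z W_k (phi f). *)

Require Import Defs.
From HB Require Import structures.
From mathcomp Require Import all_boot all_order all_algebra.
From mathcomp Require Import complex.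
From mathcomp Require Import all_classical all_reals all_analysis.
From mathcomp Require Import measurable_realfun.
From mathcomp Require Import zify ring lra.

Set Implicit Arguments.
Unset Strict Implicit.
Unset Printing Implicit Defensive.

Import Order.TTheory GRing.Theory Num.Theory.
Import numFieldNormedType.Exports.

Local Open Scope classical_set_scope.
Local Open Scope complex_scope.
Local Open Scope ring_scope.

(** * Integration on the circle *)

Section CircleIntegral.
Context {R : realType}.
Implicit Types (f g h : R[i] -> R[i]) (u v : R -> R).

Local Notation mu := (@lebesgue_measure R).
Local Notation normc := ComplexField.Normc.normc.

(** The symbol is only square integrable: [phi f] is square integrable for bounded f, but need not
    be for general f in K_alpha. Identities about U_phi are therefore paired with the bounded
    functions P_alpha z^n and P_beta z^n, which span dense subspaces, and are carried to all of H^2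
    by one principle: a bounded functional on H^2 that vanishes on the monomials is zero. The
    greatest common divisor is given by its universal property alone, so the competing divisor delta
    w has to be constructed. With M the space of those psi in H^2 for which a1 psi is in b1 H^2,
    theta is a unit vector of M orthogonal to zM; its squared modulus has no nonzero Fourier
    coefficient except the constant one, hence it is 1. Functions that agree almost everywhere are
    never identified. The Hilbert space arguments thus concern a semidefinite form, and the closed
    subspaces that occur are annihilators of explicit families, which makes them stable under
    limits. *)

Lemma twopi_gt0 : 0 < 2 * pi :> R.
Proof. by rewrite mulr_gt0// pi_gt0. Qed.

Lemma measurable_period : measurable (@period R).
Proof. exact: measurable_itv. Qed.
Hint Resolve measurable_period : core.

Lemma mu_period : mu (@period R) = (2 * pi)%:E.
Proof.
by rewrite lebesgue_measure_itv/= lte_fin twopi_gt0 -EFinD subr0.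
Qed.

Lemma aeS (P Q : R -> Prop) : (forall t, P t -> Q t) ->
  {ae mu, forall t, P t} -> {ae mu, forall t, Q t}.
Proof.
by move=> PQ; apply: filterS => //; exact: (ae_filter_ringOfSetsType mu).
Qed.

Lemma aeI (P Q : R -> Prop) :
  {ae mu, forall t, P t} -> {ae mu, forall t, Q t} ->
  {ae mu, forall t, P t /\ Q t}.
Proof. by apply: filterI; exact: (ae_filter_ringOfSetsType mu). Qed.

Lemma ae_circS (P Q : R[i] -> Prop) : (forall t, P (circ t) -> Q (circ t)) ->
  ae_circ P -> ae_circ Q.
Proof. by move=> PQ; apply: aeS => t Pt pt; apply: PQ; exact: Pt. Qed.

Lemma ae_circI (P Q : R[i] -> Prop) :
  ae_circ P -> ae_circ Q -> ae_circ (fun z => P z /\ Q z).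
Proof.
move=> aP aQ; apply: aeS (aeI aP aQ) => t [Pt Qt] pt.
by split; [exact: Pt|exact: Qt].
Qed.

Lemma ae_circS2 (P Q S : R[i] -> Prop) :
  (forall t, P (circ t) -> Q (circ t) -> S (circ t)) ->
  ae_circ P -> ae_circ Q -> ae_circ S.
Proof. by move=> H aP aQ; apply: ae_circS (ae_circI aP aQ) => t []; exact: H. Qed.

Lemma ae_circS3 (P Q S V : R[i] -> Prop) :
  (forall t, P (circ t) -> Q (circ t) -> S (circ t) -> V (circ t)) ->
  ae_circ P -> ae_circ Q -> ae_circ S -> ae_circ V.
Proof.
move=> H aP aQ aS; apply: ae_circS2 (ae_circI aP aQ) aS => t [].
exact: H.
Qed.

Lemma ae_circW (P : R[i] -> Prop) : (forall t, P (circ t)) -> ae_circ P.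
Proof. by move=> H; apply: aeW => t _; exact: H. Qed.

Definition intble u := mu.-integrable (@period R) (EFin \o u).

Lemma intble_meas u : intble u -> measurable_fun (@period R) u.
Proof. by move=> /measurable_int/measurable_EFinP. Qed.

Lemma intbleD u v : intble u -> intble v -> intble (fun t => u t + v t).
Proof. by move=> iu iv; apply: (integrableD _ iu iv). Qed.

Lemma intbleZ (c : R) u : intble u -> intble (fun t => c * u t).
Proof. by move=> iu; apply: (integrableZl _ _ iu). Qed.

Lemma intble_cst (c : R) : intble (fun=> c).
Proof.
apply: measurable_bounded_integrable => //; last exact: bounded_cst.
by rewrite [X in (X < _)%E]mu_period ltry.
Qed.

Lemma intble_norm u : intble u -> intble (fun t => `|u t|).
Proof. by move=> iu; apply: (integrable_norm iu). Qed.

Lemma intble_le u v : measurable_fun (@period R) u ->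
  (forall t, period t -> `|u t| <= v t) -> intble v -> intble u.
Proof.
move=> mU uv iv; apply: le_integrable iv => //; first exact/measurable_EFinP.
by move=> t pt /=; rewrite lee_fin (le_trans (uv _ pt))// ler_norm.
Qed.

Lemma intble_ae_le u v : measurable_fun (@period R) u ->
  {ae mu, forall t, period t -> `|u t| <= v t} -> intble v -> intble u.
Proof.
move=> mU uv iv; apply/integrableP; split; first exact/measurable_EFinP.
have /integrableP[mv] := iv; apply: le_lt_trans.
apply: ae_ge0_le_integral => //.
- by apply: measurableT_comp => //; exact/measurable_EFinP.
- by apply: measurableT_comp.
apply: aeS uv => t uv pt /=.
by rewrite lee_fin (le_trans (uv pt))// ler_norm.
Qed.

Lemma meanD u v : intble u -> intble v ->
  mean (fun t => u t + v t) = mean u + mean v.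
Proof. by move=> iu iv; rewrite /mean RintegralD// mulrDr. Qed.

Lemma meanZ (c : R) u : intble u -> mean (fun t => c * u t) = c * mean u.
Proof. by move=> iu; rewrite /mean RintegralZl// mulrCA. Qed.

Lemma meanN u : intble u -> mean (fun t => - u t) = - mean u.
Proof.
move=> iu; rewrite -[RHS]mulN1r -meanZ//; congr mean.
by apply/funext => t; rewrite mulN1r.
Qed.

Lemma mean_ge0 u : (forall t, period t -> 0 <= u t) -> 0 <= mean u.
Proof.
move=> u0; rewrite /mean mulr_ge0 ?invr_ge0 ?(ltW twopi_gt0)//.
exact: Rintegral_ge0.
Qed.

Lemma mean_ae u v : measurable_fun (@period R) u ->
  measurable_fun (@period R) v ->
  {ae mu, forall t, period t -> u t = v t} -> mean u = mean v.
Proof.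
move=> mU mV uv; rewrite /mean /Rintegral; congr (_ * fine _).
apply: ae_eq_integral => //; [exact/measurable_EFinP|exact/measurable_EFinP|].
by apply: aeS uv => t uv pt /=; rewrite uv.
Qed.

Lemma mean_cst (c : R) : mean (fun=> c) = c.
Proof.
rewrite /mean Rintegral_cst// (_ : fine _ = 2 * pi).
  by rewrite mulrCA mulVf ?mulr1// gt_eqF// twopi_gt0.
by rewrite -[LHS]/(fine (mu (@period R))) mu_period.
Qed.

Lemma mean_eq0 u : intble u -> (forall t, period t -> 0 <= u t) ->
  mean u = 0 -> {ae mu, forall t, period t -> u t = 0}.
Proof.
move=> iu u0 /eqP; rewrite /mean mulf_eq0 invr_eq0 gt_eqF ?twopi_gt0//=.
move=> /eqP m0.
have i0 : (\int[mu]_(t in @period R) `|(u t)%:E| = 0)%E.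
  rewrite (_ : (\int[mu]_(t in _) _ = \int[mu]_(t in @period R) (u t)%:E)%E).
    have := @integrable_fin_num _ _ _ mu _ measurable_period _ iu.
    by move=> /fineK <-; rewrite -[fine _]/(Rintegral _ _ _) m0.
  by apply: eq_integral => t /set_mem pt; rewrite gee0_abs// lee_fin u0.
have /integrableP[mU _] := iu.
have /ae_eq_integral_abs := mU.
move=> /(_ mu measurable_period)[/(_ i0) H _].
by apply: aeS H => t H pt; have := H pt => -[].
Qed.

(** * Modulus, conjugation and the points [circ t] *)

Lemma normc_Re (z : R[i]) : `|complex.Re z| <= normc z.
Proof.
case: z => a b /=; rewrite -sqrtr_sqr ler_sqrt ?lerDl ?sqr_ge0//.
by rewrite addr_ge0 ?sqr_ge0.
Qed.

Lemma normc_Im (z : R[i]) : `|complex.Im z| <= normc z.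
Proof.
case: z => a b /=; rewrite -sqrtr_sqr ler_sqrt ?lerDr ?sqr_ge0//.
by rewrite addr_ge0 ?sqr_ge0.
Qed.

Lemma sqr_normcE (z : R[i]) : normc z ^+ 2 = complex.Re z ^+ 2 + complex.Im z ^+ 2.
Proof. by case: z => a b /=; rewrite sqr_sqrtr// addr_ge0 ?sqr_ge0. Qed.

Lemma normc_ge0 (z : R[i]) : 0 <= normc z.
Proof. by case: z => a b /=; rewrite sqrtr_ge0. Qed.

Lemma normr_normc (z : R[i]) : `|z| = (normc z)%:C.
Proof. by []. Qed.

Lemma rcM (x y : R) : (x * y)%:C = x%:C * y%:C.
Proof. exact: (rmorphM (real_complex R)). Qed.

Lemma rcD (x y : R) : (x + y)%:C = x%:C + y%:C.
Proof. exact: (rmorphD (real_complex R)). Qed.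

Lemma rcB (x y : R) : (x - y)%:C = x%:C - y%:C.
Proof. exact: (rmorphB (real_complex R)). Qed.

Lemma rcV (x : R) : (x^-1)%:C = (x%:C)^-1.
Proof. exact: (fmorphV (real_complex R)). Qed.

Lemma conj_rc (x : R) : (x%:C)^* = x%:C.
Proof. exact: conjc_real. Qed.

Lemma conj_N1 : (-1 : R[i])^* = -1.
Proof. by rewrite rmorphN1. Qed.

Lemma conj_1 : (1 : R[i])^* = 1.
Proof. exact: rmorph1. Qed.

Lemma conjcE (z : R[i]) : z^* = conjc z.
Proof. by []. Qed.

Lemma Re_conj (z : R[i]) : complex.Re z^* = complex.Re z.
Proof. by rewrite conjcE; case: z. Qed.

Lemma Im_conj (z : R[i]) : complex.Im z^* = - complex.Im z.
Proof. by rewrite conjcE; case: z. Qed.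

Lemma normc_conj (z : R[i]) : normc z^* = normc z.
Proof. by rewrite conjcE; case: z => a b /=; rewrite sqrrN. Qed.

Lemma mul_conj_normc (z : R[i]) : z * z^* = (normc z ^+ 2)%:C.
Proof. by rewrite sqr_normcE conjcE; case: z => a b; simpc; congr (_ +i* _); ring. Qed.

Lemma normc_circ (t : R) : normc (circ t) = 1.
Proof. by rewrite /circ /= cos2Dsin2 sqrtr1. Qed.

Lemma circ_neq0 (t : R) : circ t != 0.
Proof.
apply/eqP => c0; have := normc_circ t; rewrite c0 ComplexField.Normc.normc0.
by move/eqP; rewrite eq_sym oner_eq0.
Qed.

Lemma circ0 : circ (0 : R) = 1.
Proof. by rewrite /circ cos0 sin0. Qed.

Lemma circD (s t : R) : circ (s + t) = circ s * circ t.
Proof. by rewrite /circ cosD sinD; simpc; congr (_ +i* _); ring. Qed.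

Lemma circX (t : R) (n : nat) : circ t ^+ n = circ (n%:R * t).
Proof.
elim: n => [|n IH]; first by rewrite expr0 mul0r circ0.
by rewrite exprS IH -circD -natr1 mulrDl mul1r addrC.
Qed.

Lemma circ_conj (t : R) : (circ t)^* = (circ t)^-1.
Proof.
apply: (mulfI (circ_neq0 t)); rewrite mulfV ?circ_neq0// mul_conj_normc.
by rewrite normc_circ expr1n.
Qed.

Lemma circ2pi : circ (2 * pi : R) = 1.
Proof. by rewrite mulr_natl /circ cos2pi sin2pi. Qed.

(** * Measurability on the circle *)

Lemma circ_measM f g : circ_measurable f -> circ_measurable g ->
  circ_measurable (fun z => f z * g z).
Proof.
move=> [fr fi] [gr gi]; split.
  rewrite (_ : (fun t => _) = (fun t =>
    complex.Re (f (circ t)) * complex.Re (g (circ t)) -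
    complex.Im (f (circ t)) * complex.Im (g (circ t)))).
    by apply: measurable_funB; exact: measurable_funM.
  by apply/funext => t; case: (f _); case: (g _).
rewrite (_ : (fun t => _) = (fun t =>
    complex.Re (f (circ t)) * complex.Im (g (circ t)) +
    complex.Im (f (circ t)) * complex.Re (g (circ t)))).
  by apply: measurable_funD; exact: measurable_funM.
by apply/funext => t; case: (f _); case: (g _).
Qed.

Lemma circ_measD f g : circ_measurable f -> circ_measurable g ->
  circ_measurable (fun z => f z + g z).
Proof.
move=> [fr fi] [gr gi]; split.
  rewrite (_ : (fun t => _) = (fun t =>
    complex.Re (f (circ t)) + complex.Re (g (circ t)))).
    exact: measurable_funD.
  by apply/funext => t; case: (f _); case: (g _).
rewrite (_ : (fun t => _) = (fun t =>
    complex.Im (f (circ t)) + complex.Im (g (circ t)))).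
  exact: measurable_funD.
by apply/funext => t; case: (f _); case: (g _).
Qed.

Lemma circ_meas_cst (c : R[i]) : circ_measurable (fun=> c).
Proof. by split; exact: measurable_cst. Qed.

Lemma circ_meas_conj f : circ_measurable f -> circ_measurable (fun z => (f z)^*).
Proof.
move=> [fr fi]; split.
  rewrite (_ : (fun t => _) = (fun t => complex.Re (f (circ t))))//.
  by apply/funext => t; rewrite Re_conj.
rewrite (_ : (fun t => _) = (fun t => - complex.Im (f (circ t)))).
  exact: measurableT_comp.
by apply/funext => t; rewrite Im_conj.
Qed.

Lemma circ_meas_id : circ_measurable (fun z => z : R[i]).
Proof.
split => /=; apply: (measurable_funS measurableT) => //;
  apply: continuous_measurable_fun; [exact: continuous_cos|exact: continuous_sin].
Qed.

Lemma circ_meas_eq f g : (forall t, f (circ t) = g (circ t)) ->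
  circ_measurable f -> circ_measurable g.
Proof.
move=> fg [fr fi]; split.
  by rewrite (_ : (fun t => _) = (fun t => complex.Re (f (circ t))))//;
    apply/funext => t; rewrite fg.
by rewrite (_ : (fun t => _) = (fun t => complex.Im (f (circ t))))//;
  apply/funext => t; rewrite fg.
Qed.

Lemma circ_meas_X (n : nat) : circ_measurable (fun z => z ^+ n : R[i]).
Proof.
elim: n => [|n IH]; first exact: circ_meas_cst.
apply: (circ_meas_eq _ (circ_measM circ_meas_id IH)) => t /=.
by rewrite exprS.
Qed.

Lemma monomial_circ_conj (n : int) (t : R) :
  (monomial n (circ t))^* = monomial (- n) (circ t).
Proof.
rewrite /monomial; case: n => n.
  by rewrite -exprz_inv -exprnP -exprnP -circ_conj rmorphXn.
rewrite NegzE opprK -exprz_inv -!exprnP -circ_conj rmorphXn.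
by congr (_ ^+ _); exact: conjCK.
Qed.

Lemma circ_meas_monomial (n : int) : circ_measurable (@monomial R n).
Proof.
case: n => n; first exact: circ_meas_X.
apply: (circ_meas_eq _ (circ_meas_conj (circ_meas_X n.+1))) => t /=.
by rewrite NegzE -monomial_circ_conj.
Qed.

Lemma circ_meas_normc f : circ_measurable f ->
  measurable_fun (@period R) (fun t => normc (f (circ t)) ^+ 2).
Proof.
move=> [fr fi].
rewrite (_ : (fun t => _) = (fun t => complex.Re (f (circ t)) ^+ 2 +
  complex.Im (f (circ t)) ^+ 2)).
  by apply: measurable_funD; exact: measurable_funX.
by apply/funext => t; rewrite sqr_normcE.
Qed.

Lemma circ_meas_Nc f : circ_measurable f ->
  measurable_fun (@period R) (fun t => normc (f (circ t))).
Proof.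
move=> mf; rewrite (_ : (fun t => _) =
  (fun t => Num.sqrt (normc (f (circ t)) ^+ 2))).
  apply: (measurableT_comp _ (circ_meas_normc mf)).
  by apply: continuous_measurable_fun; exact: sqrt_continuous.
apply/funext => t; rewrite sqrtr_sqr ger0_norm//.
exact: normc_ge0.
Qed.

(** * Integrable functions and their complex mean *)

Definition L1 f := intble (fun t => complex.Re (f (circ t))) /\
  intble (fun t => complex.Im (f (circ t))).

Lemma L1_meas f : L1 f -> circ_measurable f.
Proof. by move=> [? ?]; split; exact: intble_meas. Qed.

Lemma L1_le f u : circ_measurable f ->
  (forall t, period t -> normc (f (circ t)) <= u t) -> intble u -> L1 f.
Proof.
move=> [fr fi] fu iu; split; apply: intble_le iu => // t pt.
  by rewrite (le_trans (normc_Re _))// fu.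
by rewrite (le_trans (normc_Im _))// fu.
Qed.

Lemma L1_normc f : L1 f -> intble (fun t => normc (f (circ t))).
Proof.
move=> fi; have mf := L1_meas fi; case: fi => fr fi.
apply: (@intble_le _ (fun t => `|complex.Re (f (circ t))| + `|complex.Im (f (circ t))|)).
- exact: circ_meas_Nc.
- move=> t pt; rewrite ger0_norm ?normc_ge0//.
  case: (f _) => a b /=.
  rewrite -[leRHS]ger0_norm ?addr_ge0// -sqrtr_sqr ler_sqrt ?sqr_ge0//.
  rewrite sqrrD !real_normK ?num_real//; have := mulr_ge0 (normr_ge0 a) (normr_ge0 b); lra.
- by apply: (intbleD (intble_norm fr) (intble_norm fi)).
Qed.

Lemma L1_eq f g : (forall t, f (circ t) = g (circ t)) -> L1 f -> L1 g.
Proof.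
move=> fg [fr fi]; split.
  by rewrite (_ : (fun t => _) = (fun t => complex.Re (f (circ t))))//;
    apply/funext => t; rewrite fg.
by rewrite (_ : (fun t => _) = (fun t => complex.Im (f (circ t))))//;
  apply/funext => t; rewrite fg.
Qed.

Lemma L1D f g : L1 f -> L1 g -> L1 (fun z => f z + g z).
Proof.
move=> [fr fi] [gr gi]; split.
  rewrite (_ : (fun t => _) = (fun t =>
    complex.Re (f (circ t)) + complex.Re (g (circ t)))).
    exact: intbleD.
  by apply/funext => t; case: (f _); case: (g _).
rewrite (_ : (fun t => _) = (fun t =>
    complex.Im (f (circ t)) + complex.Im (g (circ t)))).
  exact: intbleD.
by apply/funext => t; case: (f _); case: (g _).
Qed.

Lemma L1Z (c : R[i]) f : L1 f -> L1 (fun z => c * f z).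
Proof.
move=> fi; apply: (@L1_le _ (fun t => normc c * normc (f (circ t)))).
- by apply: circ_measM; [exact: circ_meas_cst|exact: L1_meas].
- by move=> t pt; rewrite ComplexField.Normc.normcM.
- by apply: intbleZ; exact: L1_normc.
Qed.

Lemma L1M_monomial f (n : int) : L1 f -> L1 (fun z => f z * monomial n z).
Proof.
move=> fi; apply: (@L1_le _ (fun t => normc (f (circ t)))).
- by apply: circ_measM; [exact: L1_meas|exact: circ_meas_monomial].
- move=> t pt; rewrite ComplexField.Normc.normcM /monomial.
  have nX m : normc (circ t ^+ m) = 1.
    by rewrite circX normc_circ.
  case: n => n; first by rewrite -exprnP nX mulr1.
  by rewrite NegzE -exprz_inv -exprnP exprVn ComplexField.Normc.normcV nX invr1 mulr1.
- exact: L1_normc.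
Qed.

Lemma cmeanD f g : L1 f -> L1 g ->
  cmean (fun z => f z + g z) = cmean f + cmean g.
Proof.
move=> [fr fi] [gr gi]; rewrite /cmean.
have -> : (fun t => complex.Re (f (circ t) + g (circ t))) =
   (fun t => complex.Re (f (circ t)) + complex.Re (g (circ t))).
  by apply/funext => t; case: (f _); case: (g _).
have -> : (fun t => complex.Im (f (circ t) + g (circ t))) =
   (fun t => complex.Im (f (circ t)) + complex.Im (g (circ t))).
  by apply/funext => t; case: (f _); case: (g _).
by rewrite !meanD.
Qed.

Lemma cmeanZ (c : R[i]) f : L1 f -> cmean (fun z => c * f z) = c * cmean f.
Proof.
move=> [fr fi]; rewrite /cmean; case: c => a b.
have -> : (fun t => complex.Re ((a +i* b) * f (circ t))) =
   (fun t => a * complex.Re (f (circ t)) + - b * complex.Im (f (circ t))).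
  by apply/funext => t; case: (f _) => x y /=; rewrite mulNr.
have -> : (fun t => complex.Im ((a +i* b) * f (circ t))) =
   (fun t => a * complex.Im (f (circ t)) + b * complex.Re (f (circ t))).
  by apply/funext => t; case: (f _).
rewrite !meanD; try exact: intbleZ.
rewrite !meanZ//; simpc; congr (_ +i* _); ring.
Qed.

Lemma cmean_conj f : L1 f -> cmean (fun z => (f z)^*) = (cmean f)^*.
Proof.
move=> [fr fi]; rewrite /cmean.
have -> : (fun t => complex.Re (f (circ t))^*) =
   (fun t => complex.Re (f (circ t))).
  by apply/funext => t; rewrite Re_conj.
have -> : (fun t => complex.Im (f (circ t))^*) =
   (fun t => - complex.Im (f (circ t))).
  by apply/funext => t; rewrite Im_conj.
by rewrite meanN.
Qed.

Lemma cmean_eq f g : (forall t, f (circ t) = g (circ t)) -> cmean f = cmean g.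
Proof.
move=> fg; rewrite /cmean.
by congr (mean _ +i* mean _); apply/funext => t; rewrite fg.
Qed.

Lemma cmean_ae f g : circ_measurable f -> circ_measurable g -> aeq f g ->
  cmean f = cmean g.
Proof.
move=> [fr fi] [gr gi] fg; rewrite /cmean.
by congr (_ +i* _); apply: mean_ae => //; apply: aeS fg => t fg pt; rewrite fg.
Qed.

Lemma cmean_sum (I : Type) (s : seq I) (F : I -> R[i] -> R[i]) :
  (forall i, L1 (F i)) ->
  L1 (fun z => \sum_(i <- s) F i z) /\
  cmean (fun z => \sum_(i <- s) F i z) = \sum_(i <- s) cmean (F i).
Proof.
move=> iF; elim: s => [|i s [IH1 IH2]].
  have -> : (fun z => \sum_(i <- [::]) F i z) = (fun=> 0).
    by apply/funext => z; rewrite big_nil.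
  split; first by split; exact: (intble_cst 0).
  by rewrite big_nil /cmean !mean_cst.
have -> : (fun z => \sum_(j <- i :: s) F j z) = (fun z => F i z + \sum_(j <- s) F j z).
  by apply/funext => z; rewrite big_cons.
split; first exact: L1D.
by rewrite big_cons cmeanD// IH2.
Qed.

End CircleIntegral.

(** * Uniqueness of Fourier coefficients *)

Section FourierUniqueness.
Context {R : realType}.
Implicit Types (f g h : R[i] -> R[i]) (u v : R -> R).

Local Notation mu := (@lebesgue_measure R).

(** These are the real-valued Laurent polynomials in [circ t]. Being real, such a factor acts on the
    real and imaginary parts of a function separately. *)
Definition trigpoly u := exists (p : {poly R[i]}) (N : nat),
  forall t, (u t)%:C = circ t ^- N * p.[circ t].

Lemma trigpoly_cst (c : R) : trigpoly (fun=> c).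
Proof. by exists (c%:C)%:P, 0%N => t; rewrite expr0 invr1 mul1r hornerC. Qed.

Lemma trigpolyM u v : trigpoly u -> trigpoly v -> trigpoly (fun t => u t * v t).
Proof.
move=> [p [N pN]] [q [M qM]]; exists (p * q), (N + M)%N => t.
rewrite rmorphM /= pN qM hornerM exprD invfM; ring.
Qed.

Lemma trigpolyD u v : trigpoly u -> trigpoly v -> trigpoly (fun t => u t + v t).
Proof.
move=> [p [N pN]] [q [M qM]]; exists ('X^M * p + 'X^N * q), (N + M)%N => t.
rewrite rmorphD /= pN qM !(hornerE, hornerXn) exprD.
have := circ_neq0 t => c0.
by field; rewrite ?expf_neq0.
Qed.

Lemma trigpolyX u n : trigpoly u -> trigpoly (fun t => u t ^+ n).
Proof.
move=> Tu; elim: n => [|n IH]; first exact: (trigpoly_cst 1).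
rewrite (_ : (fun t => _) = (fun t => u t * u t ^+ n)); first exact: trigpolyM.
by apply/funext => t; rewrite exprS.
Qed.

Lemma trigpoly_cos : trigpoly cos.
Proof.
exists ((2^-1)%:P * ('X^2 + 1)), 1%N => t.
rewrite hornerM hornerD hornerXn ?hornerN !hornerC expr1.
have c0 := circ_neq0 t.
have -> : (cos t)%:C = 2^-1 * (circ t + (circ t)^-1).
  by rewrite -circ_conj conjcE /circ addcJ /= mulrA mulVf ?mul1r.
have n2 : (2 : R[i]) != 0 by rewrite pnatr_eq0.
by field; rewrite ?c0 ?n2.
Qed.

Lemma trigpoly_sin : trigpoly sin.
Proof.
exists (((2 * 'i%C)^-1)%:P * ('X^2 - 1)), 1%N => t.
rewrite hornerM hornerD hornerXn ?hornerN !hornerC expr1.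
have c0 := circ_neq0 t.
have n2 : (2 : R[i]) != 0 by rewrite pnatr_eq0.
have i0 : ('i%C : R[i]) != 0 by rewrite eq_complex /= oner_eq0 andbF.
have -> : (sin t)%:C = (2 * 'i%C)^-1 * (circ t - (circ t)^-1).
  rewrite -circ_conj conjcE /circ subcJ /=.
  by field; rewrite ?n2 ?i0.
by field; rewrite ?c0 ?n2 ?i0.
Qed.

Lemma mean_trigpoly f u : L1 f -> (forall n, cmean (fun z => f z * monomial n z) = 0) ->
  trigpoly u ->
  mean (fun t => complex.Re (f (circ t)) * u t) = 0 /\
  mean (fun t => complex.Im (f (circ t)) * u t) = 0.
Proof.
move=> fi f0 [p [N pN]].
have : cmean (fun z => \sum_(i < size p) p`_i * (f z * monomial (i%:Z - N%:Z) z)) = 0.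
  have [_ ->] := @cmean_sum R _ (index_enum _)
    (fun i : 'I_(size p) => fun z => p`_i * (f z * monomial (i%:Z - N%:Z) z))
    (fun i => L1Z _ (L1M_monomial _ fi)).
  rewrite big1// => i _; rewrite cmeanZ ?f0 ?mulr0//.
  exact: L1M_monomial.
have H t : \sum_(i < size p) p`_i * (f (circ t) * monomial (i%:Z - N%:Z) (circ t)) =
    f (circ t) * (u t)%:C.
  rewrite pN horner_coef mulrCA !mulr_sumr; apply: eq_bigr => i _.
  rewrite /monomial expfzDr ?circ_neq0// -exprnP -exprnN; ring.
rewrite /cmean => -[Hr Hi]; split.
  rewrite -[RHS]Hr; congr mean; apply/funext => t; rewrite H.
  by case: (f _) => a b /=; rewrite mulr0 subr0.
rewrite -[RHS]Hi; congr mean; apply/funext => t; rewrite H.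
by case: (f _) => a b /=; rewrite mulr0 add0r.
Qed.

Lemma bernoulli (a : R) n : -1 <= a -> 1 + n%:R * a <= (1 + a) ^+ n.
Proof.
move=> a1; elim: n => [|n IH]; first by rewrite mul0r addr0 expr0.
have := ler_wpM2l (_ : 0 <= 1 + a) IH; rewrite -exprS => /(_ ltac:(lra)).
apply: le_trans; rewrite -natr1.
have := mulr_ge0 (ler0n R n) (sqr_ge0 a); lra.
Qed.

(* These polynomials converge on [0, 1], except at 1/2, to the indicator of
   [0, 1/2[. *)
Definition step (n : nat) (y : R) : R := (1 - y ^+ n) ^+ (2 ^ n).

Lemma step_itv n y : 0 <= y <= 1 -> 0 <= step n y <= 1.
Proof.
move=> /andP[y0 y1]; have yn0 := exprn_ge0 n y0; have yn1 := exprn_ile1 n y0 y1.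
apply/andP; split; first by rewrite exprn_ge0// subr_ge0.
by apply: exprn_ile1; lra.
Qed.

(** Bernoulli's inequality bounds [step n y] below by 1 - (2y)^n. *)
Lemma step_cvg1 y : 0 <= y < 2^-1 -> step n y @[n --> \oo] --> (1 : R).
Proof.
move=> /andP[y0 y2].
apply: (@squeeze_cvgr _ _ _ _ (fun n => 1 - (2 * y) ^+ n) (fun=> 1)).
- apply: nearW => n; have /andP[_ ->] := @step_itv n y ltac:(lra).
  have yn1 := exprn_ile1 n y0 ltac:(lra).
  rewrite andbT /step.
  have := @bernoulli (- y ^+ n) (2 ^ n) ltac:(lra).
  by rewrite mulrN exprMn -natrX.
- rewrite -[X in _ --> X]subr0; apply: cvgB; first exact: cvg_cst.
  by apply: cvg_expr; rewrite ger0_norm; lra.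
- exact: cvg_cst.
Qed.

(** With t = y^n and N = 2^n, one has (1 - t)^N (1 + t)^N <= 1, while Bernoulli's inequality bounds
    (1 + t)^N below by (2y)^n. *)
Lemma step_cvg0 y : 2^-1 < y <= 1 -> step n y @[n --> \oo] --> (0 : R).
Proof.
move=> /andP[y2 y1].
apply: (@squeeze_cvgr _ _ _ _ (fun=> 0) (fun n => (2 * y)^-1 ^+ n)).
- apply: nearW => n; have /andP[-> _] := @step_itv n y ltac:(lra).
  have yn0 : 0 <= y ^+ n by apply: exprn_ge0; lra.
  have yn1 := @exprn_ile1 R n y ltac:(lra) y1.
  have y2n : 0 < (2 * y) ^+ n by apply: exprn_gt0; lra.
  rewrite /= /step exprVn -[leRHS]mul1r ler_pdivlMr//.
  have B := @bernoulli (y ^+ n) (2 ^ n) ltac:(lra).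
  have : (1 - y ^+ n) ^+ (2 ^ n) * (1 + y ^+ n) ^+ (2 ^ n) <= 1.
    rewrite -exprMn; apply: exprn_ile1; first by apply: mulr_ge0; lra.
    by have := mulr_ge0 yn0 yn0; lra.
  apply: le_trans; apply: ler_wpM2l; first by apply: exprn_ge0; lra.
  by apply: le_trans B; rewrite exprMn -natrX; lra.
- exact: cvg_cst.
- apply: cvg_expr; rewrite ger0_norm; last by rewrite invr_ge0; lra.
  by rewrite invf_lt1; lra.
Qed.

Lemma ae_neq (c : R) : {ae mu, forall t, t != c}.
Proof.
exists [set c]; split => //; first exact: lebesgue_measure_set1.
by move=> t /= /negP; rewrite negbK => /eqP.
Qed.

(** The indicator of [0, x] is an almost everywhere limit, on the period, of trigonometric
    polynomials with values in [0, 1]; dominated convergence with bound |u| does the rest. *)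
Lemma Rintegral_interval0 u :
  intble u -> (forall v, trigpoly v -> mean (fun t => u t * v t) = 0) ->
  forall x, 0 <= x <= 2 * pi -> Rintegral mu `[0, x] u = 0.
Proof.
move=> iu u0 x /andP[x0 x2].
have pi0 := pi_gt0 R.
(* The trigonometric polynomial y is < 1/2 on ]0, x[ and > 1/2 on ]x, 2 pi[. *)
pose y t : R := 2^-1 - 2^-1 * (sin (t / 2) * sin ((x - t) / 2)).
(* Product-to-sum removes the half-angles in t, so y is a trigonometric polynomial in t itself. *)
have yE t : y t = 2^-1 - 4^-1 * (cos t * cos (x / 2) + sin t * sin (x / 2) - cos (x / 2)).
  rewrite /y -cosB.
  have -> : t - x / 2 = t / 2 - (x - t) / 2 by field.
  have -> : x / 2 = t / 2 + (x - t) / 2 by field.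
  by rewrite cosB cosD; field.
have Ty : trigpoly y.
  rewrite (_ : y = fun t => 2^-1 + (- 4^-1) * (cos t * cos (x / 2) + sin t * sin (x / 2) + - cos (x / 2))).
    apply: trigpolyD; first exact: trigpoly_cst.
    apply: trigpolyM; first exact: trigpoly_cst.
    apply: trigpolyD; last exact: trigpoly_cst.
    apply: trigpolyD; apply: trigpolyM; try exact: trigpoly_cst.
      exact: trigpoly_cos.
    exact: trigpoly_sin.
  by apply/funext => t; rewrite yE mulNr.
have y01 t : 0 <= y t <= 1.
  have s1 := sin_max (t / 2); have s2 := sin_max ((x - t) / 2).
  have : `|sin (t / 2) * sin ((x - t) / 2)| <= 1.
    by rewrite normrM mulr_ile1.
  by rewrite ler_norml /y => /andP[? ?]; apply/andP; split; lra.
have Ts n : trigpoly (fun t => step n (y t)).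
  apply: trigpolyX.
  rewrite (_ : (fun t => _) = (fun t => 1 + (-1) * y t ^+ n)).
    apply: trigpolyD; first exact: trigpoly_cst.
    by apply: trigpolyM; [exact: trigpoly_cst|exact: trigpolyX].
  by apply/funext => t; rewrite mulN1r.
have my : measurable_fun (@period R) y.
  have mc : measurable_fun (@period R) cos.
    by apply: (measurable_funS measurableT) => //;
      apply: continuous_measurable_fun; exact: continuous_cos.
  have ms : measurable_fun (@period R) sin.
    by apply: (measurable_funS measurableT) => //;
      apply: continuous_measurable_fun; exact: continuous_sin.
  rewrite (_ : y = fun t => 2^-1 - 4^-1 * (cos t * cos (x / 2) + sin t * sin (x / 2) - cos (x / 2))).
    apply: measurable_funB => //; apply: measurable_funM => //.
    apply: measurable_funB => //.
    by apply: measurable_funD; apply: measurable_funM.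
  by apply/funext => t; rewrite yE.
have mstep n : measurable_fun (@period R) (fun t => step n (y t)).
  apply: measurable_funX; apply: measurable_funB => //.
  exact: measurable_funX.
have mU := intble_meas iu.
pose u_ n t : \bar R := (u t * step n (y t))%:E.
pose l t : \bar R := (u t * \1_(`[0, x]%classic : set R) t)%:E.
(* The excluded points 0, x and 2 pi are those where y = 1/2 and the steps need not converge to the
   indicator. *)
have lim : {ae mu, forall t, period t -> u_ ^~ t @ \oo --> l t}.
  have := aeI (aeI (ae_neq 0) (ae_neq x)) (ae_neq (2 * pi)).
  apply: aeS => t [[t0 tx] t2]; rewrite /period/= in_itv/= => /andP[t0' t2'].
  have {t0 t0'} t0 : 0 < t by rewrite lt_neqAle eq_sym t0.
  have {t2 t2'} t2 : t < 2 * pi by rewrite lt_neqAle t2.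
  rewrite /u_ /l; apply: cvg_EFin; first exact: nearW.
  apply: cvgM; first exact: cvg_cst.
  have st : 0 < sin (t / 2) by apply: sin_gt0_pi; apply/andP; split; lra.
  have [xt|xt] := ltP x t.
    rewrite indicE (_ : (t \in _) = false); last first.
      by apply/negP => /set_mem /=; rewrite in_itv/= (ltW t0)/= leNgt xt.
    have /andP[_ y1] := y01 t; apply: (@step_cvg0 (y t)); rewrite y1 andbT /y.
    have : 0 < sin ((t - x) / 2) by apply: sin_gt0_pi; apply/andP; split; lra.
    have -> : (x - t) / 2 = - ((t - x) / 2) by field.
    by rewrite sinN => /(mulr_gt0 st); lra.
  rewrite indicE (_ : (t \in _) = true); last first.
    by apply/mem_set => /=; rewrite in_itv/= (ltW t0) xt.
  have {}xt : t < x by rewrite lt_neqAle tx.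
  have /andP[y0 _] := y01 t; apply: (@step_cvg1 (y t)); rewrite y0 /= /y.
  have : 0 < sin ((x - t) / 2) by apply: sin_gt0_pi; apply/andP; split; lra.
  by move=> /(mulr_gt0 st); lra.
have [] := @dominated_convergence _ _ _ mu _ (@measurable_period R) u_ l
  (fun t => `|u t|%:E).
- by move=> n; have /measurable_EFinP := measurable_funM mU (mstep n).
- have mI : measurable_fun (@period R) (\1_(`[0, x]%classic : set R) : R -> R).
    exact: measurable_indic.
  by have /measurable_EFinP := measurable_funM mU mI.
- exact: lim.
- exact: (intble_norm iu).
- apply: aeW => t n pt; rewrite /u_ /= lee_fin normrM ler_piMr//.
  by have /andP[? ?] := step_itv n (y01 t); rewrite ger0_norm.
move=> il _ cl.
have u_0 n : (\int[mu]_(t in @period R) u_ n t = 0)%E.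
  have := u0 _ (Ts n); rewrite /mean => /eqP.
  rewrite mulf_eq0 invr_eq0 gt_eqF ?twopi_gt0//= => /eqP.
  rewrite /Rintegral => H.
  rewrite -[LHS]fineK ?H//.
  apply: (@integrable_fin_num _ _ _ mu) => //; first exact: measurable_period.
  apply: (@intble_le R _ (fun t => `|u t|)).
  - exact: measurable_funM.
  - move=> t pt; rewrite normrM ler_piMr//.
    by have /andP[? ?] := step_itv n (y01 t); rewrite ger0_norm.
  - exact: intble_norm.
have : (\int[mu]_(t in @period R) l t = 0)%E.
  have <- := cvg_lim (@ereal_hausdorff R) cl.
  by under eq_fun do rewrite u_0; rewrite lim_cst.
rewrite /l /Rintegral.
have -> : (fun t => (u t * \1_(`[0, x]%classic : set R) t)%:E) = ((EFin \o u) \_ `[0, x]).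
  apply/funext => t; rewrite patchE indicE; case: (t \in _) => /=.
    by rewrite mulr1.
  by rewrite mulr0.
rewrite -integral_mkcondr setIidr; first by move=> ->.
by move=> t; rewrite /period /= !in_itv/= => /andP[-> ?]/=; lra.
Qed.

(** At almost every t the primitive of u has derivative u t, by Lebesgue differentiation, and this
    primitive is constantly 0 on the period. Extending u by 0 outside the period makes it locally
    integrable on the line. *)
Lemma ae0_of_Rintegral_interval0 u : intble u ->
  (forall x, 0 <= x <= 2 * pi -> Rintegral mu `[0, x] u = 0) ->
  {ae mu, forall t, period t -> u t = 0}.
Proof.
move=> iu u0; pose f := u \_ (@period R).
have iff : mu.-integrable (@period R) (EFin \o f).
  apply: eq_integrable iu; first exact: measurable_period.
  by move=> t tp; rewrite /= /f patchE tp.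
have /lebesgue_differentiation := integrable_locally_restrict (@measurable_period R) iu.
move=> /(aeI (ae_neq 0)) /(aeI (ae_neq (2 * pi))).
apply: aeS => t [t2 [t0 lt]]; rewrite /period/= in_itv/= => /andP[t0' t2'].
have {t0 t0'} t0 : 0 < t by rewrite lt_neqAle eq_sym t0.
have {t2 t2'} t2 : t < 2 * pi by rewrite lt_neqAle t2.
have [_] := @FTC1_lebesgue_pt R f (BLeft 0) t (2 * pi) t2 iff t0 lt.
set F := (fun y => _).
have F0 y : 0 <= y <= 2 * pi -> F y = 0.
  move=> y02; rewrite -(u0 _ y02); apply: eq_Rintegral => s /set_mem /=.
  rewrite in_itv/= => /andP[s0 sy]; rewrite /f patchE mem_set//.
  by rewrite /period /= in_itv/= s0 (le_trans sy)//; case/andP: y02.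
rewrite {1}/f patchE mem_set; last by rewrite /period/= in_itv/= !ltW.
move=> <-; rewrite derive1E (@near_eq_derive _ _ _ _ (cst 0))//.
  exact: derive_cst.
near=> y; apply: F0; apply/andP; split; apply/ltW; near: y.
  exact: lt_nbhsr.
exact: lt_nbhsl.
Unshelve. all: by end_near. Qed.

(** Integrability, rather than square integrability, is the right generality: besides L^2
    uniqueness, this is applied to |theta|^2 - 1 for a theta only known to be in L^2. *)
Theorem cmean_monomial_eq0 f : L1 f ->
  (forall n, cmean (fun z => f z * monomial n z) = 0) -> aeq f (fun=> 0).
Proof.
move=> fi f0.
have Hr : {ae mu, forall t, period t -> complex.Re (f (circ t)) = 0}.
  apply: ae0_of_Rintegral_interval0; first exact: fi.1.
  apply: Rintegral_interval0; first exact: fi.1.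
  by move=> v /(mean_trigpoly fi f0)[].
have Hi : {ae mu, forall t, period t -> complex.Im (f (circ t)) = 0}.
  apply: ae0_of_Rintegral_interval0; first exact: fi.2.
  apply: Rintegral_interval0; first exact: fi.2.
  by move=> v /(mean_trigpoly fi f0)[].
apply: aeS (aeI Hr Hi) => t [H1 H2] pt.
by apply/eqP; rewrite eq_complex H1// H2//= !eqxx.
Qed.

End FourierUniqueness.

(** * The space L^2 *)

Section SquareIntegrable.
Context {R : realType}.
Implicit Types (f g h b u : R[i] -> R[i]).

Local Notation mu := (@lebesgue_measure R).
Local Notation normc := ComplexField.Normc.normc.
Local Notation normcM := ComplexField.Normc.normcM.

Lemma aeq_refl f : aeq f f.
Proof. exact: ae_circW. Qed.

Lemma aeq_sym f g : aeq f g -> aeq g f.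
Proof. by apply: ae_circS => t ->. Qed.

Lemma aeq_trans f g h : aeq f g -> aeq g h -> aeq f h.
Proof. by apply: ae_circS2 => t -> ->. Qed.

Lemma L2_meas f : L2 f -> circ_measurable f. Proof. by case. Qed.

Lemma L2_ae_le f g (M : R) : circ_measurable f -> L2 g ->
  ae_circ (fun z => normc (f z) <= M * normc (g z)) -> L2 f.
Proof.
move=> mf [mg ig] fg; split => //.
apply: (@intble_ae_le R _ (fun t => M ^+ 2 * normc (g (circ t)) ^+ 2)).
- exact: circ_meas_normc.
- apply: aeS fg => t fg pt; rewrite ger0_norm ?sqr_ge0// -exprMn.
  by rewrite lerXn2r// ?nnegrE ?normc_ge0// (le_trans _ (fg pt))// normc_ge0.
- exact: intbleZ.
Qed.

Lemma L1M f g : L2 f -> L2 g -> L1 (fun z => f z * g z).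
Proof.
move=> [mf fi] [mg gi].
apply: (@L1_le R _ (fun t => normc (f (circ t)) ^+ 2 + normc (g (circ t)) ^+ 2)).
- exact: circ_measM.
- move=> t pt; rewrite normcM.
  have := sqr_ge0 (normc (f (circ t)) - normc (g (circ t))).
  have := mulr_ge0 (normc_ge0 (f (circ t))) (normc_ge0 (g (circ t))).
  rewrite sqrrB; lra.
- exact: intbleD.
Qed.

Lemma L2Z (c : R[i]) f : L2 f -> L2 (fun z => c * f z).
Proof.
move=> fi; apply: (@L2_ae_le _ f (normc c)) => //.
  by apply: circ_measM; [exact: circ_meas_cst|exact: L2_meas].
by apply: ae_circW => t; rewrite normcM.
Qed.

Lemma L2D f g : L2 f -> L2 g -> L2 (fun z => f z + g z).
Proof.
move=> [mf fi] [mg gi]; have mfg := circ_measD mf mg; split => //.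
apply: (@intble_le R (fun t => normc (f (circ t) + g (circ t)) ^+ 2) (fun t => 2 * (normc (f (circ t)) ^+ 2 + normc (g (circ t)) ^+ 2))).
- exact: (circ_meas_normc mfg).
- move=> t pt; rewrite ger0_norm ?sqr_ge0//.
  case: (f _) => a b; case: (g _) => c d; rewrite !sqr_normcE /=.
  by have := sqr_ge0 (a - c); have := sqr_ge0 (b - d); rewrite !sqrrB !sqrrD; lra.
- by apply: intbleZ; exact: intbleD.
Qed.

Lemma L2_lin (a : R[i]) f g : L2 f -> L2 g -> L2 (fun z => a * f z + g z).
Proof. by move=> fi gi; apply: L2D gi; exact: L2Z. Qed.

Lemma L2N f : L2 f -> L2 (fun z => - f z).
Proof.
move=> /(L2Z (-1)); rewrite (_ : (fun z => -1 * f z) = (fun z => - f z))//.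
by apply/funext => z; rewrite mulN1r.
Qed.

Lemma L2B f g : L2 f -> L2 g -> L2 (fun z => f z - g z).
Proof. by move=> fi gi; apply: L2D fi _; exact: L2N. Qed.

Lemma L2_conj f : L2 f -> L2 (fun z => (f z)^*).
Proof.
move=> fi; apply: (@L2_ae_le _ f 1) => //.
  by apply: circ_meas_conj; exact: L2_meas.
by apply: ae_circW => t; rewrite normc_conj mul1r.
Qed.

Lemma L2_cst (c : R[i]) : L2 (fun=> c).
Proof. by split; [exact: circ_meas_cst|exact: intble_cst]. Qed.

Lemma L2_sum (I : Type) (s : seq I) (F : I -> R[i] -> R[i]) :
  (forall i, L2 (F i)) -> L2 (fun z => \sum_(i <- s) F i z).
Proof.
move=> LF; elim: s => [|i s IH].
  have -> : (fun z => \sum_(i <- [::]) F i z) = (fun=> 0).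
    by apply/funext => z; rewrite big_nil.
  exact: L2_cst.
have -> : (fun z => \sum_(j <- i :: s) F j z) = (fun z => F i z + \sum_(j <- s) F j z).
  by apply/funext => z; rewrite big_cons.
exact: L2D.
Qed.

Definition Linf b := circ_measurable b /\ essentially_bounded b.

Lemma essentially_boundedP b :
  essentially_bounded b <-> exists M : R, ae_circ (fun z => normc (b z) <= M).
Proof.
by split=> -[M H]; exists M; apply: ae_circS H => t; rewrite normr_normc lecR.
Qed.

Lemma L2M_Linf b f : Linf b -> L2 f -> L2 (fun z => b z * f z).
Proof.
move=> [mb /essentially_boundedP[M bM]] fi; apply: (@L2_ae_le _ f M) => //.
  by apply: circ_measM => //; exact: L2_meas.
apply: ae_circS bM => t bM; rewrite normcM.
by apply: ler_wpM2r => //; exact: normc_ge0.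
Qed.

Lemma Linf_L2 b : Linf b -> L2 b.
Proof.
move=> /L2M_Linf /(_ (L2_cst 1)).
rewrite (_ : (fun z => b z * 1) = b)//.
by apply/funext => z; rewrite mulr1.
Qed.

Lemma LinfM b u : Linf b -> Linf u -> Linf (fun z => b z * u z).
Proof.
move=> [mb /essentially_boundedP[M bM]] [mu' /essentially_boundedP[N uN]].
split; first exact: circ_measM.
apply/essentially_boundedP; exists (M * N); apply: ae_circS2 bM uN => t bM uN.
by rewrite normcM ler_pM// normc_ge0.
Qed.

Lemma Linf_conj b : Linf b -> Linf (fun z => (b z)^*).
Proof.
move=> [mb /essentially_boundedP[M bM]].
split; first exact: circ_meas_conj.
apply/essentially_boundedP; exists M; apply: ae_circS bM => t bM.
by rewrite normc_conj.
Qed.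

(** Unimodularity without analyticity: quotients such as conj(theta) b1 are of this kind before they
    are known to be inner. *)
Definition Uni u := circ_measurable u /\ ae_circ (fun z => `|u z| = 1).

Lemma UniP u : Uni u <-> circ_measurable u /\ ae_circ (fun z => u z * (u z)^* = 1).
Proof.
split=> -[mu' u1]; split => //; apply: ae_circS u1 => t.
  by rewrite mul_conj_normc normr_normc => -[->]; rewrite expr1n.
rewrite mul_conj_normc normr_normc => -[] /eqP.
by rewrite sqrp_eq1 ?normc_ge0// => /eqP ->.
Qed.

Lemma Uni_Linf u : Uni u -> Linf u.
Proof.
move=> [mu' u1]; split => //; exists 1; apply: ae_circS u1 => t ->.
exact: lexx.
Qed.

Lemma UniM u b : Uni u -> Uni b -> Uni (fun z => u z * b z).
Proof.
move=> [mu' u1] [mb b1]; split; first exact: circ_measM.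
by apply: ae_circS2 u1 b1 => t u1 b1; rewrite normrM u1 b1 mulr1.
Qed.

Lemma Uni_conj u : Uni u -> Uni (fun z => (u z)^*).
Proof.
move=> [mu' u1]; split; first exact: circ_meas_conj.
by apply: ae_circS u1 => t; rewrite !normr_normc normc_conj.
Qed.

Lemma normc_monomial (n : int) t : normc (monomial n (circ t : R[i])) = 1.
Proof.
have nX m : normc (circ t ^+ m : R[i]) = 1 by rewrite circX normc_circ.
rewrite /monomial; case: n => n; first by rewrite -exprnP nX.
by rewrite NegzE -exprz_inv -exprnP exprVn ComplexField.Normc.normcV nX invr1.
Qed.

Lemma Uni_monomial (n : int) : Uni (@monomial R n).
Proof.
split; first exact: circ_meas_monomial.
by apply: ae_circW => t; rewrite normr_normc normc_monomial.
Qed.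

Lemma L2_monomial (n : int) : L2 (@monomial R n).
Proof. exact/Linf_L2/Uni_Linf/Uni_monomial. Qed.

Lemma monomialD (m n : int) t :
  monomial (m + n) (circ t : R[i]) = monomial m (circ t) * monomial n (circ t).
Proof. by rewrite /monomial expfzDr// circ_neq0. Qed.

Lemma monomial0 (z : R[i]) : monomial 0 z = 1.
Proof. by []. Qed.

(** * Inner product and norm of L^2 *)

Lemma ip_lin (a : R[i]) f g h : L2 f -> L2 g -> L2 h ->
  ip (fun z => a * f z + g z) h = a * ip f h + ip g h.
Proof.
move=> fi gi /L2_conj hi; rewrite /ip.
rewrite -(cmeanZ a (L1M fi hi)) -(cmeanD (L1Z a (L1M fi hi)) (L1M gi hi)).
by apply: cmean_eq => t; rewrite mulrDl mulrA.
Qed.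

Lemma ipZ (a : R[i]) f h : L2 f -> L2 h ->
  ip (fun z => a * f z) h = a * ip f h.
Proof.
move=> fi /L2_conj hi; rewrite /ip -(cmeanZ a (L1M fi hi)).
by apply: cmean_eq => t; rewrite mulrA.
Qed.

Lemma ipB f g h : L2 f -> L2 g -> L2 h ->
  ip (fun z => f z - g z) h = ip f h - ip g h.
Proof.
move=> fi gi hi; rewrite addrC -mulN1r -ip_lin//; congr ip.
by apply/funext => z; rewrite mulN1r addrC.
Qed.

Lemma ip_sym f g : L2 f -> L2 g -> ip g f = (ip f g)^*.
Proof.
move=> fi gi; rewrite /ip -cmean_conj; last by apply: L1M => //; exact: L2_conj.
by apply: cmean_eq => t; rewrite rmorphM /= conjCK mulrC.
Qed.

Lemma ip_eq0_sym f g : L2 f -> L2 g -> ip f g = 0 -> ip g f = 0.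
Proof. by move=> fi gi fg; rewrite ip_sym// fg conjC0. Qed.

Lemma ip_sum (I : Type) (s : seq I) (F : I -> R[i] -> R[i]) h :
  (forall i, L2 (F i)) -> L2 h ->
  ip (fun z => \sum_(i <- s) F i z) h = \sum_(i <- s) ip (F i) h.
Proof.
move=> LF /L2_conj hi; rewrite /ip.
have := @cmean_sum R _ s (fun i z => F i z * (h z)^*) (fun i => L1M (LF i) hi).
by move=> [_ <-]; apply: cmean_eq => t; rewrite mulr_suml.
Qed.

Lemma ip_ae f f' g g' : circ_measurable f -> circ_measurable f' ->
  circ_measurable g -> circ_measurable g' ->
  aeq f f' -> aeq g g' -> ip f g = ip f' g'.
Proof.
move=> mf mf' mg mg' ff' gg'; apply: cmean_ae.
- by apply: circ_measM => //; exact: circ_meas_conj.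
- by apply: circ_measM => //; exact: circ_meas_conj.
- by apply: ae_circS2 ff' gg' => t -> ->.
Qed.

Lemma ip_mulA b f g : ip (fun z => b z * f z) g = ip f (fun z => (b z)^* * g z).
Proof. by apply: cmean_eq => t; rewrite rmorphM /= conjCK; ring. Qed.

Lemma ip_mulC b f g : ip f (fun z => b z * g z) = ip (fun z => (b z)^* * f z) g.
Proof. by apply: cmean_eq => t; rewrite rmorphM /=; ring. Qed.

Lemma ip_uni u f g : Uni u -> L2 f -> L2 g ->
  ip (fun z => u z * f z) (fun z => u z * g z) = ip f g.
Proof.
move=> Uu fi gi; have [mu' u1] := (UniP u).1 Uu.
apply: cmean_ae.
- by apply: circ_measM; [|apply: circ_meas_conj]; apply: circ_measM => //; exact: L2_meas.
- by apply: circ_measM; [|apply: circ_meas_conj]; exact: L2_meas.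
- apply: ae_circS u1 => t u1; rewrite rmorphM /=.
  by rewrite mulrACA u1 mul1r.
Qed.

Lemma norm2_ge0 f : 0 <= norm2 f. Proof. exact: sqrtr_ge0. Qed.

Lemma norm2E f : norm2 f ^+ 2 = mean (fun t => normc (f (circ t)) ^+ 2).
Proof. by rewrite /norm2 sqr_sqrtr// mean_ge0// => t _; rewrite sqr_ge0. Qed.

Lemma ip_norm2 f : ip f f = (norm2 f ^+ 2)%:C.
Proof.
rewrite norm2E /ip /cmean.
have -> : (fun t => complex.Re (f (circ t) * (f (circ t))^*)) =
          (fun t => normc (f (circ t)) ^+ 2).
  by apply/funext => t; rewrite mul_conj_normc.
have -> : (fun t => complex.Im (f (circ t) * (f (circ t))^*)) = (fun=> 0).
  by apply/funext => t; rewrite mul_conj_normc.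
by rewrite mean_cst.
Qed.

Lemma norm2_eq0 f : L2 f -> norm2 f = 0 -> aeq f (fun=> 0).
Proof.
move=> [mf fi] f0; have := norm2E f; rewrite f0 expr0n /= => /esym.
move=> /(mean_eq0 fi (fun t _ => sqr_ge0 _)).
apply: aeS => t H pt; have /eqP := H pt.
by rewrite sqrf_eq0 => /eqP/ComplexField.Normc.eq0_normc.
Qed.

Lemma norm2_ae f g : circ_measurable f -> circ_measurable g -> aeq f g ->
  norm2 f = norm2 g.
Proof.
move=> mf mg fg; rewrite /norm2; congr Num.sqrt; apply: mean_ae.
- exact: circ_meas_normc.
- exact: circ_meas_normc.
- by apply: aeS fg => t fg pt; rewrite fg.
Qed.

Lemma norm2_cst (c : R[i]) : norm2 (fun=> c) = normc c.
Proof. by rewrite /norm2 mean_cst sqrtr_sqr ger0_norm// normc_ge0. Qed.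

(** * Fourier coefficients *)

Lemma fourierM f (m n : int) :
  fourier (fun z => monomial m z * f z) n = fourier f (n - m).
Proof.
apply: cmean_eq => t; rewrite !monomial_circ_conj opprB addrC monomialD; ring.
Qed.

Lemma mean_derive (F f : R -> R) : (forall t, is_derive t (1 : R) F (f t)) ->
  continuous f -> mean f = (2 * pi)^-1 * (F (2 * pi) - F 0).
Proof.
move=> dF cf; congr (_ * _).
have cF : continuous F.
  by move=> t; apply/differentiable_continuous/derivable1_diffP; exact: ex_derive.
rewrite /Rintegral (@continuous_FTC2 R f F)//.
- exact: twopi_gt0.
- exact: continuous_subspaceT.
- split => [t _||]; first exact: ex_derive.
  + exact/cvg_at_right_filter/cF.
  + exact/cvg_at_left_filter/cF.
- by move=> t _; rewrite derive1E; exact: derive_val.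
Qed.

Lemma cmean_circX (n : nat) : cmean (fun z : R[i] => z ^+ n.+1) = 0.
Proof.
have n0 : n.+1%:R != 0 :> R by rewrite pnatr_eq0.
have cl : continuous (fun t : R => n.+1%:R * t).
  by move=> t; apply: cvgM; [exact: cvg_cst|exact: cvg_id].
have dl (t : R) : is_derive t (1 : R) (fun t : R => n.+1%:R * t) n.+1%:R.
  apply: is_derive_eq.
  by rewrite /GRing.scale/= mulr1.
have s2 : sin (n.+1%:R * (2 * pi)) = 0 :> R.
  have := circX (2 * pi : R) n.+1; rewrite circ2pi expr1n => /eqP.
  by rewrite eq_complex => /andP[_ /eqP]/= <-.
have c2 : cos (n.+1%:R * (2 * pi)) = 1 :> R.
  have := circX (2 * pi : R) n.+1; rewrite circ2pi expr1n => /eqP.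
  by rewrite eq_complex => /andP[/eqP/= <-].
apply/eqP; rewrite eq_complex /=; apply/andP; split; apply/eqP.
  have -> : (fun t => complex.Re (circ t ^+ n.+1)) = (fun t => cos (n.+1%:R * t)) :> (R -> R).
    by apply/funext => t; rewrite circX.
  have d t : is_derive t (1 : R) (fun t => n.+1%:R^-1 * sin (n.+1%:R * t)) (cos (n.+1%:R * t)).
    have d1 : is_derive t (1 : R) (sin \o (fun t : R => n.+1%:R * t)) (cos (n.+1%:R * t) * n.+1%:R).
      exact: is_derive1_comp.
    apply: is_derive_eq.
    by rewrite /GRing.scale/= mulrCA mulVf// mulr1.
  rewrite (mean_derive d); first by rewrite s2 !mulr0 sin0 mulr0 subrr mulr0.
  by move=> t; apply: continuous_comp; [exact: cl|exact: continuous_cos].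
have -> : (fun t => complex.Im (circ t ^+ n.+1)) = (fun t => sin (n.+1%:R * t)) :> (R -> R).
  by apply/funext => t; rewrite circX.
have d t : is_derive t (1 : R) (fun t => - n.+1%:R^-1 * cos (n.+1%:R * t)) (sin (n.+1%:R * t)).
  have d1 : is_derive t (1 : R) (cos \o (fun t : R => n.+1%:R * t)) (- sin (n.+1%:R * t) * n.+1%:R).
    exact: is_derive1_comp.
  apply: is_derive_eq.
  by rewrite /GRing.scale/= mulrCA !mulNr mulrN opprK mulVf// mulr1.
rewrite (mean_derive d); first by rewrite c2 mulr0 cos0 subrr mulr0.
by move=> t; apply: continuous_comp; [exact: cl|exact: continuous_sin].
Qed.

Lemma fourier_monomial (m n : int) : fourier (@monomial R m) n = (m == n)%:R.
Proof.
suff H (j : int) : cmean (@monomial R j) = (j == 0)%:R.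
  have -> : fourier (@monomial R m) n = cmean (@monomial R (m - n)).
    by apply: cmean_eq => t; rewrite monomial_circ_conj monomialD.
  by rewrite H subr_eq0.
have H k : cmean (@monomial R (Posz k.+1)) = 0 by exact: cmean_circX.
case: j => [[|k]|k]; [|exact: H|].
  rewrite eqxx (_ : cmean _ = cmean (fun=> 1)); last exact: cmean_eq.
  by rewrite /cmean !mean_cst.
have -> : cmean (@monomial R (Negz k)) = (cmean (@monomial R (Posz k.+1)))^*.
  rewrite -cmean_conj; last first.
    by apply: L1_eq (L1M (L2_monomial k.+1) (L2_cst 1)) => t; exact: mulr1.
  by apply: cmean_eq => t; rewrite monomial_circ_conj NegzE.
by rewrite H conjC0.
Qed.

Lemma fourier_unique f : L2 f -> (forall n, fourier f n = 0) -> aeq f (fun=> 0).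
Proof.
move=> fi f0; apply: cmean_monomial_eq0.
  apply: L1_eq (L1M fi (L2_cst 1)) => t.
  exact: mulr1.
move=> n; rewrite -[RHS](f0 (- n)); apply: cmean_eq => t.
by rewrite monomial_circ_conj opprK.
Qed.

Lemma fourier_aeq f g : L2 f -> L2 g -> (forall n, fourier f n = fourier g n) ->
  aeq f g.
Proof.
move=> fi gi fg; have H : aeq (fun z => f z - g z) (fun=> 0).
  apply: fourier_unique; first exact: L2B.
  move=> n; rewrite /fourier ipB//; last exact: L2_monomial.
  by rewrite -/(fourier f n) fg subrr.
by apply: ae_circS H => t /eqP; rewrite subr_eq0 => /eqP.
Qed.

End SquareIntegrable.

(** * Semi-Hilbert spaces *)

Section SemiHilbert.
Context {R : realType} {V : lmodType R[i]} (ip : V -> V -> R[i]).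
Local Notation normc := ComplexField.Normc.normc.

Hypothesis ip_linl : forall a u v w, ip (a *: u + v) w = a * ip u w + ip v w.
Hypothesis ip_symm : forall u v, ip v u = (ip u v)^*.
Hypothesis ip_ge0 : forall u, 0 <= ip u u.

(** The square of the seminorm. A vector with [sqn] equal to 0 need not be 0, since functions that
    agree almost everywhere stay distinct; conclusions are therefore about values of [ip] and
    [sqn]. *)
Definition sqn (u : V) : R := complex.Re (ip u u).

Hypothesis complete : forall s : nat -> V,
  (forall e : R, 0 < e -> exists N, forall m n, (N <= m)%N -> (N <= n)%N ->
    sqn (s m - s n) <= e) ->
  exists l, forall e : R, 0 < e -> exists N, forall n, (N <= n)%N ->
    sqn (s n - l) <= e.

Lemma sqnE u : ip u u = (sqn u)%:C.
Proof. by have := ip_ge0 u; rewrite lecE /sqn; case: (ip u u) => a b /= /andP[/eqP-> _]. Qed.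

Lemma sqn_ge0 u : 0 <= sqn u.
Proof. by rewrite -(@lecR R) -sqnE. Qed.

Lemma sh_ipDl u v w : ip (u + v) w = ip u w + ip v w.
Proof. by rewrite -{1}[u]scale1r ip_linl mul1r. Qed.

Lemma sh_ip0l w : ip 0 w = 0.
Proof. by apply: (addrI (ip 0 w)); rewrite -sh_ipDl !addr0. Qed.

Lemma sh_ipZl a u w : ip (a *: u) w = a * ip u w.
Proof. by rewrite -[a *: u]addr0 ip_linl sh_ip0l addr0. Qed.

Lemma sh_ipNl u w : ip (- u) w = - ip u w.
Proof. by rewrite -scaleN1r sh_ipZl mulN1r. Qed.

Lemma sh_ipBl u v w : ip (u - v) w = ip u w - ip v w.
Proof. by rewrite sh_ipDl sh_ipNl. Qed.

Lemma sh_ip_conj u v : (ip u v)^* = ip v u.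
Proof. by rewrite [RHS]ip_symm. Qed.

Lemma sh_ipDr u v w : ip w (u + v) = ip w u + ip w v.
Proof. by rewrite ip_symm sh_ipDl rmorphD /= !sh_ip_conj. Qed.

Lemma sh_ipZr a u w : ip w (a *: u) = a^* * ip w u.
Proof. by rewrite ip_symm sh_ipZl rmorphM /= !sh_ip_conj. Qed.

Lemma sh_ipNr u w : ip w (- u) = - ip w u.
Proof. by rewrite ip_symm sh_ipNl rmorphN /= !sh_ip_conj. Qed.

Lemma sh_ipBr u v w : ip w (u - v) = ip w u - ip w v.
Proof. by rewrite sh_ipDr sh_ipNr. Qed.

Lemma sh_ip_suml (I : Type) (s : seq I) (P : pred I) (F : I -> V) w :
  ip (\sum_(i <- s | P i) F i) w = \sum_(i <- s | P i) ip (F i) w.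
Proof.
apply: (big_morph (fun u => ip u w)) => [u v|]; first exact: sh_ipDl.
exact: sh_ip0l.
Qed.

Lemma sh_ip_sumr (I : Type) (s : seq I) (P : pred I) (F : I -> V) w :
  ip w (\sum_(i <- s | P i) F i) = \sum_(i <- s | P i) ip w (F i).
Proof.
apply: (big_morph (ip w)) => [u v|]; first exact: sh_ipDr.
by rewrite ip_symm sh_ip0l conjC0.
Qed.

Lemma sqn_subZ u v (a : R[i]) :
  sqn (u - a *: v) =
  sqn u - 2 * complex.Re (a^* * ip u v) + normc a ^+ 2 * sqn v.
Proof.
apply/(@complexI R); rewrite -sqnE sh_ipBl !sh_ipBr !sh_ipZl !sh_ipZr.
rewrite !sqnE rcD rcB [(2 * _)%:C]rcM [(normc a ^+ 2 * _)%:C]rcM -mul_conj_normc.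
rewrite [ip v u]ip_symm.
have -> : (2%:R)%:C * (complex.Re (a^* * ip u v))%:C = a^* * ip u v + a * (ip u v)^*.
  have -> : a * (ip u v)^* = (a^* * ip u v)^* by rewrite rmorphM /= conjCK.
  have -> : (2 : R)%:C = 2 by exact: (rmorph_nat (real_complex R) 2).
  by rewrite [(_ * _)^*]conjcE addcJ.
have E (x p q t : R[i]) : x - p - (q - t) = x - (p + q) + t by ring.
by rewrite E mulrA.
Qed.

Lemma sqnN u : sqn (- u) = sqn u.
Proof. by rewrite /sqn sh_ipNl sh_ipNr opprK. Qed.

Lemma sqnZ a u : sqn (a *: u) = normc a ^+ 2 * sqn u.
Proof.
apply/(@complexI R); rewrite -sqnE sh_ipZl sh_ipZr mulrA mul_conj_normc.
by rewrite sqnE [RHS]rcM.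
Qed.

Lemma parallelogram u v : sqn (u + v) + sqn (u - v) = 2 * (sqn u + sqn v).
Proof.
have := sqn_subZ u v (-1); have := sqn_subZ u v 1.
rewrite scaleN1r scale1r opprK => -> ->.
rewrite conj_N1 conj_1 mulN1r mul1r.
have -> : normc (-1 : R[i]) = 1 by rewrite normcN ComplexField.Normc.normc1.
rewrite ComplexField.Normc.normc1.
have -> : complex.Re (- ip u v) = - complex.Re (ip u v) by case: (ip u v).
ring.
Qed.

Lemma sqn_add_le u v : sqn (u + v) <= 2 * (sqn u + sqn v).
Proof. by have := parallelogram u v; have := sqn_ge0 (u - v); lra. Qed.

Lemma cauchy_schwarz u v : normc (ip u v) ^+ 2 <= sqn u * sqn v.
Proof.
have [su|su] := ltP 0 (sqn v); last first.
  have {su} sv : sqn v = 0 by apply/eqP; rewrite eq_le su sqn_ge0.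
  (* For v of seminorm 0, expanding [sqn] of u - c <u, v> v leaves no quadratic term in c, and an
     expression affine in c can be nonnegative for all real c only if <u, v> = 0. *)
  have H (c : R) : 0 <= sqn u - 2 * c * normc (ip u v) ^+ 2.
    have := sqn_ge0 (u - (c%:C * ip u v) *: v).
    rewrite sqn_subZ sv mulr0 addr0 rmorphM /=.
    have -> : (c%:C)^* * (ip u v)^* * ip u v = (c * normc (ip u v) ^+ 2)%:C.
      rewrite conj_rc -mulrA [_^* * _]mulrC mul_conj_normc.
      by rewrite rcM.
    by rewrite /= mulrA.
  rewrite sv mulr0; apply/ler_addgt0Pl => e e0; rewrite addr0.
  rewrite leNgt; apply/negP => lte.
  have := H (sqn u / e); rewrite subr_ge0.
  have [u0|u0] := ltP 0 (sqn u); last first.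
    have {}u0 : sqn u = 0 by apply/eqP; rewrite eq_le u0 sqn_ge0.
    by have := H 1; rewrite u0; lra.
  rewrite leNgt => /negP; apply.
  have : sqn u < sqn u / e * normc (ip u v) ^+ 2.
    by rewrite mulrAC -mulrA ltr_pMr// ltr_pdivlMr ?mul1r.
  by lra.
have := sqn_ge0 (u - (ip u v / (sqn v)%:C) *: v).
rewrite sqn_subZ ComplexField.Normc.normcM ComplexField.Normc.normcV.
have -> : normc (sqn v)%:C = sqn v.
  by rewrite /= expr0n/= addr0 sqrtr_sqr gtr0_norm.
have -> : (ip u v / (sqn v)%:C)^* * ip u v = (normc (ip u v) ^+ 2 / sqn v)%:C.
  rewrite rmorphM /= fmorphV /= conj_rc.
  by rewrite mulrAC [_^* * _]mulrC mul_conj_normc [RHS]rcM rcV.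
rewrite /= -(ler_pM2r su) mul0r exprMn exprVn.
have v0 : sqn v != 0 by rewrite gt_eqF.
set x := normc _ ^+ 2.
have -> : (sqn u - 2 * (x / sqn v) + x / sqn v ^+ 2 * sqn v) * sqn v = sqn u * sqn v - x.
  by field.
by rewrite subr_ge0.
Qed.

Lemma ip_cvg0 (s : nat -> V) l w :
  (forall e : R, 0 < e -> exists N, forall n, (N <= n)%N -> sqn (s n - l) <= e) ->
  (forall n, ip (s n) w = 0) -> ip l w = 0.
Proof.
move=> sl s0; apply: ComplexField.Normc.eq0_normc.
apply/eqP; rewrite -sqrf_eq0 eq_le sqr_ge0 andbT.
apply/ler_addgt0Pl => e e0; rewrite addr0.
have e' : 0 < e / (sqn w + 1) by rewrite divr_gt0// ltr_wpDl// sqn_ge0.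
have [N /(_ N (leqnn _)) H] := sl _ e'.
have := cauchy_schwarz (s N - l) w.
rewrite sh_ipBl s0 sub0r normcN => /le_trans; apply.
apply: (@le_trans _ _ (e / (sqn w + 1) * sqn w)).
  by apply: ler_wpM2r => //; exact: sqn_ge0.
have w0 := sqn_ge0 w.
by rewrite mulrAC ler_pdivrMr ?ltr_wpDl// ler_pM2l//; lra.
Qed.

(** Young's inequality: a small weight d keeps the first constant close to 1, where [sqn_add_le]
    loses a factor 2 and would spoil bounds in the limit. *)
Lemma sqn_add_eps (d : R) u v : 0 < d ->
  sqn (u + v) <= (1 + d) * sqn u + (1 + d^-1) * sqn v.
Proof.
move=> d0; have := sqn_subZ v u (-1); have := sqn_ge0 (v - d%:C *: u).
rewrite [sqn (v - -1 *: u)](_ : _ = sqn (u + v)); last by rewrite scaleN1r opprK addrC.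
rewrite sqn_subZ conj_N1 mulN1r conj_rc.
have -> : normc (-1 : R[i]) = 1 by rewrite normcN ComplexField.Normc.normc1.
rewrite sqr_normcE /= expr0n/= addr0 expr1n mul1r.
have -> : complex.Re (- ip v u) = - complex.Re (ip v u) by case: (ip v u).
have -> : complex.Re (d%:C * ip v u) = d * complex.Re (ip v u).
  by case: (ip v u) => a b; simpc.
move=> H ->; rewrite -subr_ge0.
have -> : (1 + d) * sqn u + (1 + d^-1) * sqn v -
   (sqn v - 2 * - complex.Re (ip v u) + sqn u) =
   d^-1 * (sqn v - 2 * (d * complex.Re (ip v u)) + d ^+ 2 * sqn u).
  by field; rewrite gt_eqF.
by rewrite mulr_ge0 ?invr_ge0 ?(ltW d0).
Qed.

Lemma sqn_lim_le (s : nat -> V) x l B N :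
  (forall e : R, 0 < e -> exists N, forall n, (N <= n)%N -> sqn (s n - l) <= e) ->
  (forall n, (N <= n)%N -> sqn (x - s n) <= B) -> sqn (x - l) <= B.
Proof.
move=> sl sB; have B0 : 0 <= B by apply: le_trans (sB N (leqnn _)); exact: sqn_ge0.
apply/ler_addgt0Pr => e e0.
(* The excess e is shared equally: this weight makes d B <= e / 2, and the distance from [s n] to l
   is then taken small enough to absorb the factor 1 + 1/d. *)
have d0 : 0 < e / 2 / (B + 1) by rewrite !divr_gt0//; lra.
set d := e / 2 / (B + 1) in d0.
have d1 : 0 < 1 + d^-1 by rewrite ltr_pwDl ?invr_ge0 ?(ltW d0).
have e'0 : 0 < e / 2 / (1 + d^-1) by rewrite !divr_gt0.
have [M HM] := sl _ e'0.
have := sqn_add_eps (x - s (maxn M N)) (s (maxn M N) - l) d0.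
rewrite addrA subrK => /le_trans; apply.
have H1 := HM _ (leq_maxl M N); have H2 := sB _ (leq_maxr M N).
rewrite ler_pdivlMr// in H1.
have : d * sqn (x - s (maxn M N)) <= e / 2.
  apply: (@le_trans _ _ (d * B)); first by rewrite ler_wpM2l// ltW.
  by rewrite /d mulrAC ler_pdivrMr ?ler_wpM2l//; lra.
by rewrite mulrDl mul1r; lra.
Qed.

(** The projection of x is the limit of a minimizing sequence. As the subspace is an annihilator,
    [ip_cvg0] shows that it contains this limit. *)
Lemma orthocomplement_projection (I : Type) (E : I -> V) (x : V) :
  exists y, (forall i, ip y (E i) = 0) /\
    forall h, (forall i, ip h (E i) = 0) -> ip (x - y) h = 0.
Proof.
pose S : set V := [set y | forall i, ip y (E i) = 0].
pose D : set R := [set sqn (x - y) | y in S].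
have S0 : S 0 by move=> i; exact: sh_ip0l.
have D0 : has_inf D.
  split; first by exists (sqn (x - 0)), 0.
  by exists 0 => _ [y _ <-]; exact: sqn_ge0.
have Slin a u v : S u -> S v -> S (a *: u + v).
  by move=> Su Sv i; rewrite ip_linl Su Sv mulr0 addr0.
have dle y : S y -> inf D <= sqn (x - y).
  by move=> Sy; apply: ge_inf; [exact: D0.2|exists y].
have ex n : exists y, S y /\ sqn (x - y) <= inf D + n.+1%:R^-1.
  have [_ [y Sy <-] H] := @inf_adherent R D n.+1%:R^-1 ltac:(by rewrite invr_gt0) D0.
  by exists y; split => //; exact: ltW.
have [s sP] := boolp.choice ex.
(* The midpoint of [s m] and [s n] lies in S and so is no closer to x than the infimum; the
   parallelogram law turns this into a Cauchy estimate. *)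
have half m n : sqn (s m - s n) <= 2 * (m.+1%:R^-1 + n.+1%:R^-1).
  have [Sm dm] := sP m; have [Sn dn] := sP n.
  have := parallelogram (x - s m) (x - s n).
  have -> : x - s m - (x - s n) = - (s m - s n) by rewrite opprB addrC addrA subrK opprB.
  rewrite sqnN.
  have -> : x - s m + (x - s n) = 2 *: (x - (2^-1 *: s m + 2^-1 *: s n)).
    rewrite scalerBr scalerDr !scalerA mulfV ?pnatr_eq0// !scale1r.
    by rewrite scaler_nat mulr2n opprD addrACA.
  rewrite sqnZ.
  have -> : normc (2 : R[i]) ^+ 2 = 4.
    by rewrite sqr_normcE /=; ring.
  have /dle : S (2^-1 *: s m + 2^-1 *: s n).
    apply: (Slin _ _ _ Sm); rewrite -[_ *: _]addr0; exact: Slin.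
  move: dm dn; set p := sqn (x - s m); set q := sqn (x - s n).
  set r := sqn (x - _); set t := sqn (s m - s n).
  set a := _^-1; set b := _^-1; set d := inf D.
  by lra.
have [y yl] : exists l, forall e : R, 0 < e -> exists N, forall n, (N <= n)%N ->
    sqn (s n - l) <= e.
  apply: complete => e e0.
  have e4 : 0 < e / 4 by rewrite divr_gt0.
  have [N _ H] := near_infty_natSinv_lt (PosNum e4).
  exists N => m n /H /= Nm /H /= Nn; apply: le_trans (half m n) _.
  move: Nm Nn; set p := m.+1%:R^-1; set q := n.+1%:R^-1; lra.
exists y.
have Sy : S y.
  move=> i; apply: (ip_cvg0 yl) => n; exact: (sP n).1.
split => // h Sh.
have dy : sqn (x - y) <= inf D.
  apply/ler_addgt0Pr => e e0.
  have [N _ H] := near_infty_natSinv_lt (PosNum e0).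
  apply: (sqn_lim_le yl (N := N)) => n /H /= Nn; have [_] := sP n.
  by move/le_trans; apply; rewrite lerD2l ltW.
have H (c : R) : 0 <= - 2 * c * normc (ip (x - y) h) ^+ 2 + c ^+ 2 * normc (ip (x - y) h) ^+ 2 * sqn h.
  pose a := c%:C * ip (x - y) h.
  have := dle (a *: h + y) (Slin _ _ _ Sh Sy).
  have -> : x - (a *: h + y) = (x - y) - a *: h by rewrite opprD [- _ - _]addrC addrA.
  rewrite sqn_subZ /a rmorphM /=.
  have -> : (c%:C)^* * (ip (x - y) h)^* * ip (x - y) h = (c * normc (ip (x - y) h) ^+ 2)%:C.
    rewrite conj_rc -mulrA [_^* * _]mulrC mul_conj_normc.
    by rewrite rcM.
  rewrite ComplexField.Normc.normcM exprMn.
  have -> : normc c%:C ^+ 2 = c ^+ 2 by rewrite sqr_normcE /= expr0n addr0.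
  by move: dy; rewrite /=; lra.
apply: ComplexField.Normc.eq0_normc; apply/eqP; rewrite -sqrf_eq0.
(* The optimal c would be 1 / sqn h; adding 1 avoids a division by 0 and still leaves a negative
   coefficient. *)
have := H (sqn h + 1)^-1.
have h0 := sqn_ge0 h.
set p := normc _ ^+ 2.
have p0 : 0 <= p by exact: sqr_ge0.
have -> : - 2 * (sqn h + 1)^-1 * p + (sqn h + 1)^-1 ^+ 2 * p * sqn h =
   - ((sqn h + 2) / (sqn h + 1) ^+ 2) * p.
  by field; rewrite gt_eqF//; lra.
rewrite mulNr oppr_ge0.
rewrite pmulr_rle0; first by move=> p0'; rewrite eq_le p0 p0'.
by rewrite divr_gt0 ?exprn_gt0//; lra.
Qed.

(** * Orthonormal families indexed by the integers *)

Section Orthonormal.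
Variable e : int -> V.
Hypothesis orthonormal : forall m n, ip (e m) (e n) = (m == n)%:R.

(** The order is 0, -1, 1, -2, 2, ..., which turns two-sided expansions into ordinary sequences of
    partial sums. *)
Definition int_enum (n : nat) : int := if odd n then Negz n./2 else Posz n./2.

Lemma int_enum_inj : injective int_enum.
Proof.
move=> m n; rewrite /int_enum => H.
rewrite -[m]odd_double_half -[n]odd_double_half; move: H.
by case: (odd m); case: (odd n) => //= -[->].
Qed.

Lemma int_enum_surj n : exists m, int_enum m = n.
Proof.
case: n => n; first by exists n.*2; rewrite /int_enum odd_double doubleK.
by exists n.*2.+1; rewrite /int_enum /= odd_double /= uphalf_double.
Qed.

Definition psum (c : int -> R[i]) (M : nat) : V :=
  \sum_(i < M) c (int_enum i) *: e (int_enum i).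

Lemma ip_psum c M m :
  ip (psum c M) (e (int_enum m)) = if (m < M)%N then c (int_enum m) else 0.
Proof.
rewrite /psum sh_ip_suml.
under eq_bigr => i _ do rewrite sh_ipZl orthonormal (inj_eq int_enum_inj).
case: ifPn => mM.
  rewrite (bigD1 (Ordinal mM))//= eqxx mulr1 big1 ?addr0// => i.
  by rewrite -val_eqE /= => /negPf ->; rewrite mulr0.
rewrite big1// => i _; case: eqP => [im|_]; last by rewrite mulr0.
by rewrite -im ltn_ord in mM.
Qed.

Lemma sqn_psumB c M N : (M <= N)%N ->
  sqn (psum c N - psum c M) = \sum_(M <= i < N) normc (c (int_enum i)) ^+ 2.
Proof.
move=> MN; have D : psum c N - psum c M = \sum_(M <= i < N) c (int_enum i) *: e (int_enum i).
  rewrite /psum -!(big_mkord xpredT (fun i => c (int_enum i) *: e (int_enum i))).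
  by rewrite (big_cat_nat (leq0n M) MN)/= addrAC subrr add0r.
apply: (@complexI R); rewrite -sqnE {2}D.
transitivity (\sum_(M <= i < N) (c (int_enum i))^* * ip (psum c N - psum c M) (e (int_enum i))).
  elim/big_rec2 : _ => [|i y1 y2 _ IH]; first by rewrite ip_symm sh_ip0l conjC0.
  by rewrite sh_ipDr sh_ipZr IH.
rewrite rmorph_sum /=; apply: eq_big_nat => i /andP[Mi iN].
by rewrite sh_ipBl !ip_psum iN ltnNge Mi /= subr0 mulrC mul_conj_normc.
Qed.

Lemma sqn_psum c M : sqn (psum c M) = \sum_(i < M) normc (c (int_enum i)) ^+ 2.
Proof.
have := sqn_psumB c (leq0n M).
by rewrite {2}/psum big_ord0 subr0 big_mkord.
Qed.

Lemma bessel (u : V) M : sqn (psum (fun n => ip u (e n)) M) <= sqn u.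
Proof.
set c := fun n => ip u (e n); set p := psum c M.
have E w : ip w p = \sum_(i < M) (c (int_enum i))^* * ip w (e (int_enum i)).
  by rewrite sh_ip_sumr; apply: eq_bigr => i _; rewrite sh_ipZr.
have H : ip u p = (sqn p)%:C.
  by rewrite -sqnE !E; apply: eq_bigr => i _; rewrite ip_psum ltn_ord.
have := sqn_ge0 (u - 1 *: p); rewrite sqn_subZ H conj_1 mul1r.
rewrite ComplexField.Normc.normc1 expr1n /=; lra.
Qed.

Lemma riesz_fischer (c : int -> R[i]) (B : R) :
  (forall M, \sum_(i < M) normc (c (int_enum i)) ^+ 2 <= B) ->
  exists f, [/\ forall n, ip f (e n) = c n, sqn f <= B &
   forall d : R, 0 < d -> exists N, forall n, (N <= n)%N -> sqn (psum c n - f) <= d].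
Proof.
move=> cB.
pose a : nat -> R := fun M => \sum_(i < M) normc (c (int_enum i)) ^+ 2.
have aE m n : (m <= n)%N -> sqn (psum c n - psum c m) = a n - a m.
  move=> mn; rewrite sqn_psumB// /a.
  rewrite -!(big_mkord xpredT (fun i => normc (c (int_enum i)) ^+ 2)).
  by rewrite (big_cat_nat (leq0n m) mn)/= addrAC subrr add0r.
have aup m n : (m <= n)%N -> a m <= a n.
  by move=> mn; rewrite -subr_ge0 -aE// sqn_ge0.
pose A : set R := range a.
have A0 : has_sup A.
  by split; [exists (a 0%N), 0%N|exists B => _ [n _ <-]; exact: cB].
(* Squared distances between partial sums are differences of terms of a, which is nondecreasing and
   bounded. *)
have cau d : 0 < d -> exists N, forall m n, (N <= m)%N -> (N <= n)%N ->
    sqn (psum c m - psum c n) <= d.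
  move=> d0; have [_ [N _ <-] HN] := sup_adherent d0 A0.
  exists N => m n; wlog mn : m n / (n <= m)%N.
    move=> wlg Nm Nn; have [mn|/ltnW nm] := leqP n m; first exact: wlg.
    by rewrite -sqnN opprB; exact: wlg.
  move=> Nm Nn; rewrite aE//.
  have : a m <= sup A by apply: ub_le_sup; [exact: A0.2|exists m].
  have := aup _ _ Nn; lra.
have [f fl] := complete cau.
exists f; split => //.
- move=> n; have [m <-] := int_enum_surj n.
  (* The shift by [m.+1] starts the sequence where the m-th term is already present, so that all its
     members are orthogonal to that basis vector. *)
  pose s k := psum c (k + m.+1) - c (int_enum m) *: e (int_enum m).
  have sl : forall d, 0 < d -> exists N, forall k, (N <= k)%N ->
      sqn (s k - (f - c (int_enum m) *: e (int_enum m))) <= d.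
    move=> d /fl[N HN]; exists N => k Nk.
    rewrite /s opprB addrA subrK; apply: HN.
    exact: leq_trans (leq_addr _ _).
  have s0 k : ip (s k) (e (int_enum m)) = 0.
    by rewrite /s sh_ipBl ip_psum addnS ltnS leq_addl sh_ipZl orthonormal eqxx mulr1 subrr.
  have := ip_cvg0 sl s0; rewrite sh_ipBl sh_ipZl orthonormal eqxx mulr1.
  by move/eqP; rewrite subr_eq0 => /eqP.
- rewrite -sqnN -[- f]add0r.
  apply: (sqn_lim_le fl (N := 0%N)) => n _.
  by rewrite sub0r sqnN sqn_psum.
Qed.

Hypothesis total : forall u, (forall n, ip u (e n) = 0) -> sqn u = 0.

Lemma psum_cvg (u : V) (d : R) : 0 < d ->
  exists M, sqn (u - psum (fun n => ip u (e n)) M) <= d.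
Proof.
move=> d0; have B M : \sum_(i < M) normc (ip u (e (int_enum i))) ^+ 2 <= sqn u.
  by rewrite -(sqn_psum (fun n => ip u (e n))); exact: bessel.
have [f [fe _ fl]] := riesz_fischer (c := fun n => ip u (e n)) B.
have fu : sqn (u - f) = 0 by apply: total => n; rewrite sh_ipBl fe subrr.
have [N /(_ N (leqnn _)) HN] := fl (d / 2) ltac:(by rewrite divr_gt0).
exists N; rewrite -sqnN opprB.
have -> : psum (fun n => ip u (e n)) N - u = (psum (fun n => ip u (e n)) N - f) + (f - u).
  by rewrite addrA subrK.
apply: le_trans (sqn_add_le _ _) _.
by rewrite -[sqn (f - u)]sqnN opprB fu; lra.
Qed.

(** This stands in for density arguments. The partial sums of u involve only basis vectors with
    nonzero coefficient, so they lie in D and L kills them; hence L u = L (u - p M), which is as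
    small as desired. *)
Lemma functional_eq0 (D : set V) (L : V -> R[i]) (B : R) (u : V) :
  (forall a v w, D v -> D w -> D (a *: v + w)) ->
  (forall a v w, D v -> D w -> L (a *: v + w) = a * L v + L w) ->
  (forall v, D v -> normc (L v) ^+ 2 <= B * sqn v) ->
  D u -> (forall n, ip u (e n) != 0 -> D (e n) /\ L (e n) = 0) -> L u = 0.
Proof.
move=> Dl Ll LB Du ue.
have D0 : D 0 by rewrite -(subrr u) -scaleN1r addrC; exact: Dl.
have L0 : L 0 = 0.
  have := Ll 1 _ _ D0 D0; rewrite scale1r addr0 mul1r => /eqP.
  by rewrite -subr_eq0 opprD addNKr oppr_eq0 => /eqP.
pose p := psum (fun n => ip u (e n)).
have pD M : D (p M) /\ L (p M) = 0.
  elim: M => [|M [IH1 IH2]]; first by rewrite /p /psum big_ord0.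
  rewrite /p /psum big_ord_recr /= addrC.
  have [->|/ue[De Le]] := eqVneq (ip u (e (int_enum M))) 0.
    by rewrite scale0r add0r.
  by split; [exact: Dl|rewrite Ll// Le IH2 mulr0 addr0].
have Dp M : D (u - p M).
  by rewrite addrC -scaleN1r; apply: Dl => //; exact: (pD M).1.
have Lp M : L (u - p M) = L u.
  rewrite addrC -scaleN1r Ll//; last exact: (pD M).1.
  by rewrite (pD M).2 mulr0 add0r.
have {}LB v : D v -> normc (L v) ^+ 2 <= `|B| * sqn v.
  move=> Dv; apply: le_trans (LB _ Dv) _; apply: ler_wpM2r; first exact: sqn_ge0.
  exact: ler_norm.
apply: ComplexField.Normc.eq0_normc; apply/eqP.
rewrite -sqrf_eq0 eq_le sqr_ge0 andbT.
apply/ler_addgt0Pl => d d0; rewrite addr0.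
have B0 := normr_ge0 B.
have [M HM] := @psum_cvg u (d / (`|B| + 1)) ltac:(by rewrite divr_gt0// ltr_wpDl).
rewrite -(Lp M); apply: le_trans (LB _ (Dp M)) _.
apply: le_trans (ler_wpM2l B0 HM) _.
by rewrite mulrA ler_pdivrMr ?ltr_wpDl// mulrC ler_pM2l//; lra.
Qed.

End Orthonormal.

End SemiHilbert.

(** * Completeness of L^2 *)

Section FastCauchy.
Context d (T : measurableType d) {R : realType}.
Variables (mu : {measure set T -> \bar R}) (D : set T) (mD : measurable D).
Hypothesis muD : (mu D < +oo)%E.

Definition variation (a : nat -> R) : \bar R :=
  (\sum_(0 <= n <oo) `|a n.+1 - a n|%:E)%E.

(** Finiteness of the variation, rather than convergence, decides where the limit is taken: it cuts
    out a measurable set, so the resulting function is measurable, with value 0 elsewhere. *)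
Definition seqlim (a : nat -> R) : R :=
  if (variation a < +oo)%E then limn a else 0.

Lemma seqlimP a : (variation a < +oo)%E -> a @ \oo --> seqlim a.
Proof.
move=> va; rewrite /seqlim va.
have vf : variation a \is a fin_num.
  by rewrite ge0_fin_numE// nneseries_ge0.
have cs : cvgn (series (fun n => a n.+1 - a n)).
  apply: normed_cvg; apply: nondecreasing_is_cvgn.
    by apply: nondecreasing_series => k _ _; exact: normr_ge0.
  exists (fine (variation a)) => _ [n _ <-].
  rewrite -lee_fin fineK// /= /series/= -sumEFin.
  by apply: nneseries_lim_ge => k _; rewrite lee_fin.
apply/cvg_ex; exists (limn (series (fun n => a n.+1 - a n)) + a 0%N).
have E : a = fun n => series (fun n => a n.+1 - a n) n + a 0%N.
  by apply/funext => n; rewrite /series/= telescope_sumr// subrK.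
rewrite [X in X @ _]E.
by apply: cvgD; [exact: cs|exact: cvg_cst].
Qed.

Variable u : nat -> T -> R.
Hypothesis mu_ : forall n, measurable_fun D (u n).
Hypothesis ufast : forall n,
  (\int[mu]_(x in D) ((u n.+1 x - u n x) ^+ 2)%:E <= (4^-1 ^+ n)%:E)%E.

Let v x := seqlim (u^~ x).
Let G x := variation (u^~ x).

Lemma measurable_diff m n : measurable_fun D (fun x => u m x - u n x).
Proof. exact: measurable_funB. Qed.

Lemma measurable_variation : measurable_fun D G.
Proof.
apply: ge0_emeasurable_sum => [k x Dx _|k _]; first by rewrite lee_fin.
apply/measurable_EFinP; apply: measurableT_comp => //; exact: measurable_diff.
Qed.

Lemma variation_ae_fin : {ae mu, forall x, D x -> (G x < +oo)%E}.
Proof.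
have G0 x : (0 <= G x)%E by apply: nneseries_ge0 => n _ _; rewrite lee_fin.
have iG : mu.-integrable D G.
  apply/integrableP; split; first exact: measurable_variation.
  under eq_integral do rewrite gee0_abs//.
  rewrite integral_nneseries//; last first.
    move=> n; apply/measurable_EFinP; apply: measurableT_comp => //.
    exact: measurable_diff.
  have muf : mu D \is a fin_num by rewrite ge0_fin_numE.
  (* The inequality below bounds the n-th integral by 2^n 4^-n + 2^-n mu(D) = (1 + mu(D)) 2^-n; the
     factor 2 matches the exponent n + 1 of the geometric series used. *)
  pose c := (1 + fine (mu D)) * 2.
  apply: (@le_lt_trans _ _ (\sum_(0 <= n <oo) (c / (2 ^ (n + 1))%:R)%:E)%E); last first.
    by have /cvg_lim -> := @cvg_geometric_eseries_half R c 0; rewrite ?ltry.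
  apply: lee_nneseries => [n _ _|n _]; first by apply: integral_ge0 => x _; rewrite lee_fin.
  have mdif : measurable_fun D (fun x => ((2 ^+ n * (u n.+1 x - u n x) ^+ 2))%:E).
    apply/measurable_EFinP; apply: measurable_funM => //; apply: measurable_funX.
    exact: measurable_diff.
  apply: (@le_trans _ _ (\int[mu]_(x in D)
      ((2 ^+ n * (u n.+1 x - u n x) ^+ 2)%:E + (2^-1 ^+ n)%:E))%E).
    apply: ge0_le_integral => //.
    - apply/measurable_EFinP; apply: measurableT_comp => //; exact: measurable_diff.
    - by apply: emeasurable_funD.
    (* AM-GM: |p| <= 2^n p^2 + 2^-n *)
    move=> x Dx; rewrite -EFinD lee_fin; set p := u n.+1 x - u n x.
    have p2 : 0 < 2 ^+ n :> R by rewrite exprn_gt0.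
    rewrite exprVn -[leLHS]mulr1 -(ler_pM2l p2) mulrDr mulfV ?gt_eqF// mulr1.
    have := sqr_ge0 (2 ^+ n * `|p| - 2^-1).
    rewrite sqrrB exprMn real_normK ?num_real//; lra.
  rewrite ge0_integralD//; last by move=> x _; rewrite lee_fin mulr_ge0 ?sqr_ge0// exprn_ge0.
  rewrite integral_cst//.
  under eq_integral do rewrite EFinM.
  rewrite ge0_integralZl//; last 2 first.
  - by apply/measurable_EFinP; apply: measurable_funX; exact: measurable_diff.
  - by move=> x _; rewrite lee_fin sqr_ge0.
  apply: (@le_trans _ _ ((2 ^+ n)%:E * (4^-1 ^+ n)%:E + (2^-1 ^+ n)%:E * mu D)%E).
    by rewrite leeD2r// lee_wpmul2l// lee_fin exprn_ge0.
  rewrite -[in leLHS](fineK muf) -!EFinM -EFinD lee_fin.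
  rewrite -exprMn (_ : 2 * 4^-1 = 2^-1 :> R); last by field.
  rewrite /c addn1 expnS natrM natrX exprVn.
  rewrite -{1}[X in X + _]mulr1 -mulrDr mulrC -mulrA ler_wpM2l//.
  by rewrite invfM mulrA mulfV ?mul1r.
have := integrable_ae mD iG; apply: filterS.
by move=> x H /H; rewrite ge0_fin_numE.
Qed.

Lemma fast_cvg : {ae mu, forall x, D x -> u ^~ x @ \oo --> v x}.
Proof.
have := variation_ae_fin; apply: filterS.
by move=> x H /H; exact: seqlimP.
Qed.

Lemma measurable_seqlim : measurable_fun D v.
Proof.
have mA : measurable (D `&` [set x | (G x < +oo)%E]).
  by apply: emeasurable_fun_infty_o => //; exact: measurable_variation.
apply: (@measurable_fun_cvg _ _ _ D
  (fun n x => u n x * \1_(D `&` [set x | (G x < +oo)%E]) x)).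
  by move=> n; apply: measurable_funM => //; exact: measurable_indic.
move=> x Dx; rewrite indicE.
have [Gx|Gx] := boolP (G x < +oo)%E.
  rewrite mem_set//=; under eq_fun do rewrite mulr1.
  exact: seqlimP.
rewrite memNset/=; last by move=> [_ /=]; rewrite (negbTE Gx).
under eq_fun do rewrite mulr0.
rewrite /v /seqlim -/(G x) (negbTE Gx); exact: cvg_cst.
Qed.

(** Fatou's lemma along the sequence shifted by n, all of whose terms satisfy the bound. *)
Lemma fast_fatou n (e : \bar R) :
  (forall m, (n <= m)%N -> \int[mu]_(x in D) ((u m x - u n x) ^+ 2)%:E <= e)%E ->
  (\int[mu]_(x in D) ((v x - u n x) ^+ 2)%:E <= e)%E.
Proof.
move=> H; pose f m x := ((u (m + n)%N x - u n x) ^+ 2)%:E.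
have mf m : measurable_fun D (f m).
  by apply/measurable_EFinP; apply: measurable_funX; exact: measurable_diff.
have f0 m x : D x -> (0 <= f m x)%E by rewrite lee_fin sqr_ge0.
have := fatou mu mD mf f0.
rewrite (_ : (\int[mu]_(x in D) limn_einf (f^~ x) = \int[mu]_(x in D) ((v x - u n x) ^+ 2)%:E)%E).
  move=> /le_trans; apply.
  rewrite limn_einf_lim; apply: lime_le; first exact: is_cvg_einfs.
  apply: nearW => m; apply: (@le_trans _ _ (\int[mu]_(x in D) f m x)%E).
    by apply: ereal_inf_lbound; exists m => //=.
  by apply: H; exact: leq_addl.
apply: ae_eq_integral => //.
- under eq_fun do rewrite /limn_einf.
  apply: measurableT_comp => //; apply: measurable_fun_limn_esup => m.
  by apply: measurableT_comp.
- apply/measurable_EFinP; apply: measurable_funX; apply: measurable_funB => //.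
  exact: measurable_seqlim.
have := fast_cvg; apply: filterS.
move=> x cx Dx; have {}cx := cx Dx.
have : f^~ x @ \oo --> ((v x - u n x) ^+ 2)%:E.
  apply: cvg_EFin; first exact: nearW.
  rewrite (_ : _ \o _ = fun m => (u (m + n)%N x - u n x) * (u (m + n)%N x - u n x))//.
  have c : u (m + n)%N x - u n x @[m --> \oo] --> v x - u n x.
    apply: cvgB; last exact: cvg_cst.
    by rewrite (cvg_shiftn n (u^~ x)).
  exact: (cvgM c c).
by move=> /cvg_limn_einf_sup[-> _].
Qed.

End FastCauchy.

(** Bundled representatives form a module over the complex numbers, to which the semi-Hilbert
    results apply; equality remains equality of functions. *)
Record L2fun (R : realType) := MkL2 {l2f : R[i] -> R[i]; l2P : L2 l2f}.

Section L2Space.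
Context {R : realType}.
Local Notation mu := (@lebesgue_measure R).
Local Notation normc := ComplexField.Normc.normc.
Local Notation V := (L2fun R).
Implicit Types (f g h : R[i] -> R[i]).

Lemma L2fun_eq (f g : V) : l2f f = l2f g -> f = g.
Proof.
case: f => f Pf; case: g => g Pg /= E; case: _ / E Pg => Pg.
by rewrite (Prop_irrelevance Pf Pg).
Qed.

HB.instance Definition _ := gen_eqMixin (L2fun R).
HB.instance Definition _ := gen_choiceMixin (L2fun R).

Definition l2_add (f g : V) : V := MkL2 (L2D (l2P f) (l2P g)).
Definition l2_opp (f : V) : V := MkL2 (L2N (l2P f)).
Definition l2_zero : V := MkL2 (@L2_cst R 0).
Definition l2_scale (a : R[i]) (f : V) : V := MkL2 (L2Z a (l2P f)).

Lemma l2_addA : associative l2_add.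
Proof. by move=> f g h; apply/L2fun_eq/funext => z; exact: addrA. Qed.
Lemma l2_addC : commutative l2_add.
Proof. by move=> f g; apply/L2fun_eq/funext => z; exact: addrC. Qed.
Lemma l2_add0 : left_id l2_zero l2_add.
Proof. by move=> f; apply/L2fun_eq/funext => z; exact: add0r. Qed.
Lemma l2_addN : left_inverse l2_zero l2_opp l2_add.
Proof. by move=> f; apply/L2fun_eq/funext => z; exact: addNr. Qed.

HB.instance Definition _ := GRing.isZmodule.Build (L2fun R)
  l2_addA l2_addC l2_add0 l2_addN.

Lemma l2_scaleA a b (f : V) : l2_scale a (l2_scale b f) = l2_scale (a * b) f.
Proof. by apply/L2fun_eq/funext => z; exact: mulrA. Qed.
Lemma l2_scale1 : left_id 1 l2_scale.
Proof. by move=> f; apply/L2fun_eq/funext => z; exact: mul1r. Qed.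
Lemma l2_scaleDr : right_distributive l2_scale +%R.
Proof. by move=> a f g; apply/L2fun_eq/funext => z; exact: mulrDr. Qed.
Lemma l2_scaleDl (f : V) : {morph l2_scale^~ f : a b / a + b}.
Proof. by move=> a b; apply/L2fun_eq/funext => z; exact: mulrDl. Qed.

HB.instance Definition _ := GRing.Zmodule_isLmodule.Build R[i] (L2fun R)
  l2_scaleA l2_scale1 l2_scaleDr l2_scaleDl.

Definition l2ip (f g : V) : R[i] := ip (l2f f) (l2f g).

Lemma l2ip_linl a (u v w : V) : l2ip (a *: u + v) w = a * l2ip u w + l2ip v w.
Proof. exact: (ip_lin _ (l2P u) (l2P v) (l2P w)). Qed.

Lemma l2ip_symm (u v : V) : l2ip v u = (l2ip u v)^*.
Proof. exact: (ip_sym (l2P u) (l2P v)). Qed.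

Lemma l2ip_ge0 (u : V) : 0 <= l2ip u u.
Proof. by rewrite /l2ip ip_norm2 ler0c sqr_ge0. Qed.

Lemma sqn_norm2 (u : V) : sqn l2ip u = norm2 (l2f u) ^+ 2.
Proof. by rewrite /sqn /l2ip ip_norm2. Qed.

Lemma sqn_integral (u : V) :
  (2 * pi * sqn l2ip u)%:E =
  (\int[mu]_(t in @period R) (normc (l2f u (circ t)) ^+ 2)%:E)%E.
Proof.
rewrite sqn_norm2 norm2E /mean mulrA mulfV ?mul1r ?gt_eqF ?twopi_gt0//.
rewrite /Rintegral fineK//; apply: (@integrable_fin_num _ _ _ mu) => //.
  exact: measurable_period.
exact: (l2P u).2.
Qed.

(** A subsequence with squared distances at most 4^-n, up to the factor 2 pi, converges almost
    everywhere, for real and imaginary parts separately, and Fatou's lemma turns this into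
    convergence in norm. *)
Lemma l2_complete (s : nat -> V) :
  (forall e : R, 0 < e -> exists N, forall m n, (N <= m)%N -> (N <= n)%N ->
    sqn l2ip (s m - s n) <= e) ->
  exists l, forall e : R, 0 < e -> exists N, forall n, (N <= n)%N ->
    sqn l2ip (s n - l) <= e.
Proof.
move=> cau.
have mP : measurable (@period R) by exact: measurable_period.
have muP : (mu (@period R) < +oo)%E by rewrite [X in (X < _)%E]mu_period ltry.
have pi2 := twopi_gt0 (R := R).
have ex n : exists N, forall m n', (N <= m)%N -> (N <= n')%N ->
    2 * pi * sqn l2ip (s m - s n') <= 4^-1 ^+ n.
  have [N HN] := cau (4^-1 ^+ n / (2 * pi)) ltac:(by rewrite divr_gt0// exprn_gt0).
  exists N => m n' Nm Nn; have := HN _ _ Nm Nn.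
  by rewrite ler_pdivlMr// mulrC.
have [M MP] := boolp.choice ex.
(* The sum makes [phi] nondecreasing and at least [M n]; the summand n makes it unbounded. *)
pose phi n := (n + \sum_(i < n.+1) M i)%N.
have phiM n : (M n <= phi n)%N by rewrite /phi big_ord_recr addnA leq_addl.
have phi_le m n : (m <= n)%N -> (phi m <= phi n)%N.
  move=> mn; rewrite leq_add// -!(big_mkord xpredT M).
  by rewrite (@big_cat_nat _ _ _ m.+1 0 n.+1)//= leq_addr.
pose F n t : R[i] := l2f (s (phi n)) (circ t).
pose ur n t := complex.Re (F n t); pose ui n t := complex.Im (F n t).
have mr n : measurable_fun (@period R) (ur n) by exact: (L2_meas (l2P (s (phi n)))).1.
have mi n : measurable_fun (@period R) (ui n) by exact: (L2_meas (l2P (s (phi n)))).2.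
have mdr m n : measurable_fun (@period R) (fun t => ((ur m t - ur n t) ^+ 2)%:E).
  by apply/measurable_EFinP; apply: measurable_funX; exact: measurable_funB.
have mdi m n : measurable_fun (@period R) (fun t => ((ui m t - ui n t) ^+ 2)%:E).
  by apply/measurable_EFinP; apply: measurable_funX; exact: measurable_funB.
have intD m n : (\int[mu]_(t in @period R) ((ur m t - ur n t) ^+ 2)%:E +
    \int[mu]_(t in @period R) ((ui m t - ui n t) ^+ 2)%:E =
    (2 * pi * sqn l2ip (s (phi m) - s (phi n)))%:E)%E.
  rewrite sqn_integral -ge0_integralD//; try exact: mdr; try exact: mdi;
    try (by move=> t _; rewrite lee_fin sqr_ge0).
  apply: eq_integral => t _; rewrite -EFinD sqr_normcE /ur /ui /F /=.
  by congr (_%:E); case: (l2f _ _) => a b; case: (l2f _ _) => c d.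
have br m n (e : R) : 2 * pi * sqn l2ip (s (phi m) - s (phi n)) <= e ->
   (\int[mu]_(t in @period R) ((ur m t - ur n t) ^+ 2)%:E <= e%:E)%E.
  rewrite -lee_fin -intD; apply: le_trans; rewrite leeDl//.
  by apply: integral_ge0 => t _; rewrite lee_fin sqr_ge0.
have bi m n (e : R) : 2 * pi * sqn l2ip (s (phi m) - s (phi n)) <= e ->
   (\int[mu]_(t in @period R) ((ui m t - ui n t) ^+ 2)%:E <= e%:E)%E.
  rewrite -lee_fin -intD; apply: le_trans; rewrite leeDr//.
  by apply: integral_ge0 => t _; rewrite lee_fin sqr_ge0.
have fast m n : (n <= m)%N -> 2 * pi * sqn l2ip (s (phi m) - s (phi n)) <= 4^-1 ^+ n.
  move=> nm; apply: MP; last exact: phiM.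
  by apply: leq_trans (phiM n) _; exact: phi_le.
have fr n : (\int[mu]_(t in @period R) ((ur n.+1 t - ur n t) ^+ 2)%:E <= (4^-1 ^+ n)%:E)%E.
  exact/br/fast.
have fi n : (\int[mu]_(t in @period R) ((ui n.+1 t - ui n t) ^+ 2)%:E <= (4^-1 ^+ n)%:E)%E.
  exact/bi/fast.
pose f z : R[i] := seqlim (fun n => complex.Re (l2f (s (phi n)) z)) +i*
                   seqlim (fun n => complex.Im (l2f (s (phi n)) z)).
have mf : circ_measurable f.
  split; first exact: (measurable_seqlim mP mr).
  exact: (measurable_seqlim mP mi).
have fat n (e : R) : (forall m, (n <= m)%N -> 2 * pi * sqn l2ip (s (phi m) - s (phi n)) <= e) ->
   (\int[mu]_(t in @period R) (normc (f (circ t) - l2f (s (phi n)) (circ t)) ^+ 2)%:E <= (e + e)%:E)%E.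
  move=> H.
  have mfr : measurable_fun (@period R) (fun t => ((complex.Re (f (circ t)) - ur n t) ^+ 2)%:E).
    apply/measurable_EFinP; apply: measurable_funX; apply: measurable_funB => //.
    exact: mf.1.
  have mfi : measurable_fun (@period R) (fun t => ((complex.Im (f (circ t)) - ui n t) ^+ 2)%:E).
    apply/measurable_EFinP; apply: measurable_funX; apply: measurable_funB => //.
    exact: mf.2.
  have -> : (\int[mu]_(t in @period R) (normc (f (circ t) - l2f (s (phi n)) (circ t)) ^+ 2)%:E =
     \int[mu]_(t in @period R) ((complex.Re (f (circ t)) - ur n t) ^+ 2)%:E +
     \int[mu]_(t in @period R) ((complex.Im (f (circ t)) - ui n t) ^+ 2)%:E)%E.
    rewrite -ge0_integralD//; try by move=> t _; rewrite lee_fin sqr_ge0.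
    apply: eq_integral => t _; rewrite -EFinD sqr_normcE /ur /ui /F.
    by congr (_%:E); case: (f _) => a b; case: (l2f _ _) => c d.
  rewrite EFinD; apply: leeD.
    exact: (@fast_fatou _ _ _ mu _ mP muP ur mr fr n e%:E (fun m nm => br _ _ _ (H m nm))).
  exact: (@fast_fatou _ _ _ mu _ mP muP ui mi fi n e%:E (fun m nm => bi _ _ _ (H m nm))).
have fL2 : L2 f.
  have dL2 : L2 (fun z => f z - l2f (s (phi 0%N)) z).
    have mdf : circ_measurable (fun z => f z - l2f (s (phi 0%N)) z).
      by apply: circ_measD => //; apply: L2_meas; apply: L2N; exact: l2P.
    split => //; apply/integrableP; split.
      by apply/measurable_EFinP; exact: (circ_meas_normc mdf).
    under eq_integral do rewrite gee0_abs ?lee_fin ?sqr_ge0//.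
    apply: le_lt_trans (fat 0%N _ (fun m => fast m 0%N)) _.
    by rewrite ltry.
  have := L2D dL2 (l2P (s (phi 0%N))).
  by under eq_fun do rewrite subrK.
exists (MkL2 fL2) => e e0.
(* Fatou's lemma costs e/6 for each of the two parts and [sqn_add_le] doubles: 2 (e/6 + 2 e/6) =
   e. *)
have [N HN] := cau (e / 6) ltac:(by rewrite divr_gt0).
have [q Nq] : exists q, (N <= phi q)%N by exists N; exact: leq_addr.
exists N => n Nn.
have -> : s n - MkL2 fL2 = (s n - s (phi q)) + (s (phi q) - MkL2 fL2).
  by rewrite addrA subrK.
apply: le_trans (sqn_add_le l2ip_linl l2ip_symm l2ip_ge0 _ _) _.
have H1 := HN _ _ Nn Nq.
have H2 : sqn l2ip (s (phi q) - MkL2 fL2) <= e / 6 + e / 6.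
  rewrite -(sqnN l2ip_linl l2ip_symm) opprB.
  rewrite -(ler_pM2l pi2) -lee_fin sqn_integral mulrDr.
  apply: fat => m qm; rewrite ler_pM2l//; apply: HN => //.
  by apply: leq_trans Nq _; exact: phi_le.
lra.
Qed.

Definition l2mono (n : int) : V := MkL2 (L2_monomial n).

Lemma l2mono_orthonormal m n : l2ip (l2mono m) (l2mono n) = (m == n)%:R.
Proof. exact: fourier_monomial. Qed.

Lemma l2mono_total (u : V) : (forall n, l2ip u (l2mono n) = 0) -> sqn l2ip u = 0.
Proof.
move=> u0; have au : aeq (l2f u) (fun=> 0) by apply: fourier_unique u0; exact: l2P.
have := norm2_ae (L2_meas (l2P u)) (circ_meas_cst 0) au.
rewrite sqn_norm2 => ->.
by rewrite norm2_cst ComplexField.Normc.normc0 expr0n.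
Qed.

Lemma ip_normc_le f g : L2 f -> L2 g -> normc (ip f g) <= norm2 f * norm2 g.
Proof.
move=> Lf Lg.
have := cauchy_schwarz l2ip_linl l2ip_symm l2ip_ge0 (MkL2 Lf) (MkL2 Lg).
rewrite !sqn_norm2 -exprMn ler_sqr ?nnegrE ?mulr_ge0 ?norm2_ge0//.
exact: normc_ge0.
Qed.

Lemma functional_fourier_eq0 (D : set (R[i] -> R[i])) (L : (R[i] -> R[i]) -> R[i])
    (B : R) f :
  (forall g, D g -> L2 g) ->
  (forall a g h, D g -> D h -> D (fun z => a * g z + h z)) ->
  (forall a g h, D g -> D h -> L (fun z => a * g z + h z) = a * L g + L h) ->
  (forall g, D g -> normc (L g) <= B * norm2 g) ->
  D f -> (forall n, fourier f n != 0 -> D (monomial n) /\ L (monomial n) = 0) ->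
  L f = 0.
Proof.
move=> DL2 Dl Ll LB Df fe.
apply: (@functional_eq0 _ _ _ l2ip_linl l2ip_symm l2ip_ge0 l2_complete _
  l2mono_orthonormal l2mono_total [set u | D (l2f u)] (fun u => L (l2f u))
  (B ^+ 2) (MkL2 (DL2 _ Df))) => //.
- by move=> a v w; exact: Dl.
- by move=> a v w; exact: Ll.
- move=> v Dv; rewrite sqn_norm2 -exprMn; have H := LB _ Dv.
  by rewrite lerXn2r// ?nnegrE ?normc_ge0// (le_trans _ H)// normc_ge0.
Qed.

(** Bessel's inequality for the orthonormal subfamily z^(tau n), then Riesz-Fischer. The identity
    restricted to n >= 0 yields the Riesz projection, and tau n = k n yields W_k. *)
Lemma fourier_reindex (I : int -> bool) (tau : int -> int) f : injective tau -> L2 f ->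
  exists g, [/\ L2 g, norm2 g <= norm2 f &
    forall n, fourier g n = if I n then fourier f (tau n) else 0].
Proof.
move=> taui Lf; pose u := MkL2 Lf.
pose c n := if I n then fourier f (tau n) else 0.
have B M : \sum_(i < M) normc (c (int_enum i)) ^+ 2 <= sqn l2ip u.
  have ort m n : l2ip (l2mono (tau m)) (l2mono (tau n)) = (m == n)%:R.
    by rewrite l2mono_orthonormal (inj_eq taui).
  have := bessel l2ip_linl l2ip_symm l2ip_ge0 ort u M.
  apply: le_trans.
  rewrite (sqn_psum l2ip_linl l2ip_symm l2ip_ge0 ort (fun n => l2ip u (l2mono (tau n)))).
  apply: ler_sum => i _; rewrite /c; case: (I _) => //.
  by rewrite ComplexField.Normc.normc0 expr0n sqr_ge0.
have [g [gc gn _]] := riesz_fischer l2ip_linl l2ip_symm l2ip_ge0 l2_complete l2mono_orthonormal B.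
exists (l2f g); split; [exact: l2P| |exact: gc].
by move: gn; rewrite !sqn_norm2 /= ler_sqr// ?nnegrE ?norm2_ge0.
Qed.

Lemma orthocomplement_proj (I : Type) (E : I -> R[i] -> R[i]) f :
  (forall i, L2 (E i)) -> L2 f ->
  exists g, [/\ L2 g, forall i, ip g (E i) = 0 &
    forall h, L2 h -> (forall i, ip h (E i) = 0) -> ip (fun z => f z - g z) h = 0].
Proof.
move=> LE Lf.
have [g [gE gp]] := orthocomplement_projection l2ip_linl l2ip_symm l2ip_ge0
  l2_complete (fun i => MkL2 (LE i)) (MkL2 Lf).
exists (l2f g); split; [exact: l2P|exact: gE|].
by move=> h Lh hE; exact: (gp (MkL2 Lh) hE).
Qed.

End L2Space.

(** * The substitution z^k *)

Section Substitution.
Context {R : realType}.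
Implicit Types (f g h : R[i] -> R[i]).
Local Notation mu := (@lebesgue_measure R).
Local Notation normc := ComplexField.Normc.normc.

(** * Affine change of variables *)

Section Affine.
Variables (a : R) (c : R).
Hypothesis a0 : 0 < a.

Definition affine (t : measurableTypeR R) : measurableTypeR R := a * t - c.

Lemma measurable_affine : measurable_fun [set: measurableTypeR R] affine.
Proof.
rewrite /affine; apply: measurable_funB => //; exact: measurable_funM.
Qed.

Let pushforward_affine : {measure set (measurableTypeR R) -> \bar R} :=
  measure_function_pushforward__canonical__measure_function_Measure
    mu measurable_affine.

(** Lebesgue measure is determined by the lengths of half-open intervals, and a times its image
    under [affine] gives them the same lengths. *)
Lemma lebesgue_measure_affine (A : set (measurableTypeR R)) : measurable A ->
  mu A = (a%:E * mu (affine @^-1` A))%E.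
Proof.
move=> mA.
have a0' : 0 <= a := ltW a0.
transitivity (mscale (NngNum a0') pushforward_affine A); last by [].
apply: lebesgue_measure_unique => //.
move=> _ /= [[x y] _ <-]; rewrite /mscale /= /pushforward.
have -> : affine @^-1` `]x, y] = `](x + c) / a, (y + c) / a]%classic.
  apply/seteqP; split => t /=; rewrite !in_itv/= /affine.
    by rewrite ltr_pdivrMr// ler_pdivlMr// [t * a]mulrC ltrBrDr lerBlDr.
  by rewrite ltr_pdivrMr// ler_pdivlMr// [t * a]mulrC ltrBrDr lerBlDr.
rewrite !lebesgue_measure_itv/= !lte_fin ltr_pM2r ?invr_gt0// ltrD2r.
case: ifP => _; last by rewrite mule0.
rewrite -!EFinB -EFinM; congr (_%:E).
by field; rewrite gt_eqF.
Qed.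

Lemma ge0_integral_affine (D : set (measurableTypeR R)) (g : R -> \bar R) :
  measurable D -> measurable_fun D g -> (forall t, D t -> (0 <= g t)%E) ->
  (\int[mu]_(t in D) g t = a%:E * \int[mu]_(t in affine @^-1` D) g (affine t))%E.
Proof.
move=> mD mg g0; have a0' : 0 <= a := ltW a0.
rewrite -(@ge0_integral_pushforward _ _ _ _ _ affine measurable_affine mu D g mD mg); last first.
  by move=> t /set_mem; exact: g0.
rewrite -(@ge0_integral_mscale _ _ _ pushforward_affine _ mD (NngNum a0'))//.
by apply: eq_measure_integral => A mA _; exact: lebesgue_measure_affine.
Qed.

End Affine.

(** * The map z^k on the circle *)

Section PowerSubstitution.
Variable k : nat.
Hypothesis k0 : (0 < k)%N.

Let kR0 : 0 < k%:R :> R. Proof. by rewrite ltr0n. Qed.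

(** The arc from 2 pi j / k to 2 pi (j + 1) / k, along which z^k runs once around the circle. *)
Let piece (j : nat) : set R := affine k%:R (j%:R * (2 * pi)) @^-1` period.

Lemma measurable_piece j : measurable (piece j).
Proof.
rewrite /piece -[X in measurable X]setTI.
exact: (@measurable_affine k%:R (j%:R * (2 * pi)) measurableT _ measurable_period).
Qed.

(** Truncating k t / (2 pi) yields j. The value j = k occurs only at the end point t = 2 pi, whence
    the k + 1 pieces. *)
Lemma piece_cover t : period t -> exists2 j, (j <= k)%N & piece j t.
Proof.
rewrite /period/= in_itv/= => /andP[t0 t2].
have p0 := twopi_gt0 (R := R).
have x0 : 0 <= k%:R * t / (2 * pi) by apply: divr_ge0; [apply: mulr_ge0|exact: ltW].
have /andP[H1 H2] := Num.Theory.truncn_itv x0.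
set j := Num.truncn _ in H1 H2.
exists j.
  rewrite -(ler_nat R) (le_trans H1)// ler_pdivrMr// ler_pM2l//.
rewrite /piece /period /affine /= in_itv/=; apply/andP; split.
  by rewrite subr_ge0 -ler_pdivlMr.
rewrite lerBlDr -[X in _ <= X + _]mul1r -mulrDl.
rewrite -ler_pdivrMr// (le_trans (ltW H2))//.
by rewrite -natr1 addrC.
Qed.

Lemma circ_affine j t : circ (affine k%:R (j%:R * (2 * pi)) t) = circ t ^+ k :> R[i].
Proof.
rewrite /affine circX.
have -> : circ (k%:R * t) = circ (k%:R * t - j%:R * (2 * pi)) * circ (j%:R * (2 * pi)) :> R[i].
  by rewrite -circD subrK.
by rewrite -circX circ2pi expr1n mulr1.
Qed.

Lemma measurable_pow (g : R[i] -> R) :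
  measurable_fun (@period R) (fun t => g (circ t)) ->
  measurable_fun (@period R) (fun t => g (circ t ^+ k)).
Proof.
move=> mg.
have : measurable_fun (\bigcup_j piece j) (fun t => g (circ t ^+ k)).
  apply/measurable_fun_bigcup; first exact: measurable_piece.
  move=> j; rewrite (_ : (fun t => _) =
    (fun t => g (circ t)) \o affine k%:R (j%:R * (2 * pi))); last first.
    by apply/funext => t /=; rewrite circ_affine.
  apply: (measurable_comp (@measurable_period R) _ mg).
    by move=> _ [t pt <-].
  by apply: (measurable_funS measurableT) => //; exact: measurable_affine.
apply: measurable_funS; first by apply: bigcupT_measurable; exact: measurable_piece.
by move=> t /piece_cover[j _ jt]; exists j.
Qed.

Lemma circ_meas_Wadj f : circ_measurable f -> circ_measurable (Wadj k f).
Proof.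
move=> [fr fi]; split.
  exact: (measurable_pow (g := fun z => complex.Re (f z))).
exact: (measurable_pow (g := fun z => complex.Im (f z))).
Qed.

(** On each piece an exceptional point is pulled back by an affine map, which preserves null
    sets. *)
Lemma ae_circ_pow (P : R[i] -> Prop) : ae_circ P -> ae_circ (fun z => P (z ^+ k)).
Proof.
move=> [N [mN N0 NP]].
suff: mu.-negligible (\bigcup_j (affine k%:R (j%:R * (2 * pi)) @^-1` N)).
  apply: negligibleS => t /= /not_implyP[pt nP].
  have [j _ pj] := piece_cover pt; exists j => //.
  by apply: NP => /= H; apply: nP; rewrite -(circ_affine j); exact: H.
apply: negligible_bigcup => j.
exists (affine k%:R (j%:R * (2 * pi)) @^-1` N); split => //.
  rewrite -[X in measurable X]setTI.
  exact: (@measurable_affine k%:R (j%:R * (2 * pi)) measurableT _ mN).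
have := lebesgue_measure_affine (j%:R * (2 * pi)) kR0 mN.
rewrite [LHS]N0 => /esym/eqP; rewrite mule_eq0 eqe gt_eqF//= => /eqP.
exact.
Qed.

(** Each of the k + 1 pieces contributes 1/k of the integral. Counting the last one, which meets the
    period in a null set, makes the constant (k + 1)/k instead of 1; it serves only for
    integrability and boundedness. *)
Lemma integral_pow_le (g : R[i] -> R) : (forall z, 0 <= g z) ->
  measurable_fun (@period R) (fun t => g (circ t)) ->
  (\int[mu]_(t in @period R) (g (circ t ^+ k))%:E <=
   (k.+1%:R / k%:R)%:E * \int[mu]_(t in @period R) (g (circ t))%:E)%E.
Proof.
move=> g0 mg; have mgk := measurable_pow mg.
have mp := measurable_period (R := R).
pose H t := (g (circ t ^+ k))%:E.
have H0 t : (0 <= H t)%E by rewrite lee_fin.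
have mHj j : measurable_fun (piece j) H.
  rewrite (_ : H = (EFin \o (fun t => g (circ t))) \o affine k%:R (j%:R * (2 * pi))); last first.
    by apply/funext => t /=; rewrite circ_affine.
  apply: (measurable_comp mp).
  - by move=> _ [t pt <-].
  - exact/measurable_EFinP.
  - by apply: (measurable_funS measurableT) => //; exact: measurable_affine.
have step : (\int[mu]_(t in @period R) H t <=
    \sum_(0 <= j < k.+1) \int[mu]_(t in piece j) H t)%E.
  rewrite integral_mkcond.
  under [leRHS]eq_bigr do rewrite integral_mkcond.
  have mHp j : measurable_fun setT (H \_ (piece j)).
    exact: ((measurable_restrictT H (measurable_piece j)).1 (mHj j)).
  have Hp0 (E : set R) t : (0 <= (H \_ E) t)%E by rewrite patchE; case: ifP.
  rewrite -ge0_integral_sum//.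
  apply: ge0_le_integral => //.
  - by apply: (measurable_restrictT H mp).1; exact/measurable_EFinP.
  - by apply: emeasurable_sum => j; exact: mHp.
  move=> t _; rewrite patchE; case: ifPn => [/set_mem pt|_]; last first.
    by apply: sume_ge0 => j _; rewrite patchE; case: ifP.
  have [j jk pj] := piece_cover pt.
  rewrite (bigD1_seq j) ?iota_uniq ?mem_index_iota//=.
  rewrite patchE mem_set// leeDl//; apply: sume_ge0 => i _.
  by rewrite patchE; case: ifP.
apply: le_trans step _.
have E j : (\int[mu]_(t in piece j) H t = (k%:R^-1)%:E * \int[mu]_(t in @period R) (g (circ t))%:E)%E.
  rewrite (@ge0_integral_affine k%:R (j%:R * (2 * pi)) kR0 _ (fun t => (g (circ t))%:E) mp)//.
    rewrite muleA -EFinM mulVf ?gt_eqF// mul1e.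
    by apply: eq_integral => t _; rewrite circ_affine.
  - exact/measurable_EFinP.
  - by move=> t _; rewrite lee_fin.
under eq_bigr do rewrite E.
rewrite big_const_nat subn0 iter_addr_0 EFinM -muleA.
by rewrite mule_natl.
Qed.

Lemma L2_Wadj f : L2 f -> L2 (Wadj k f).
Proof.
move=> [mf fi]; have mw := circ_meas_Wadj mf; split => //.
have mn := circ_meas_normc mf.
have := @integral_pow_le (fun z => normc (f z) ^+ 2) (fun z => sqr_ge0 _) mn.
have /integrable_fin_num := fi; move=> /(_ measurable_period) fin.
move=> H; apply/integrableP; split; first by apply/measurable_EFinP; exact: (circ_meas_normc mw).
under eq_integral do rewrite gee0_abs ?lee_fin ?sqr_ge0//.
apply: le_lt_trans H _.
by rewrite -(fineK fin) -EFinM ltry.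
Qed.

Lemma norm2_Wadj_le f : L2 f -> norm2 (Wadj k f) <= Num.sqrt (k.+1%:R / k%:R) * norm2 f.
Proof.
move=> Lf; have Lw := L2_Wadj Lf.
rewrite /norm2 -sqrtrM ?divr_ge0//; apply: ler_wsqrtr.
rewrite /mean mulrCA ler_pM2l ?invr_gt0 ?twopi_gt0//.
have := @integral_pow_le (fun z => normc (f z) ^+ 2) (fun z => sqr_ge0 _) (circ_meas_normc Lf.1).
have /integrable_fin_num := Lf.2; move=> /(_ measurable_period) fin1.
have /integrable_fin_num := Lw.2; move=> /(_ measurable_period) fin2.
by rewrite -[in leLHS](fineK fin2) -[in leRHS](fineK fin1) -EFinM lee_fin.
Qed.

Lemma Linf_Wadj f : Linf f -> Linf (Wadj k f).
Proof.
move=> [mf /essentially_boundedP[M fM]]; split; first exact: circ_meas_Wadj.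
by apply/essentially_boundedP; exists M; exact: (ae_circ_pow fM).
Qed.

End PowerSubstitution.
End Substitution.

(** * Hardy and model spaces *)

Section HardySpace.
Context {R : realType}.
Implicit Types (f g h u b alpha beta : R[i] -> R[i]) (m n : int).
Local Notation normc := ComplexField.Normc.normc.

Lemma ip0l h : ip (fun=> 0) h = 0.
Proof.
rewrite /ip (_ : cmean _ = cmean (fun=> 0)); last first.
  by apply: cmean_eq => t; rewrite mul0r.
by rewrite /cmean !mean_cst.
Qed.

Lemma fourier_lin a f g n : L2 f -> L2 g ->
  fourier (fun z => a * f z + g z) n = a * fourier f n + fourier g n.
Proof. by move=> Lf Lg; rewrite /fourier ip_lin//; exact: L2_monomial. Qed.

Lemma fourierB f g n : L2 f -> L2 g ->
  fourier (fun z => f z - g z) n = fourier f n - fourier g n.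
Proof. by move=> Lf Lg; rewrite /fourier ipB//; exact: L2_monomial. Qed.

Lemma fourier_ae f g n : circ_measurable f -> circ_measurable g -> aeq f g ->
  fourier f n = fourier g n.
Proof.
move=> mf mg fg; apply: ip_ae => //; try exact: circ_meas_monomial.
exact: aeq_refl.
Qed.

Lemma fourier_normc_le f n : L2 f -> normc (fourier f n) <= norm2 f.
Proof.
move=> Lf; have := ip_normc_le Lf (L2_monomial n).
have -> : norm2 (@monomial R n) = 1.
  have : (norm2 (@monomial R n) ^+ 2)%:C = 1.
    by rewrite -ip_norm2 -/(fourier _ _) fourier_monomial eqxx.
  move=> /complexI /eqP; rewrite sqrp_eq1 ?norm2_ge0// => /eqP ->.
  by [].
by rewrite mulr1.
Qed.

Lemma norm2_uni u f : Uni u -> L2 f -> norm2 (fun z => u z * f z) = norm2 f.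
Proof.
move=> Uu Lf; have := ip_uni Uu Lf Lf; rewrite !ip_norm2 => /complexI/eqP.
by rewrite eqrXn2 ?norm2_ge0// => /eqP.
Qed.

Lemma H2_L2 f : H2 f -> L2 f. Proof. by case. Qed.

Lemma H2_lin a f g : H2 f -> H2 g -> H2 (fun z => a * f z + g z).
Proof.
move=> [Lf f0] [Lg g0]; split; first exact: L2_lin.
by move=> n n0; rewrite fourier_lin// f0// g0// mulr0 addr0.
Qed.

Lemma H2B f g : H2 f -> H2 g -> H2 (fun z => f z - g z).
Proof.
move=> [Lf f0] [Lg g0]; split; first exact: L2B.
by move=> n n0; rewrite fourierB// f0// g0// subr0.
Qed.

Lemma H2_monomial n : 0 <= n -> H2 (@monomial R n).
Proof.
move=> n0; split; first exact: L2_monomial.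
by move=> m m0; rewrite fourier_monomial; case: eqP => // nm; lia.
Qed.

Lemma H2_ae f g : L2 g -> aeq f g -> H2 f -> H2 g.
Proof.
move=> Lg fg [Lf f0]; split => // n n0; rewrite -(f0 n n0).
by apply/esym/fourier_ae => //; exact: L2_meas.
Qed.

Lemma H2_functional_eq0 (L : (R[i] -> R[i]) -> R[i]) (B : R) f :
  (forall a g h, H2 g -> H2 h -> L (fun z => a * g z + h z) = a * L g + L h) ->
  (forall g, H2 g -> normc (L g) <= B * norm2 g) ->
  (forall n, 0 <= n -> L (monomial n) = 0) -> H2 f -> L f = 0.
Proof.
move=> Ll LB L0 Hf; apply: (@functional_fourier_eq0 _ H2 L B) => //.
- by move=> g [].
- by move=> a g h; exact: H2_lin.
- move=> n fn; have n0 : 0 <= n.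
    by rewrite leNgt; apply/negP => n0; rewrite (proj2 Hf)// eqxx in fn.
  by split; [exact: H2_monomial|exact: L0].
Qed.

Lemma L2_functional_eq0 (L : (R[i] -> R[i]) -> R[i]) (B : R) f :
  (forall a g h, L2 g -> L2 h -> L (fun z => a * g z + h z) = a * L g + L h) ->
  (forall g, L2 g -> normc (L g) <= B * norm2 g) ->
  (forall n, L (monomial n) = 0) -> L2 f -> L f = 0.
Proof.
move=> Ll LB L0 Lf; apply: (@functional_fourier_eq0 _ L2 L B) => //.
- by move=> a g h; exact: L2_lin.
- by move=> n _; split; [exact: L2_monomial|].
Qed.

Lemma ip_H2_eq0 f g : H2 f -> L2 g -> (forall n, 0 <= n -> fourier g n = 0) ->
  ip f g = 0.
Proof.
move=> Hf Lg g0; apply: (@H2_functional_eq0 (fun f => ip f g) (norm2 g)) Hf.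
- by move=> a p q /H2_L2 Lp /H2_L2 Lq; rewrite ip_lin.
- by move=> p /H2_L2 Lp; rewrite mulrC ip_normc_le.
- move=> n n0; apply: ip_eq0_sym => //; first exact: L2_monomial.
  exact: g0.
Qed.

(** For n < 0 the function conj(b) z^n has no coefficient of nonnegative index, so it is orthogonal
    to H^2. *)
Lemma H2M b f : Hoo b -> H2 f -> H2 (fun z => b z * f z).
Proof.
move=> [Hb eb] Hf; have Lb : Linf b by split => //; exact: (L2_meas Hb.1).
split; first by apply: L2M_Linf => //; exact: H2_L2.
move=> n n0; rewrite /fourier ip_mulA.
apply: ip_H2_eq0 => //.
  by apply: L2M_Linf; [exact: Linf_conj|exact: L2_monomial].
move=> m m0.
have -> : fourier (fun z => (b z)^* * monomial n z) m = (fourier b (n - m))^*.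
  rewrite /fourier -ip_sym; [|exact: Hb.1|exact: L2_monomial].
  apply: cmean_eq => t.
  by rewrite !monomial_circ_conj monomialD [RHS]mulrC mulrA.
by rewrite Hb.2 ?conjC0//; lia.
Qed.

Lemma inner_Uni u : inner u -> Uni u.
Proof. by move=> [[[Lu _] _] u1]; split => //; exact: L2_meas. Qed.

Lemma inner_Hoo u : inner u -> Hoo u. Proof. by case. Qed.

Lemma Hoo_Linf b : Hoo b -> Linf b.
Proof. by move=> [[Lb _] eb]; split => //; exact: L2_meas. Qed.

Lemma H2_Uni_inner u : H2 u -> Uni u -> inner u.
Proof.
move=> Hu Uu; split; last exact: Uu.2.
by split => //; exact: (Uni_Linf Uu).2.
Qed.

Lemma HooM b u : Hoo b -> Hoo u -> Hoo (fun z => b z * u z).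
Proof.
move=> Hb Hu; split; first by apply: H2M => //; exact: Hu.1.
by have := LinfM (Hoo_Linf Hb) (Hoo_Linf Hu) => -[].
Qed.

Lemma innerM u v : inner u -> inner v -> inner (fun z => u z * v z).
Proof.
move=> iu iv; apply: H2_Uni_inner.
  by apply: H2M; [exact: inner_Hoo|exact: (inner_Hoo iv).1].
by apply: UniM; exact: inner_Uni.
Qed.

Lemma Hoo_monomial n : 0 <= n -> Hoo (@monomial R n).
Proof.
move=> n0; split; first exact: H2_monomial.
exact: (Uni_Linf (Uni_monomial n)).2.
Qed.

Lemma riesz_projection f : L2 f ->
  exists g, H2 g /\ forall n, 0 <= n -> fourier g n = fourier f n.
Proof.
move=> Lf; have [g [Lg _ gf]] := @fourier_reindex _ (fun n => 0 <= n) id f (fun _ _ => id) Lf.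
exists g; split; first by split => // n n0; rewrite gf leNgt n0.
by move=> n n0; rewrite gf n0.
Qed.

Lemma essentially_bounded_ae f g : aeq f g -> essentially_bounded f ->
  essentially_bounded g.
Proof. by move=> fg [M fM]; exists M; apply: ae_circS2 fg fM => t ->. Qed.

Lemma LinfD b u : Linf b -> Linf u -> Linf (fun z => b z + u z).
Proof.
move=> [mb /essentially_boundedP[M bM]] [mu' /essentially_boundedP[N uN]].
split; first exact: circ_measD.
apply/essentially_boundedP; exists (M + N); apply: ae_circS2 bM uN => t bM uN.
by rewrite (le_trans (le_normcD _ _))// lerD.
Qed.

Lemma Linf_cst (c : R[i]) : Linf (fun=> c).
Proof.
split; first exact: circ_meas_cst.
by apply/essentially_boundedP; exists (normc c); exact: ae_circW.
Qed.

Lemma LinfB b u : Linf b -> Linf u -> Linf (fun z => b z - u z).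
Proof.
move=> Lb Lu; have := LinfD Lb (LinfM (Linf_cst (-1)) Lu).
by under eq_fun do rewrite mulN1r.
Qed.

Lemma Linf_sum (I : Type) (s : seq I) (F : I -> R[i] -> R[i]) :
  (forall i, Linf (F i)) -> Linf (fun z => \sum_(i <- s) F i z).
Proof.
move=> LF; elim: s => [|i s IH].
  have -> : (fun z => \sum_(i <- [::]) F i z) = (fun=> 0).
    by apply/funext => z; rewrite big_nil.
  exact: Linf_cst.
have -> : (fun z => \sum_(j <- i :: s) F j z) = (fun z => F i z + \sum_(j <- s) F j z).
  by apply/funext => z; rewrite big_cons.
exact: LinfD.
Qed.

(** By uniqueness of coefficients f is almost everywhere a polynomial. This is the source of all
    bounded test functions in the model spaces. *)
Lemma finite_fourier_bounded f (n : nat) : H2 f ->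
  (forall m, n%:Z < m -> fourier f m = 0) -> essentially_bounded f.
Proof.
move=> [Lf f0] fn.
pose F (i : 'I_n.+1) z := fourier f i * monomial i%:Z z.
have LF i : Linf (F i).
  by apply: LinfM; [exact: Linf_cst|exact/Uni_Linf/Uni_monomial].
have Lp : Linf (fun z => \sum_(i < n.+1) F i z) by exact: Linf_sum.
apply: essentially_bounded_ae (proj2 Lp).
apply: fourier_aeq => //; first exact: Linf_L2.
move=> m; rewrite /fourier ip_sum; [|by move=> i; exact: Linf_L2|exact: L2_monomial].
have FE i : ip (F i) (monomial m) = fourier f i * (i%:Z == m)%:R.
  rewrite ipZ; [|exact: L2_monomial|exact: L2_monomial].
    by rewrite -[ip _ _]/(fourier (monomial i%:Z) m) fourier_monomial.
under eq_bigr do rewrite FE.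
have [m0|m0] := ltP m 0.
  rewrite big1 => [|i _]; first by rewrite -/(fourier f m) f0.
  by case: eqP => [im|]; rewrite ?mulr0//; lia.
have [nm|mn] := ltP n%:Z m.
  rewrite big1 => [|i _]; first by rewrite -/(fourier f m) fn.
  by case: eqP => [im|]; rewrite ?mulr0//; have := ltn_ord i; lia.
have mn' : (`|m|%N < n.+1)%N by lia.
have mE : m = `|m|%N%:Z by lia.
rewrite (bigD1 (Ordinal mn'))//= -mE eqxx mulr1 big1 ?addr0// => i im.
case: eqP => [e|]; rewrite ?mulr0//.
by case/eqP: im; apply: val_inj => /=; lia.
Qed.

(** * Model spaces and their projections *)

Section ModelSpace.
Variable alpha : R[i] -> R[i].
Hypothesis ialpha : inner alpha.

Local Notation K := (modelK alpha).
Local Notation PK := (Defs.proj (modelK alpha)).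

Let Ua : Uni alpha := inner_Uni ialpha.
Let La : Linf alpha := Uni_Linf Ua.

Lemma modelK_L2 f : K f -> L2 f. Proof. by case=> -[]. Qed.

Lemma modelK_lin a f g : K f -> K g -> K (fun z => a * f z + g z).
Proof.
move=> [Hf f0] [Hg g0]; split; first exact: H2_lin.
move=> h Hh; rewrite ip_lin ?f0 ?g0 ?mulr0 ?addr0//; try exact: H2_L2.
by apply: L2M_Linf => //; exact: H2_L2.
Qed.

Lemma modelKP f : H2 f -> (forall n, 0 <= n -> ip f (fun z => alpha z * monomial n z) = 0) -> K f.
Proof.
move=> Hf f0; split => // h Hh; rewrite ip_mulC; apply: ip_eq0_sym.
- exact: H2_L2.
- by apply: L2M_Linf; [exact: Linf_conj|exact: H2_L2].
apply: ip_H2_eq0 => //.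
  by apply: L2M_Linf; [exact: Linf_conj|exact: H2_L2].
by move=> n n0; rewrite /fourier -ip_mulC f0.
Qed.

(** Here r is the Riesz projection of conj(alpha) f. Its coefficients are recorded because for a
    monomial f only finitely many of them are nonzero. *)
Lemma proj_alphaH2 f : H2 f -> exists r, [/\ H2 r,
  K (fun z => f z - alpha z * r z) &
  forall n, 0 <= n -> fourier r n = ip f (fun z => alpha z * monomial n z)].
Proof.
move=> Hf; have Lf := H2_L2 Hf.
have Laf : L2 (fun z => (alpha z)^* * f z).
  by apply: L2M_Linf => //; exact: Linf_conj.
have [r [Hr rf]] := riesz_projection Laf.
exists r; split => //; last by move=> n n0; rewrite rf// ip_mulC.
have Har : H2 (fun z => alpha z * r z).
  by apply: H2M => //; exact: inner_Hoo.
apply: modelKP; first exact: H2B.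
move=> n n0; have Lan : L2 (fun z => alpha z * monomial n z).
  by apply: L2M_Linf => //; exact: L2_monomial.
rewrite ipB//; last exact: H2_L2.
rewrite ip_uni//; [|exact: H2_L2|exact: L2_monomial].
by rewrite ip_mulC -/(fourier _ _) -rf// subrr.
Qed.

Lemma projP f : L2 f ->
  K (PK f) /\ forall h, K h -> ip f h = ip (PK f) h.
Proof.
move=> Lf; pose S := [set g | K g /\ forall h, K h -> ip (fun z => f z - g z) h = 0].
(* The projection is done in two stages: onto H^2, then away from alpha H^2. *)
have [f1 [Hf1 f1f]] := riesz_projection Lf.
have [r [Hr Kr _]] := proj_alphaH2 Hf1.
have Lf1 := H2_L2 Hf1.
have Har : H2 (fun z => alpha z * r z) by apply: H2M => //; exact: inner_Hoo.
have Lar := H2_L2 Har.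
have S1 : S (fun z => f1 z - alpha z * r z).
  split => // h [Hh h0]; have Lh := H2_L2 Hh.
  rewrite ipB//; last exact: L2B.
  rewrite [ip (fun z => f1 z - _) _]ipB//.
  rewrite (ip_eq0_sym Lh Lar (h0 _ Hr)) subr0 -ipB//.
  apply: ip_eq0_sym => //; first exact: L2B.
  apply: ip_H2_eq0 => //; first exact: L2B.
  by move=> n n0; rewrite fourierB// f1f// subrr.
have [Kp p0] : S (PK f) by apply: xgetPex; exists (fun z => f1 z - alpha z * r z).
split => // h Kh; apply/eqP; rewrite -subr_eq0 -ipB//; try exact: modelK_L2.
by rewrite p0.
Qed.

(** The result is an equality of functions, not merely almost everywhere: [proj] chooses from a set
    that depends only on the pairings with K, so the same representative is picked. This permits
    rewriting with projections. *)
Lemma proj_eq f g : L2 f -> L2 g -> (forall h, K h -> ip f h = ip g h) ->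
  PK f = PK g.
Proof.
move=> Lf Lg fg; rewrite /Defs.proj; congr xget; apply/seteqP; split=> p /= [Kp p0];
  split => // h Kh; have := p0 h Kh; have Lp := modelK_L2 Kp; have Lh := modelK_L2 Kh;
  by rewrite !ipB// fg.
Qed.

Lemma modelK_ae_eq f g : K f -> K g -> (forall h, K h -> ip f h = ip g h) -> aeq f g.
Proof.
move=> Kf Kg fg; have Lf := modelK_L2 Kf; have Lg := modelK_L2 Kg.
have Kd : K (fun z => -1 * f z + g z) by exact: modelK_lin.
have Ld := modelK_L2 Kd.
have : ip (fun z => -1 * f z + g z) (fun z => -1 * f z + g z) = 0.
  by rewrite ip_lin// fg// mulN1r addNr.
rewrite ip_norm2 => /complexI/eqP; rewrite sqrf_eq0 => /eqP /(norm2_eq0 Ld).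
by apply: ae_circS => t /eqP; rewrite mulN1r addrC subr_eq0 => /eqP.
Qed.

Lemma proj_ae f g : L2 f -> K g -> (forall h, K h -> ip f h = ip g h) ->
  aeq (PK f) g.
Proof.
move=> Lf Kg fg; have [Kp pf] := projP Lf.
by apply: modelK_ae_eq => // h Kh; rewrite -pf// fg.
Qed.

Lemma proj_id f : K f -> aeq (PK f) f.
Proof. by move=> Kf; apply: proj_ae => //; exact: modelK_L2. Qed.

Lemma proj_alphaM r : H2 r -> aeq (PK (fun z => alpha z * r z)) (fun=> 0).
Proof.
move=> Hr; have Lar : L2 (fun z => alpha z * r z).
  by apply: L2M_Linf => //; exact: H2_L2.
have K0 : K (fun=> 0).
  have [r' [_ Kr' _]] := proj_alphaH2 (H2_monomial (lexx 0)).
  have := modelK_lin (-1) Kr' Kr'.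
  by under eq_fun do rewrite mulN1r addNr.
apply: proj_ae => // h Kh.
rewrite (ip_eq0_sym (modelK_L2 Kh) Lar (Kh.2 _ Hr)).
by rewrite ip0l.
Qed.

Lemma proj_lin a f g : L2 f -> L2 g ->
  aeq (PK (fun z => a * f z + g z)) (fun z => a * PK f z + PK g z).
Proof.
move=> Lf Lg; have [Kf pf] := projP Lf; have [Kg pg] := projP Lg.
apply: proj_ae; [exact: L2_lin|exact: modelK_lin|].
move=> h Kh; have Lh := modelK_L2 Kh.
by rewrite !ip_lin ?pf ?pg//; exact: modelK_L2.
Qed.

Lemma proj_norm_le f : L2 f -> norm2 (PK f) <= norm2 f.
Proof.
move=> Lf; have [Kf pf] := projP Lf; have Lp := modelK_L2 Kf.
have := ip_normc_le Lf Lp; rewrite pf// ip_norm2.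
have -> : normc (norm2 (PK f) ^+ 2)%:C = norm2 (PK f) ^+ 2.
  by rewrite /= expr0n/= addr0 sqrtr_sqr ger0_norm// sqr_ge0.
have [p0|p0] := ltP 0 (norm2 (PK f)); first by rewrite expr2 ler_pM2r.
by move=> _; apply: le_trans p0 (norm2_ge0 _).
Qed.

Lemma proj_bounded_linear : bounded_linear H2 K (PK).
Proof.
split.
- by move=> f /H2_L2/projP[].
- by move=> a f g /H2_L2 Lf /H2_L2 Lg; exact: proj_lin.
- by exists 1 => f /H2_L2 Lf; rewrite mul1r; exact: proj_norm_le.
Qed.

Lemma proj_repr f : H2 f -> exists r, [/\ H2 r,
  aeq (PK f) (fun z => f z - alpha z * r z) &
  forall n, 0 <= n -> fourier r n = ip f (fun z => alpha z * monomial n z)].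
Proof.
move=> Hf; have [r [Hr Kr rE]] := proj_alphaH2 Hf; exists r; split => //.
apply: proj_ae => //; first exact: H2_L2.
move=> h Kh; have Lh := modelK_L2 Kh.
have Lar : L2 (fun z => alpha z * r z) by apply: L2M_Linf => //; exact: H2_L2.
rewrite ipB//; last exact: H2_L2.
by rewrite (ip_eq0_sym Lh Lar (Kh.2 _ Hr)) subr0.
Qed.

(** The difference f - P_alpha f is in alpha H^2, and multiplication by b preserves alpha H^2. *)
Lemma proj_mul b f : Hoo b -> H2 f ->
  PK (fun z => b z * PK f z) = PK (fun z => b z * f z).
Proof.
move=> Hb Hf; have Lb := Hoo_Linf Hb; have Lf := H2_L2 Hf.
have [Kf pf] := projP Lf; have Lp := modelK_L2 Kf.
have [r [Hr pr _]] := proj_repr Hf.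
have Hbr := H2M Hb Hr; have Lbr := H2_L2 Hbr.
apply: proj_eq; [exact: L2M_Linf|exact: L2M_Linf|].
move=> h Kh; have Lh := modelK_L2 Kh.
have Lab : L2 (fun z => alpha z * (b z * r z)) by exact: L2M_Linf.
have Lbf : L2 (fun z => b z * f z) by exact: L2M_Linf.
transitivity (ip (fun z => b z * f z - alpha z * (b z * r z)) h).
  apply: ip_ae; try exact: L2_meas.
  - by apply: L2_meas; exact: L2M_Linf.
  - by apply: L2_meas; exact: L2B.
  - by apply: ae_circS pr => t ->; rewrite mulrBr mulrCA.
  - exact: aeq_refl.
by rewrite ipB// (ip_eq0_sym Lh Lab (Kh.2 _ Hbr)) subr0.
Qed.

Lemma Hoo_X (n : nat) : Hoo (fun z => z ^+ n : R[i]).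
Proof. exact: (@Hoo_monomial n%:Z). Qed.

(** Only positive powers are covered: at power 0 the left side is f itself, which agrees with its
    projection only almost everywhere. *)
Lemma iter_shift (n : nat) f : K f ->
  iter n.+1 (shift_op alpha) f = PK (fun z => z ^+ n.+1 * f z).
Proof.
move=> Kf; elim: n => [//|n IH]; rewrite iterS IH.
rewrite /shift_op (@proj_mul (fun z => z)).
- by congr Defs.proj; apply/funext => z; rewrite mulrA -exprS.
- exact: (Hoo_X 1).
- by apply: H2M; [exact: Hoo_X|exact: Kf.1].
Qed.

(** In P_alpha z^n = z^n - alpha r, the m-th coefficient of r is the conjugate of the coefficient of
    alpha of index n - m, which is 0 for m > n. Thus r is a polynomial. *)
Lemma proj_monomial n : 0 <= n -> modelKoo alpha (PK (monomial n)).
Proof.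
move=> n0; have Hn := H2_monomial n0; have [Kp _] := projP (H2_L2 Hn).
split => //; split; first exact: Kp.1.
have [r [Hr pr rE]] := proj_repr Hn.
apply: essentially_bounded_ae (aeq_sym pr) _.
have br : essentially_bounded r.
  apply: (@finite_fourier_bounded r `|n|%N) => // m nm.
  have m0 : 0 <= m by lia.
  rewrite rE// -[RHS]conjC0 ip_sym; last 2 first.
  - by apply: L2M_Linf => //; exact: L2_monomial.
  - exact: L2_monomial.
  congr (_^*); rewrite -[LHS]/(fourier _ n).
  have -> : fourier (fun z => alpha z * monomial m z) n = fourier alpha (n - m).
    rewrite -fourierM; apply: cmean_eq => t; by rewrite [alpha _ * _]mulrC.
  by rewrite ialpha.1.1.2//; lia.
apply: (proj2 (LinfB (Uni_Linf (Uni_monomial n)) (LinfM La _))).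
by split => //; exact: (L2_meas (H2_L2 Hr)).
Qed.

(* The point of these test functions is that they are bounded. *)
Lemma modelK_orthogonal f : L2 f -> (forall n, 0 <= n -> ip f (PK (monomial n)) = 0) ->
  forall h, K h -> ip f h = 0.
Proof.
move=> Lf f0 h Kh; have [Kp pf] := projP Lf; have Lp := modelK_L2 Kp.
rewrite pf//; have p0 : aeq (PK f) (fun=> 0).
  apply: fourier_unique => // n; have [n0|n0] := ltP n 0; first exact: Kp.1.2.
  have [Kn pn] := projP (L2_monomial n); have Ln := modelK_L2 Kn.
  apply: ip_eq0_sym; [exact: L2_monomial|by []|].
  by rewrite pn// ip_sym// -pf// f0 ?conjC0.
rewrite -(ip0l h); apply: ip_ae => //; try exact: aeq_refl; apply: L2_meas => //.
- exact: modelK_L2.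
- exact: modelK_L2.
Qed.

Lemma mul_proj_bounded_linear (b : R[i] -> R[i]) : Uni b -> Hoo b ->
  bounded_linear K K (fun f => PK (fun z => b z * f z)).
Proof.
move=> Ub Hb; have Lb := Hoo_Linf Hb.
have Lbf f : K f -> L2 (fun z => b z * f z).
  by move=> Kf; apply: L2M_Linf => //; exact: modelK_L2.
split.
- by move=> f /Lbf/projP[].
- move=> a f g /Lbf Lf /Lbf Lg.
  rewrite (_ : (fun z => b z * _) = (fun z => a * (b z * f z) + b z * g z)); last first.
    by apply/funext => z; ring.
  exact: proj_lin.
- exists 1 => f Kf; rewrite mul1r -(norm2_uni Ub (modelK_L2 Kf)).
  exact/proj_norm_le/Lbf.
Qed.

End ModelSpace.

(** * Bounded operators determined by their values on monomials *)

Lemma bounded_linear_ae (V V' : set (R[i] -> R[i])) U f g :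
  V `<=` L2 -> V' `<=` L2 ->
  (forall a p q, V p -> V q -> V (fun z => a * p z + q z)) ->
  bounded_linear V V' U -> V f -> V g -> aeq f g -> aeq (U f) (U g).
Proof.
move=> VL V'L Vl [UV Ul [C UC]] Vf Vg fg.
have Vd := Vl (-1) f g Vf Vg.
have d0 : aeq (fun z => -1 * f z + g z) (fun=> 0).
  by apply: ae_circS fg => t ->; rewrite mulN1r addNr.
have LU := V'L _ (UV _ Vd).
have : norm2 (U (fun z => -1 * f z + g z)) = 0.
  apply/eqP; rewrite eq_le norm2_ge0 andbT (le_trans (UC _ Vd))//.
  rewrite (norm2_ae _ _ d0); [|exact/L2_meas/VL|exact: circ_meas_cst].
  by rewrite norm2_cst ComplexField.Normc.normc0 mulr0.
move=> /(norm2_eq0 LU) U0.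
apply: ae_circS2 U0 (Ul (-1) f g Vf Vg) => t -> /esym/eqP.
by rewrite mulN1r addrC subr_eq0 => /eqP.
Qed.

Lemma bounded_linear_comp (V V' V'' : set (R[i] -> R[i])) U U' :
  V' `<=` L2 -> V'' `<=` L2 ->
  (forall a p q, V' p -> V' q -> V' (fun z => a * p z + q z)) ->
  (forall a p q, V p -> V q -> V (fun z => a * p z + q z)) ->
  bounded_linear V V' U -> bounded_linear V' V'' U' ->
  bounded_linear V V'' (fun f => U' (U f)).
Proof.
move=> V'L V''L V'l Vl [UV Ul [C UC]] bU'; have [U'V U'l [C' U'C]] := bU'.
split.
- by move=> f /UV/U'V.
- move=> a f g Vf Vg.
  apply: aeq_trans (U'l a _ _ (UV _ Vf) (UV _ Vg)).
  apply: (bounded_linear_ae V'L V''L V'l bU').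
  + by apply: UV; exact: Vl.
  + by apply: V'l; exact: UV.
  + exact: Ul.
- exists (`|C'| * C) => f Vf.
  apply: (le_trans (U'C _ (UV _ Vf))).
  rewrite -mulrA; apply: le_trans (ler_wpM2r (norm2_ge0 _) (ler_norm C')) _.
  by apply: ler_wpM2l; [exact: normr_ge0|exact: UC].
Qed.

(** Each Fourier coefficient of T f - T' f is a bounded functional of f, with bound C + C', that
    vanishes on the monomials. *)
Lemma H2_bounded_linear_eq (V : set (R[i] -> R[i])) T T' f : V `<=` L2 ->
  bounded_linear H2 V T -> bounded_linear H2 V T' ->
  (forall n, 0 <= n -> aeq (T (monomial n)) (T' (monomial n))) ->
  H2 f -> aeq (T f) (T' f).
Proof.
move=> VL [TV Tl [C TC]] [T'V T'l [C' T'C]] TT' Hf.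
have LT g : H2 g -> L2 (T g) by move=> /TV/VL.
have LT' g : H2 g -> L2 (T' g) by move=> /T'V/VL.
apply: fourier_aeq; [exact: LT|exact: LT'|] => m.
apply/eqP; rewrite -subr_eq0; apply/eqP.
apply: (@H2_functional_eq0 (fun g => fourier (T g) m - fourier (T' g) m) (C + C')) Hf.
- move=> a p q Hp Hq; have Hpq := H2_lin a Hp Hq.
  have Lp := LT _ Hp; have Lq := LT _ Hq; have Lp' := LT' _ Hp; have Lq' := LT' _ Hq.
  rewrite (fourier_ae _ _ _ (Tl a _ _ Hp Hq)); try (apply: L2_meas; [exact: LT|exact: L2_lin]).
  + rewrite (fourier_ae _ _ _ (T'l a _ _ Hp Hq)).
    * by rewrite !fourier_lin//; ring.
    * exact/L2_meas/LT'.
    * exact/L2_meas/L2_lin.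
  + exact/L2_meas/LT.
  + exact/L2_meas/L2_lin.
- move=> g Hg; rewrite mulrDl (le_trans (le_normcD _ _))// normcN lerD//.
  + exact: le_trans (fourier_normc_le _ (LT _ Hg)) (TC _ Hg).
  + exact: le_trans (fourier_normc_le _ (LT' _ Hg)) (T'C _ Hg).
- move=> n n0; have Hn := H2_monomial n0.
  rewrite (fourier_ae _ _ _ (TT' _ n0)) ?subrr//; apply: L2_meas; [exact: LT|exact: LT'].
Qed.

End HardySpace.

(** * The operator W_k *)

Section WeightedComposition.
Context {R : realType}.
Implicit Types (f g h u x : R[i] -> R[i]) (m n l : int).
Local Notation normc := ComplexField.Normc.normc.

Variable k : nat.
Hypothesis k0 : (0 < k)%N.

Let kz : k%:Z != 0. Proof. by lia. Qed.

(** In terms of coefficients, W_k keeps those of index k n and renumbers them by n. *)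
Lemma is_W_ex : exists W, is_W (R := R) k W.
Proof.
have tau_inj : injective (fun n : int => k%:Z * n).
  exact: mulfI.
have ex f : exists g, L2 f -> [/\ L2 g, norm2 g <= norm2 f &
    forall n, fourier g n = fourier f (k%:Z * n)].
  have [Lf|nLf] := pselect (L2 f); last by exists f.
  have [g [Lg gf ge]] := @fourier_reindex _ xpredT _ f tau_inj Lf.
  by exists g.
have [W WP] := boolp.choice ex.
have WL f : L2 f -> L2 (W f) by move=> /WP[].
have WE f n : L2 f -> fourier (W f) n = fourier f (k%:Z * n) by move=> /WP[].
exists W; split.
  split => //.
  - move=> a f g Lf Lg; have Lfg := L2_lin a Lf Lg.
    apply: fourier_aeq; [exact: WL|by apply: L2_lin; exact: WL|] => n.
    by rewrite fourier_lin ?WE ?fourier_lin//; exact: WL.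
  - by exists 1 => f /WP[_ ? _]; rewrite mul1r.
move=> n; have Ln := @L2_monomial R n.
apply: fourier_aeq; [exact: WL| |].
  by case: ifP => _; [exact: L2_monomial|exact: L2_cst].
move=> m; rewrite WE// fourier_monomial.
case: ifPn => [/dvdzP[q ->]|nk].
  rewrite mulzK// fourier_monomial.
  by rewrite mulrC (inj_eq tau_inj).
rewrite -[RHS]/(ip (fun=> 0) _) ip0l; case: eqP => // nkm.
by rewrite nkm dvdz_mulr ?dvdzz// in nk.
Qed.

Local Notation W := (@Wop R k).

Lemma is_W_Wop : is_W k W.
Proof. by apply: xgetPex; exact: is_W_ex. Qed.

Lemma Wop_L2 f : L2 f -> L2 (W f).
Proof. by have [[WL _ _] _] := is_W_Wop; exact: WL. Qed.

(** [Wop] is chosen among the operators with the defining properties, so its coefficients can only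
    be found from the monomials, through boundedness. *)
Lemma Wop_fourier f n : L2 f -> fourier (W f) n = fourier f (k%:Z * n).
Proof.
move=> Lf; apply/eqP; rewrite -subr_eq0; apply/eqP.
have [[WL Wl [C WC]] Wm] := is_W_Wop.
apply: (@L2_functional_eq0 _ (fun g => fourier (W g) n - fourier g (k%:Z * n)) (C + 1)) Lf.
- move=> a p q Lp Lq.
  rewrite (fourier_ae _ _ _ (Wl a _ _ Lp Lq)).
  + by rewrite !fourier_lin//; [ring|exact: WL|exact: WL].
  + by apply: L2_meas; apply: WL; exact: L2_lin.
  + by apply: L2_meas; apply: L2_lin; exact: WL.
- move=> g Lg; rewrite mulrDl (le_trans (le_normcD _ _))// normcN lerD//.
  + exact: le_trans (fourier_normc_le _ (WL _ Lg)) (WC _ Lg).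
  + by rewrite mul1r fourier_normc_le.
- move=> m; rewrite (fourier_ae _ _ _ (Wm m)); last 2 first.
  + by apply: L2_meas; apply: WL; exact: L2_monomial.
  + by case: ifP => _; [exact: circ_meas_monomial|exact: circ_meas_cst].
  rewrite fourier_monomial; case: ifPn => [/dvdzP[q ->]|nk].
    rewrite mulzK// fourier_monomial mulrC.
    by rewrite (inj_eq (mulfI kz)) subrr.
  rewrite -[X in X - _]/(ip (fun=> 0) (monomial n)) ip0l; case: eqP => [mkn|]; rewrite ?subrr//.
  by rewrite mkn dvdz_mulr ?dvdzz// in nk.
Qed.

Lemma Wadj_lin a f g : Wadj k (fun z => a * f z + g z) =
  fun z => a * Wadj k f z + Wadj k g z.
Proof. by []. Qed.

Lemma Wadj_fourier u n : L2 u ->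
  fourier (Wadj k u) n = if (k%:Z %| n)%Z then fourier u (n %/ k%:Z)%Z else 0.
Proof.
move=> Lu; apply/eqP; rewrite -subr_eq0; apply/eqP.
pose q n u := if (k%:Z %| n)%Z then fourier u (n %/ k%:Z)%Z else 0 : R[i].
have ql a f g : L2 f -> L2 g -> q n (fun z => a * f z + g z) = a * q n f + q n g.
  by move=> Lf Lg; rewrite /q; case: ifP => _; rewrite ?mulr0 ?addr0// fourier_lin.
have qC f : L2 f -> normc (q n f) <= norm2 f.
  move=> Lf; rewrite /q; case: ifP => _; first exact: fourier_normc_le.
  by rewrite ComplexField.Normc.normc0 norm2_ge0.
apply: (@L2_functional_eq0 _ (fun u => fourier (Wadj k u) n - q n u)
  (Num.sqrt (k.+1%:R / k%:R) + 1)) Lu.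
- move=> a f g Lf Lg; rewrite ql// Wadj_lin fourier_lin; try exact: L2_Wadj.
  ring.
- move=> g Lg; rewrite mulrDl (le_trans (le_normcD _ _))// normcN lerD//.
  + apply: le_trans (fourier_normc_le _ (L2_Wadj k0 Lg)) _.
    exact: norm2_Wadj_le.
  + by rewrite mul1r qC.
- move=> m.
  have -> : fourier (Wadj k (monomial m)) n = fourier (@monomial R (k%:Z * m)) n.
    apply: cmean_eq => t; congr (_ * _).
    by rewrite /Wadj /monomial exprnP exprz_exp.
  rewrite fourier_monomial /q; case: ifPn => [/dvdzP[p ->]|nk].
    rewrite mulzK// fourier_monomial mulrC.
    by rewrite (inj_eq (mulIf kz)) subrr.
  rewrite subr0; case: eqP => // kmn.
  by rewrite -kmn dvdz_mulr ?dvdzz// in nk.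
Qed.

Lemma ip_Wop x g : L2 x -> L2 g -> ip (W x) g = ip x (Wadj k g).
Proof.
move=> Lx Lg; have Lw := L2_Wadj k0 Lg; apply/eqP; rewrite -subr_eq0; apply/eqP.
have [[WL Wl [C WC]] Wm] := is_W_Wop.
apply: (@L2_functional_eq0 _ (fun x => ip (W x) g - ip x (Wadj k g))
  (`|C| * norm2 g + norm2 (Wadj k g))) Lx.
- move=> a p q Lp Lq.
  rewrite (_ : ip (W _) g = ip (fun z => a * W p z + W q z) g).
    by rewrite !ip_lin//; [ring|exact: WL|exact: WL].
  apply: ip_ae; try exact: L2_meas.
  + by apply: L2_meas; apply: WL; exact: L2_lin.
  + by apply: L2_meas; apply: L2_lin; exact: WL.
  + exact: Wl.
  + exact: aeq_refl.
- move=> p Lp; rewrite mulrDl (le_trans (le_normcD _ _))// normcN lerD//.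
  + apply: le_trans (ip_normc_le (WL _ Lp) Lg) _.
    rewrite mulrAC ler_wpM2r ?norm2_ge0//.
    apply: le_trans (WC _ Lp) _.
    by rewrite ler_wpM2r ?norm2_ge0// ler_norm.
  + by rewrite mulrC ip_normc_le.
- move=> m; rewrite [ip (monomial m) _]ip_sym//; last exact: L2_monomial.
  rewrite -[ip (Wadj k g) _]/(fourier _ _) Wadj_fourier//.
  rewrite (_ : ip (W _) g = ip (if (k%:Z %| m)%Z then monomial (m %/ k%:Z)%Z else fun=> 0) g).
    case: ifP => _; last by rewrite ip0l conjC0 subrr.
    by rewrite ip_sym ?subrr//; exact: L2_monomial.
  apply: ip_ae; try exact: L2_meas.
  + by apply: L2_meas; apply: WL; exact: L2_monomial.
  + by case: ifP => _; [exact: circ_meas_monomial|exact: circ_meas_cst].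
  + exact: Wm.
  + exact: aeq_refl.
Qed.

Lemma L2_monomialM l f : L2 f -> L2 (fun z => monomial l z * f z).
Proof. by move=> Lf; apply: L2M_Linf => //; exact/Uni_Linf/Uni_monomial. Qed.

Lemma Wop_monomial l f : L2 f ->
  aeq (W (fun z => monomial (k%:Z * l) z * f z)) (fun z => monomial l z * W f z).
Proof.
move=> Lf; have Llf := L2_monomialM (k%:Z * l) Lf.
apply: fourier_aeq; [exact: Wop_L2|by apply: L2_monomialM; exact: Wop_L2|].
move=> n; rewrite Wop_fourier// !fourierM Wop_fourier//.
by rewrite mulrBr.
Qed.

(** All frequencies of z^l u(z^k) are congruent to l modulo k, so W_k sends it to z^(l/k) u when k
    divides l and to 0 otherwise; then adjointness is used. *)
Lemma ip_Wadj l u g : L2 u -> L2 g ->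
  ip (fun z => monomial l z * Wadj k u z) (Wadj k g) =
  if (k%:Z %| l)%Z then ip (fun z => monomial (l %/ k%:Z)%Z z * u z) g else 0.
Proof.
move=> Lu Lg; have Lw := L2_Wadj k0 Lu; have Llw := L2_monomialM l Lw.
rewrite -ip_Wop//.
pose v := if (k%:Z %| l)%Z then (fun z => monomial (l %/ k%:Z)%Z z * u z) else fun=> 0.
have Lv : L2 v by rewrite /v; case: ifP => _; [exact: L2_monomialM|exact: L2_cst].
transitivity (ip v g); last by rewrite /v; case: ifP => // _; rewrite ip0l.
apply: ip_ae; try exact: L2_meas; last exact: aeq_refl.
  by apply: L2_meas; exact: Wop_L2.
apply: fourier_aeq => //; first exact: Wop_L2.
move=> n; rewrite Wop_fourier// fourierM Wadj_fourier//.
have knk : (k%:Z %| k%:Z * n)%Z by rewrite dvdz_mulr ?dvdzz.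
have kl : (k%:Z %| k%:Z * n - l)%Z = (k%:Z %| l)%Z by rewrite rpredBl.
rewrite kl /v; case: ifPn => [/dvdzP[p ->]|_].
  rewrite fourierM mulzK// mulrC; by rewrite -mulrBl mulzK.
by rewrite -[RHS]/(ip (fun=> 0) (monomial n)) ip0l.
Qed.

End WeightedComposition.

(** * Division by inner functions *)

Section CoprimeDivision.
Context {R : realType}.
Implicit Types (f g h u x : R[i] -> R[i]) (m n l : int).

Variables (alpha B d a1 b1 : R[i] -> R[i]).
Hypothesis ia1 : inner a1.
Hypothesis ib1 : inner b1.
Hypothesis id : inner d.
Hypothesis alphaE : aeq alpha (fun z => d z * a1 z).
Hypothesis BE : aeq B (fun z => d z * b1 z).
Hypothesis gcdP : forall e, inner e -> inner_dvd e alpha -> inner_dvd e B ->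
  inner_dvd e d.

Let Ua1 : Uni a1 := inner_Uni ia1.
Let Ub1 : Uni b1 := inner_Uni ib1.

Let kappa z := b1 z * (a1 z)^*.
Let Ukappa : Uni kappa. Proof. exact: UniM Ub1 (Uni_conj Ua1). Qed.

(** Orthogonality to the [true] members places f in z^N H^2; orthogonality to the [false] ones
    places conj(kappa) f = a1 conj(b1) f there. At N = 0 the latter says that a1 f is in b1 H^2. *)
Let E (N : int) (i : bool * {n : int | n < N}) : R[i] -> R[i] :=
  if i.1 then monomial (sval i.2) else fun z => kappa z * monomial (sval i.2) z.
Arguments E : clear implicits.

Let LE N i : L2 (E N i).
Proof.
case: i => -[] [n nN]; first exact: L2_monomial.
by apply: L2M_Linf; [exact: Uni_Linf|exact: L2_monomial].
Qed.

(* [M 0] is the space of the f in H^2 such that a1 f is in b1 H^2, and [M 1] is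
   z [M 0]; the inner function generating [M 0] spans its complement. *)
Let M (N : int) : set (R[i] -> R[i]) := [set f | L2 f /\ forall i, ip f (E N i) = 0].

Let MP N f : M N f <-> [/\ L2 f, forall n, n < N -> fourier f n = 0 &
  forall n, n < N -> ip f (fun z => kappa z * monomial n z) = 0].
Proof.
split=> [[Lf fE]|[Lf f0 f1]].
  split=> // n nN; first exact: (fE (true, exist _ n nN)).
  exact: (fE (false, exist _ n nN)).
by split=> // -[[] [n nN]]; [exact: f0|exact: f1].
Qed.

Let M_shift N l f : M N f -> M (N + l) (fun z => monomial l z * f z).
Proof.
move=> /MP[Lf f0 f1]; apply/MP; split; first exact: L2_monomialM.
- by move=> n nN; rewrite fourierM f0//; lia.
- move=> n nN; rewrite -[RHS](f1 (n - l)); last by lia.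
  apply: cmean_eq => t; rewrite !rmorphM /= !monomial_circ_conj.
  by rewrite opprB addrC monomialD; ring.
Qed.

Let b1_M : M 0 b1.
Proof.
apply/MP; split; [exact: ib1.1.1.1|exact: ib1.1.1.2|] => n n0.
have -> : (fun z => kappa z * monomial n z) = (fun z => b1 z * ((a1 z)^* * monomial n z)).
  by apply/funext => z; rewrite mulrA.
have -> : ip b1 (fun z => b1 z * ((a1 z)^* * monomial n z)) =
   ip (fun z => b1 z * (fun=> 1) z) (fun z => b1 z * ((a1 z)^* * monomial n z)).
  by apply: cmean_eq => t; rewrite mulr1.
rewrite ip_uni//; [|exact: L2_cst|]; last first.
  by apply: L2M_Linf; [exact/Uni_Linf/Uni_conj|exact: L2_monomial].
rewrite ip_mulC -[RHS](ia1.1.1.2 n n0); apply: cmean_eq => t.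
by rewrite conjCK mulr1.
Qed.

(** If M 0 were contained in M 1, dividing by z would preserve M 0, so every conj(z)^n b1 would lie
    in M 1. All coefficients of b1 would vanish, although b1 is unimodular. *)
Let exists_wandering : exists2 x, M 0 x & ~ M 1 x.
Proof.
apply: contrapT => H.
have M01 x : M 0 x -> M 1 x by move=> Mx; apply: contrapT => nMx; apply: H; exists x.
have Mz (n : nat) : M 0 (fun z => monomial (- n%:Z) z * b1 z).
  elim: n => [|n IH].
    by have -> : (fun z => monomial (- 0%:Z) z * b1 z) = b1 by apply/funext => z; rewrite mul1r.
  have := M_shift (-1) (M01 _ IH); rewrite subrr => /MP[L0 f0 f1].
  apply/MP.
  have e t : monomial (- n.+1%:Z) (circ t) * b1 (circ t) =
     monomial (-1) (circ t) * (monomial (- n%:Z) (circ t) * b1 (circ t)) :> R[i].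
    by rewrite mulrA -monomialD; congr (monomial _ _ * _); lia.
  split.
  - by apply: L2_monomialM; exact: ib1.1.1.1.
  - by move=> m m0; rewrite -[RHS](f0 m m0); apply: cmean_eq => t; rewrite e.
  - by move=> m m0; rewrite -[RHS](f1 m m0); apply: cmean_eq => t; rewrite e.
have b0 n : fourier b1 n = 0.
  have [n0|n0] := ltP n 0; first exact: ib1.1.1.2.
  have := M01 _ (Mz `|n|%N) => /MP[_ /(_ 0 ltr01) + _].
  by rewrite fourierM; congr (fourier _ _ = _); lia.
have /fourier_unique b10 : L2 b1 by exact: ib1.1.1.1.
have := norm2_ae (L2_meas ib1.1.1.1) (circ_meas_cst 0) (b10 b0).
have := norm2_uni Ub1 (L2_cst (1 : R[i])).
have -> : (fun z => b1 z * 1) = b1 by apply/funext => z; rewrite mulr1.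
move=> ->; rewrite !norm2_cst ComplexField.Normc.normc0 ComplexField.Normc.normc1.
by move/eqP; rewrite oner_eq0.
Qed.

(** The component of x orthogonal to M 1, normalised; it is nonzero because x is outside M 1. *)
Let exists_generator : exists theta, [/\ inner theta, M 0 theta &
  forall f, M 1 f -> ip f theta = 0].
Proof.
have [x Mx nMx] := exists_wandering; have [Lx _] := Mx.
have [y [Ly yE yp]] := orthocomplement_proj (@LE 1) Lx.
pose w z := x z - y z; have Lw : L2 w by exact: L2B.
have M10 f : M 1 f -> M 0 f.
  move=> /MP[Lf f0 f1]; apply/MP; split => // n n0; first by apply: f0; lia.
  by apply: f1; lia.
have My : M 1 y by split.
have w0 : norm2 w != 0.
  apply/eqP => /(norm2_eq0 Lw) w0; apply: nMx; split => // i.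
  rewrite -(yE i); apply: ip_ae; try exact: L2_meas; last exact: aeq_refl.
  by apply: ae_circS w0 => t /eqP; rewrite subr_eq0 => /eqP.
have Mw : M 0 w.
  split => // i; rewrite ipB//.
  by rewrite Mx.2 (M10 _ My).2 subrr.
pose c : R[i] := ((norm2 w)^-1)%:C.
pose theta z := c * w z.
have Lt : L2 theta by exact: L2Z.
have Mt : M 0 theta by split => // i; rewrite ipZ ?Mw.2 ?mulr0//.
have orth f : M 1 f -> ip f theta = 0.
  move=> [Lf fE]; apply: ip_eq0_sym => //; rewrite ipZ// yp ?mulr0//.
have n1 : ip theta theta = 1.
  rewrite ipZ// ip_sym// ipZ// ip_norm2 /c -rcM conj_rc -rcM.
  by congr (_%:C); field.
exists theta; split => //.
apply: H2_Uni_inner; first by split => // n n0; have /MP[_ H _] := Mt; exact: H.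
apply/UniP; split; first exact: L2_meas.
(* |theta|^2 - 1 has no nonzero Fourier coefficient, as z^n theta is orthogonal
   to theta for n > 0 and theta has norm 1. *)
pose F z := theta z * (theta z)^* - 1.
suff F0 : aeq F (fun=> 0) by apply: ae_circS F0 => t /eqP; rewrite subr_eq0 => /eqP.
have LF : L1 F.
  have L1t := L1M Lt (L2_conj Lt).
  apply: L1_eq (L1D L1t (L1M (L2_cst (-1)) (L2_cst (1 : R[i])))) => t.
  by rewrite mulr1.
have Fp (n : int) : 0 < n -> cmean (fun z => F z * monomial n z) = 0.
  move=> n0.
  have H : M 1 (fun z => monomial n z * theta z).
    have /MP[L0 f0 f1] := M_shift n Mt; apply/MP; split=> // m m1.
      by apply: f0; lia.
    by apply: f1; lia.
  have e1 := orth _ H.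
  have e2 : cmean (@monomial R n) = 0.
    have e : fourier (@monomial R n) 0 = 0 by rewrite fourier_monomial gt_eqF.
    rewrite -[RHS]e.
    by apply: cmean_eq => t; rewrite monomial_circ_conj oppr0 monomial0 mulr1.
  transitivity (ip (fun z => monomial n z * theta z) theta + -1 * cmean (@monomial R n)).
    rewrite -cmeanZ; last first.
      by apply: L1_eq (L1M (L2_monomial n) (L2_cst 1)) => t; rewrite mulr1.
    rewrite -cmeanD.
    + by apply: cmean_eq => t; rewrite /F; ring.
    + by apply: L1M; [exact: L2_monomialM|exact: L2_conj].
    + by apply: L1_eq (L1M (L2_cst (-1)) (L2_monomial n)) => t.
  by rewrite e1 e2 mulr0 addr0.
apply: cmean_monomial_eq0 => // n.
have [n0|n0|->] := ltrgtP n 0.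
- rewrite -[RHS]conjC0 -(Fp (- n)); last by lia.
  rewrite -cmean_conj; last exact: L1M_monomial.
  apply: cmean_eq => t; rewrite !rmorphM /= monomial_circ_conj opprK.
  by rewrite /F mul_conj_normc [(_ - 1)^*]rmorphB /= conj_rc conj_1.
- exact: Fp.
- transitivity (ip theta theta + cmean (fun=> -1)).
    rewrite -cmeanD.
    + by apply: cmean_eq => t; rewrite monomial0 mulr1.
    + exact: L1M Lt (L2_conj Lt).
    + by apply: L1_eq (L1M (L2_cst (-1)) (L2_cst (1 : R[i]))) => t; rewrite mulr1.
  by rewrite n1 /cmean !mean_cst /=; apply/eqP; rewrite eq_complex /= subrr oppr0 addr0 !eqxx.
Qed.

Lemma coprime_division psi : H2 psi ->
  (forall n, n < 0 -> ip (fun z => a1 z * psi z) (fun z => b1 z * monomial n z) = 0) ->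
  H2 (fun z => (b1 z)^* * psi z).
Proof.
move=> Hpsi psi0; have Lpsi := H2_L2 Hpsi.
have [theta [itheta Mt orth]] := exists_generator.
have Ut := inner_Uni itheta.
(* For n < 0 the n-th coefficient of conj(theta) f is the pairing with theta of z^(-n) f, which is
   in M 1. *)
have divM f : M 0 f -> H2 (fun z => (theta z)^* * f z).
  move=> Mf; have [Lf _] := Mf; split.
    by apply: L2M_Linf => //; exact/Uni_Linf/Uni_conj.
  move=> n n0; rewrite /fourier ip_mulA.
  have H : M 1 (fun z => monomial (- n) z * f z).
    have /MP[L0 f0 f1] := M_shift (- n) Mf; apply/MP; split=> // m m1.
      by apply: f0; lia.
    by apply: f1; lia.
  rewrite -[RHS](orth _ H); apply: cmean_eq => t.
  by rewrite !rmorphM /= monomial_circ_conj conjCK; ring.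
have Mpsi : M 0 psi.
  apply/MP; split => // n n0; first exact: Hpsi.2.
  rewrite -[RHS](psi0 n n0); apply: cmean_eq => t.
  by rewrite !rmorphM /= conjCK; ring.
pose w z := (theta z)^* * b1 z.
have Hw : H2 w by exact: divM b1_M.
have Uw : Uni w by exact: UniM (Uni_conj Ut) Ub1.
have iw := H2_Uni_inner Hw Uw.
have ut := ((UniP _).1 Ut).2; have ua := ((UniP _).1 Ua1).2.
have ub := ((UniP _).1 Ub1).2; have uw := ((UniP _).1 Uw).2.
(* This is theta conj(kappa), analytic because theta is in M 0; it is the cofactor that makes d w
   divide alpha. *)
pose v z := (w z)^* * a1 z.
have iv : inner v.
  have Uv : Uni v by exact: UniM (Uni_conj Uw) Ua1.
  apply: H2_Uni_inner => //; split; first exact: Linf_L2 (Uni_Linf Uv).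
  move=> n n0; have /MP[_ _ f1] := Mt.
  rewrite -[RHS](f1 n n0); apply: cmean_eq => t.
  by rewrite /v /w !rmorphM /= !conjCK; ring.
have idw : inner (fun z => d z * w z) by exact: innerM.
have dwa : inner_dvd (fun z => d z * w z) alpha.
  exists v; split => //; apply: ae_circS2 alphaE uw => t -> uw.
  by rewrite /v mulrACA mulrCA mulrA -[w _ * _ * _]mulrA -[LHS]mulr1 -uw; ring.
have dwB : inner_dvd (fun z => d z * w z) B.
  exists theta; split => //; apply: ae_circS2 BE ut => t -> ut.
  rewrite /w -[LHS]mulr1 -ut; ring.
(* From d = d w w' follows w w' = 1, so conj(b1) psi = w' conj(theta) psi: the factor conj(w) is
   replaced by the analytic w'. *)
have [w' [iw' dw']] := gcdP idw dwa dwB.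
have ud := ((UniP _).1 (inner_Uni id)).2.
have Hres : H2 (fun z => w' z * ((theta z)^* * psi z)).
  by apply: H2M; [exact: inner_Hoo|exact: divM].
apply: H2_ae Hres.
  by apply: L2M_Linf => //; exact/Uni_Linf/Uni_conj.
apply: ae_circS3 (ae_circI dw' ud) ub ut => t [dw'' ud'] ub' ut'.
have ww' : w (circ t) * w' (circ t) = 1.
  have d0 : d (circ t) != 0.
    by apply/eqP => d0; move/eqP: ud'; rewrite d0 mul0r eq_sym oner_eq0.
  by apply: (mulfI d0); rewrite mulrA -dw'' mulr1.
rewrite -[LHS]mul1r -ub'.
transitivity ((b1 (circ t))^* * psi (circ t) * (w (circ t) * w' (circ t))).
  by rewrite /w; ring.
by rewrite ww' mulr1.
Qed.

End CoprimeDivision.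

(** * Intertwining operators *)

Section Intertwining.
Context {R : realType}.
Implicit Types (f g h u : R[i] -> R[i]) (m n l : int).

Lemma ip_ael f f' g : L2 f -> L2 f' -> L2 g -> aeq f f' -> ip f g = ip f' g.
Proof.
move=> Lf Lf' Lg ff'; apply: (ip_ae (L2_meas Lf) (L2_meas Lf') (L2_meas Lg) (L2_meas Lg) ff').
exact: aeq_refl.
Qed.

Lemma linear_sub (a x y x' y' : R[i]) :
  a * x + y - (a * x' + y') = a * (x - x') + (y - y').
Proof. by ring. Qed.

Variables (k : nat) (alpha beta delta : R[i] -> R[i]).
Variable U : (R[i] -> R[i]) -> (R[i] -> R[i]).
Hypothesis k0 : (0 < k)%N.
Hypothesis ialpha : inner alpha.
Hypothesis ibeta : inner beta.
Variables a1 b1 : R[i] -> R[i].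
Hypothesis idelta : inner delta.
Hypothesis ia1 : inner a1.
Hypothesis ib1 : inner b1.
Hypothesis alphaE : aeq alpha (fun z => delta z * a1 z).
Hypothesis BE : aeq (Wadj k beta) (fun z => delta z * b1 z).
Hypothesis gcdP : forall e, inner e -> inner_dvd e alpha ->
  inner_dvd e (Wadj k beta) -> inner_dvd e delta.
Hypothesis blU : bounded_linear (modelK alpha) (modelK beta) U.

Local Notation Ka := (modelK alpha).
Local Notation Kb := (modelK beta).
Local Notation Pa := (Defs.proj (modelK alpha)).
Local Notation Pb := (Defs.proj (modelK beta)).
Local Notation W := (Wop k).
Local Notation B := (Wadj k beta).

Let UK f : Ka f -> Kb (U f). Proof. by case: blU => H _ _; exact: H. Qed.

Let U_ae f g : Ka f -> Ka g -> aeq f g -> aeq (U f) (U g).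
Proof.
apply: bounded_linear_ae blU; try exact: modelK_L2.
by move=> a p q; exact: modelK_lin.
Qed.

Let PaK f : L2 f -> Ka (Pa f). Proof. by move=> Lf; have [] := projP ialpha Lf. Qed.
Let PbK f : L2 f -> Kb (Pb f). Proof. by move=> Lf; have [] := projP ibeta Lf. Qed.

Let blPa : bounded_linear H2 Ka Pa := proj_bounded_linear ialpha.

Let blUPa : bounded_linear H2 Kb (fun f => U (Pa f)).
Proof.
apply: bounded_linear_comp blPa blU; try exact: modelK_L2.
- by move=> a p q; exact: modelK_lin.
- by move=> a p q; exact: H2_lin.
Qed.

Let LB : L2 beta := H2_L2 ibeta.1.1.
Let UB : Uni beta := inner_Uni ibeta.
Let mB : circ_measurable B. Proof. by apply: circ_meas_Wadj => //; exact: L2_meas. Qed.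
Let Ub1 : Uni b1 := inner_Uni ib1.
Let Ud : Uni delta := inner_Uni idelta.
Let UWB : Uni B.
Proof. by split => //; exact: (ae_circ_pow k0 (P := fun z => `|beta z| = 1) UB.2). Qed.

Let Hoo_Xk (n : nat) : Hoo (fun z => z ^+ n : R[i]). Proof. exact: Hoo_X. Qed.

Let intertwine f : op_eq Ka (fun f => shift_op beta (U f))
    (fun f => U (iter k (shift_op alpha) f)) -> H2 f ->
  aeq (U (Pa (fun z => z ^+ k * f z))) (Pb (fun z => z * U (Pa f) z)).
Proof.
move=> SU Hf; have Kf := PaK (H2_L2 Hf).
have := SU _ Kf; rewrite -(prednK k0) (iter_shift ialpha _ Kf) proj_mul//.
exact: aeq_sym.
Qed.

(** * Necessity: the symbol of an intertwining operator *)

Section Necessity.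
Hypothesis SU : op_eq Ka (fun f => shift_op beta (U f))
    (fun f => U (iter k (shift_op alpha) f)).

Let u (j : nat) := U (Pa (monomial j)).

Let Ku j : Kb (u j). Proof. by apply: UK; apply: PaK; exact: L2_monomial. Qed.
Let Lu j : L2 (u j). Proof. exact: modelK_L2. Qed.

(** Each use of the intertwining relation trades a factor z^k inside U for a factor z outside, and
    [proj_mul] absorbs the projections that pile up. *)
Let U_monomial (m j : nat) :
  aeq (U (Pa (monomial (k * m + j)%N))) (Pb (fun z => monomial m z * u j z)).
Proof.
elim: m => [|m IH].
  rewrite muln0 add0n.
  rewrite (_ : (fun z => monomial 0%N z * u j z) = u j); last first.
    by apply/funext => z; rewrite mul1r.
  exact/aeq_sym/proj_id.
have Hn : H2 (@monomial R (k * m + j)%N) by exact: H2_monomial.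
have := intertwine SU Hn.
rewrite (_ : (fun z => z ^+ k * monomial _ z) = monomial (k * m.+1 + j)%N); last first.
  by apply/funext => z; rewrite /monomial -!exprnP -exprD; congr (_ ^+ _); lia.
move=> /aeq_trans; apply.
have Lm := L2_monomialM m (Lu j).
have Hm : H2 (fun z => monomial m z * u j z).
  by apply: H2M; [exact: Hoo_monomial|exact: (Ku j).1].
have LPm := modelK_L2 (PbK Lm).
have -> : Pb (fun z => monomial m.+1 z * u j z) =
    Pb (fun z => z * Pb (fun z => monomial m z * u j z) z).
  rewrite (proj_mul ibeta (b := fun z => z) (Hoo_Xk 1) Hm); congr Defs.proj.
  by apply/funext => z; rewrite mulrA /monomial -!exprnP exprS.
have LUP : L2 (U (Pa (monomial (k * m + j)%N))).
  by apply: modelK_L2; apply: UK; apply: PaK; exact: L2_monomial.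
have Lz f : L2 f -> L2 (fun z => z * f z) by exact: (L2_monomialM 1).
have -> : Pb (fun z => z * U (Pa (monomial (k * m + j)%N)) z) =
    Pb (fun z => z * Pb (fun z => monomial m z * u j z) z); last exact: aeq_refl.
apply: proj_eq.
- exact: Lz.
- exact: Lz.
- move=> h Kh; apply: (ip_ael (Lz _ LUP) (Lz _ LPm) (modelK_L2 Kh)).
  by apply: ae_circS IH => t ->.
Qed.

(* As W_k (z^l W_k^* g) vanishes unless k divides l, W_k (phi z^j) = u_j for
   j < k. *)
Let phi z := \sum_(j < k) monomial (- j%:Z) z * Wadj k (u j) z.

Let Lphi : L2 phi.
Proof. by apply: L2_sum => j; apply: L2_monomialM; exact: L2_Wadj. Qed.

Let ip_phi l g : L2 g ->
  ip (fun z => monomial l z * phi z) (Wadj k g) = \sum_(j < k)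
    if (k%:Z %| l - j%:Z)%Z
    then ip (fun z => monomial ((l - j%:Z) %/ k%:Z)%Z z * u j z) g else 0.
Proof.
move=> Lg; have LW := L2_Wadj k0 Lg.
rewrite (_ : ip (fun z => monomial l z * phi z) _ =
   ip (fun z => \sum_(j < k) monomial (l - j%:Z) z * Wadj k (u j) z) (Wadj k g)).
  rewrite ip_sum//; first by apply: eq_bigr => j _; rewrite ip_Wadj.
  by move=> j; apply: L2_monomialM; exact: L2_Wadj.
apply: cmean_eq => t; congr (_ * _); rewrite mulr_sumr; apply: eq_bigr => j _.
by rewrite mulrA -monomialD.
Qed.

(** Boundedness of g makes conj(phi) times W_k^* g square integrable, so the right side is a bounded
    functional of f on all of H^2 and monomials suffice. *)
Let U_weak g f : modelKoo beta g -> H2 f ->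
  ip (U (Pa f)) g = ip f (fun z => (phi z)^* * Wadj k g z).
Proof.
move=> [Kg Hg] Hf; have Lg := modelK_L2 Kg.
have Lv : L2 (fun z => (phi z)^* * Wadj k g z).
  have := L2M_Linf (Linf_Wadj k0 (Hoo_Linf Hg)) (L2_conj Lphi).
  by under eq_fun do rewrite mulrC.
have [UV Ul [C UC]] := blUPa.
apply/eqP; rewrite -subr_eq0; apply/eqP.
apply: (@H2_functional_eq0 _ (fun f => ip (U (Pa f)) g - ip f (fun z => (phi z)^* * Wadj k g z))
  (`|C| * norm2 g + norm2 (fun z => (phi z)^* * Wadj k g z))) Hf.
- move=> a p q Hp Hq; have Kp := UV _ Hp; have Kq := UV _ Hq.
  have Lp := modelK_L2 Kp; have Lq := modelK_L2 Kq.
  rewrite (_ : ip (U _) g = ip (fun z => a * U (Pa p) z + U (Pa q) z) g).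
    by rewrite (ip_lin a Lp Lq Lg) (ip_lin a (H2_L2 Hp) (H2_L2 Hq) Lv) linear_sub.
  have LU := modelK_L2 (UV _ (H2_lin a Hp Hq)).
  exact: (ip_ael LU (L2_lin a Lp Lq) Lg (Ul _ _ _ Hp Hq)).
- move=> p Hp; have Lp := modelK_L2 (UV _ Hp).
  rewrite mulrDl (le_trans (le_normcD _ _))// normcN lerD//.
  + apply: le_trans (ip_normc_le Lp Lg) _.
    rewrite mulrAC ler_wpM2r ?norm2_ge0//.
    apply: le_trans (UC _ Hp) _.
    by rewrite ler_wpM2r ?norm2_ge0// ler_norm.
  + by rewrite mulrC ip_normc_le//; exact: H2_L2.
(* With n = k m + j and j < k, the index i = j is the only one below k for which k divides n - i, so
   one summand of phi survives. *)
- move=> n n0; pose m := (`|n| %/ k)%N; pose j := (`|n| %% k)%N.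
  have jk : (j < k)%N by rewrite ltn_mod.
  have nE : n = (k * m + j)%N by rewrite [(k * m)%N]mulnC -divn_eq; lia.
  have Lmu := L2_monomialM m (Lu j).
  have -> : ip (U (Pa (monomial n))) g = ip (fun z => monomial m z * u j z) g.
    have [Kp pP] := projP ibeta Lmu.
    rewrite pP// nE.
    have LU := modelK_L2 (UV _ (@H2_monomial R (k * m + j)%N isT)).
    exact: (ip_ael LU (modelK_L2 Kp) Lg (U_monomial m j)).
  have -> : ip (monomial n) (fun z => (phi z)^* * Wadj k g z) =
            ip (fun z => monomial n z * phi z) (Wadj k g).
    by apply: cmean_eq => t; rewrite rmorphM /= conjCK mulrA.
  rewrite ip_phi// (bigD1 (Ordinal jk))//= big1.
    have -> : n - j%:Z = m%:Z * k%:Z by rewrite nE; lia.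
    by rewrite dvdz_mull ?dvdzz// mulzK ?addr0 ?subrr//; lia.
  move=> i ij; case: ifPn => // /dvdzP[q nq].
  case/eqP: ij; apply: val_inj => /=.
  have e : (k * m + j)%N%:Z = q * k%:Z + i%:Z by lia.
  have := congr1 (fun a => modz a k%:Z) e.
  rewrite modzMDl PoszD PoszM [k%:Z * _]mulrC modzMDl.
  have ik := ltn_ord i.
  rewrite modz_small; last by lia.
  rewrite modz_small; last by lia.
  by case.
Qed.

Let ip_phi_Wadj f g : L2 (fun z => phi z * f z) -> L2 g ->
  ip (W (fun z => phi z * f z)) g = ip f (fun z => (phi z)^* * Wadj k g z).
Proof.
move=> Lf Lg; rewrite ip_Wop//; apply: cmean_eq => t.
by rewrite rmorphM /= conjCK mulrCA mulrA.
Qed.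

Let LphiM f : Linf f -> L2 (fun z => phi z * f z).
Proof. by move=> Lf; have := L2M_Linf Lf Lphi; under eq_fun do rewrite mulrC. Qed.

(** By [U_weak], U f and W_k (phi f) have equal pairings with every P_beta z^n, and these pairings
    determine the projection to K_beta. *)
Let U_extension : is_extension k alpha beta phi U.
Proof.
split => // f [Kf Hf]; have Lpf := LphiM (Hoo_Linf Hf).
have LX := Wop_L2 k0 Lpf; have LU := modelK_L2 (UK Kf).
have KPf := PaK (modelK_L2 Kf); have LUP := modelK_L2 (UK KPf).
rewrite /Uop; have -> : Pb (W (fun z => phi z * f z)) = Pb (U f).
  apply: proj_eq => // h Kh; apply/eqP; rewrite -subr_eq0.
  rewrite -(ipB LX LU (modelK_L2 Kh)); apply/eqP.
  apply: (modelK_orthogonal ibeta) Kh; first exact: L2B.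
  move=> n n0; have Kn := proj_monomial ibeta n0; have Ln := modelK_L2 Kn.1.
  rewrite (ipB LX LU Ln) ip_phi_Wadj//.
  have -> : ip (U f) (Pb (monomial n)) = ip (U (Pa f)) (Pb (monomial n)).
    apply: (ip_ael LU LUP Ln); apply: U_ae => //; exact/aeq_sym/proj_id.
  by rewrite (U_weak Kn Hf.1) subrr.
exact/aeq_sym/(proj_id ibeta)/UK.
Qed.

(** K_B is the orthogonal sum of the spaces z^i W_k^* K_beta with 0 <= i < k. The factor z^(k-1)
    moves the exponents -j of phi exactly into this range. *)
Let psi z := monomial (k%:Z - 1) z * phi z.

Let Lpsi : L2 psi. Proof. exact: L2_monomialM. Qed.

Let Hpsi : H2 psi.
Proof.
split => // n n0.
have -> : fourier psi n = ip (fun z => monomial (k%:Z - 1 - n) z * phi z) (Wadj k (fun=> 1)).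
  apply: cmean_eq => t; rewrite monomial_circ_conj conj_1 mulr1 /psi.
  by rewrite [monomial (_ - n) _]monomialD; ring.
rewrite ip_phi; last exact: L2_cst.
apply: big1 => j _; case: ifPn => // /dvdzP[q nq].
rewrite nq mulzK; last by lia.
have jk := ltn_ord j.
(* Here q k = k - 1 - n - j with n < 0 and j < k, so only coefficients of u_j of negative index
   appear. *)
have q0 : 0 < q by nia.
have -> : ip (fun z => monomial q z * u j z) (fun=> 1) = fourier (u j) (- q).
  by apply: cmean_eq => t; rewrite monomial_circ_conj opprK conj_1 mulr1 mulrC.
by apply: (Ku j).1.2; lia.
Qed.

Let psi_orth m : 0 <= m -> ip psi (fun z => B z * monomial m z) = 0.
Proof.
move=> m0.
have -> : ip psi (fun z => B z * monomial m z) =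
   ip (fun z => monomial (k%:Z - 1 - m) z * phi z) (Wadj k beta).
  apply: cmean_eq => t; rewrite rmorphM /= monomial_circ_conj /psi.
  by rewrite [monomial (_ - m) _]monomialD; ring.
rewrite ip_phi//; apply: big1 => j _; case: ifPn => // /dvdzP[q nq].
rewrite nq mulzK; last by lia.
(* Here q k = k - 1 - m - j is at most k - 1, so z^(-q) is analytic and u_j is orthogonal to beta
   z^(-q). *)
have q0 : q <= 0 by nia.
rewrite -[RHS]((Ku j).2 (monomial (- q))); last by apply: H2_monomial; lia.
apply: cmean_eq => t; rewrite rmorphM /= monomial_circ_conj opprK; ring.
Qed.

Let LphiaM n : L2 (fun z => phi z * (alpha z * monomial n z)).
Proof.
apply: LphiM; apply: LinfM; first exact/Uni_Linf/inner_Uni.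
exact/Uni_Linf/Uni_monomial.
Qed.

(** As z^(k-1) z^(-n) = z^(-1-n) z^k, with f = alpha z^(-1-n) the pairing equals that of W_k (phi f)
    with beta conj(z). Since U P_alpha f = 0, the function W_k (phi f) is in beta H^2, hence
    orthogonal to beta conj(z). *)
Let alphapsi_orth n : n < 0 ->
  ip (fun z => alpha z * psi z) (fun z => B z * monomial n z) = 0.
Proof.
move=> n0; pose f z := alpha z * monomial (- 1 - n) z.
have n1 : 0 <= - 1 - n by lia.
have Hf : Hoo f by apply: HooM; [exact: inner_Hoo|exact: Hoo_monomial].
have Lpf : L2 (fun z => phi z * f z) by exact: LphiaM.
have LX := Wop_L2 k0 Lpf.
(* The product phi f is conj(z)^(k-1) times an element of H^2, so its frequencies are at least
   -(k-1), while a negative multiple of k is at most -k. *)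
have HX : H2 (W (fun z => phi z * f z)).
  split => // m m0; rewrite Wop_fourier//.
  have -> : fourier (fun z => phi z * f z) (k%:Z * m) =
     fourier (fun z => alpha z * psi z) (k%:Z * m + k%:Z - 1 - (- 1 - n)).
    apply: cmean_eq => t; rewrite !monomial_circ_conj /f /psi.
    rewrite (_ : - (k%:Z * m) = - (k%:Z * m + k%:Z - 1 - (- 1 - n)) + (k%:Z - 1) + - (- 1 - n)); last by lia.
    rewrite !monomialD.
    have := monomialD (- 1 - n) (- (- 1 - n)) t; rewrite subrr monomial0 => e.
    rewrite -[RHS]mulr1 e monomialD; ring.
  have := (H2M (inner_Hoo ialpha) Hpsi).2; apply.
  have : k%:Z * m <= - k%:Z by nia.
  lia.
have U0 : aeq (U (Pa f)) (fun=> 0).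
  have P0 : aeq (Pa f) (fun=> 0) by apply: (proj_alphaM ialpha); exact: H2_monomial.
  have Kf := PaK (H2_L2 Hf.1); have [_ _ [C UC]] := blU.
  apply: norm2_eq0; first exact: modelK_L2 (UK Kf).
  apply/eqP; rewrite eq_le norm2_ge0 andbT (le_trans (UC _ Kf))//.
  rewrite (norm2_ae (L2_meas (modelK_L2 Kf)) (circ_meas_cst 0) P0).
  by rewrite norm2_cst ComplexField.Normc.normc0 mulr0.
have X0 h : Kb h -> ip (W (fun z => phi z * f z)) h = 0.
  apply: (modelK_orthogonal ibeta) => // m m0.
  have Kn := proj_monomial ibeta m0; have Ln := modelK_L2 Kn.1.
  rewrite ip_phi_Wadj// -(U_weak Kn Hf.1) -(ip0l (Pb (monomial m))).
  have Kf := PaK (H2_L2 Hf.1).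
  exact: (ip_ael (modelK_L2 (UK Kf)) (L2_cst 0) Ln U0).
have [r [Hr rP _]] := proj_repr ibeta HX.
have P0 : aeq (Pb (W (fun z => phi z * f z))) (fun=> 0).
  have [KP PP] := projP ibeta LX.
  apply: norm2_eq0; first exact: modelK_L2 KP.
  have := X0 _ KP; rewrite PP// ip_norm2 => /complexI/eqP.
  by rewrite sqrf_eq0 => /eqP.
have Xr : aeq (W (fun z => phi z * f z)) (fun z => beta z * r z).
  by apply: ae_circS2 rP P0 => t -> /eqP; rewrite subr_eq0 => /eqP.
have Lbr : L2 (fun z => beta z * r z).
  by apply: L2M_Linf; [exact: Uni_Linf|exact: H2_L2].
have Lbz : L2 (fun z => beta z * monomial (-1) z).
  by apply: L2M_Linf; [exact: Uni_Linf|exact: L2_monomial].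
transitivity (ip (W (fun z => phi z * f z)) (fun z => beta z * monomial (-1) z)); last first.
  rewrite (ip_ael LX Lbr Lbz Xr) (ip_uni UB (H2_L2 Hr) (L2_monomial (-1))).
  exact: Hr.2.
rewrite ip_Wop//; apply: cmean_eq => t.
rewrite {2}/Wadj !rmorphM /= /psi /f -[beta (circ t ^+ k)]/(B (circ t)).
have -> : monomial (-1) (circ t ^+ k) = monomial (- k%:Z) (circ t) :> R[i].
  by rewrite /monomial exprnP exprz_exp mulrN1.
rewrite !monomial_circ_conj.
rewrite opprK (_ : monomial (- n) (circ t) =
    monomial k%:Z (circ t) * (monomial (- 1 - n) (circ t) * monomial (- (k%:Z - 1)) (circ t))); last first.
  by rewrite -!monomialD; congr (monomial _ _); lia.
have := monomialD (k%:Z - 1) (- (k%:Z - 1)) t; rewrite subrr monomial0 => e.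
rewrite -[RHS]mulr1 e; ring.
Qed.

Lemma necessity : exists2 phi, symbol_space k beta delta phi &
  is_extension k alpha beta phi U.
Proof.
exists phi => //.
have Lm n f : Uni f -> L2 (fun z => f z * monomial n z).
  by move=> Uf; apply: L2M_Linf; [exact: Uni_Linf|exact: L2_monomial].
have Ua := inner_Uni ialpha; have Ua1 := inner_Uni ia1.
have La1 : L2 (fun z => a1 z * psi z) by apply: L2M_Linf => //; exact: Uni_Linf.
have La : L2 (fun z => alpha z * psi z) by apply: L2M_Linf => //; exact: Uni_Linf.
have Hg : H2 (fun z => (b1 z)^* * psi z).
  apply: (coprime_division ia1 ib1 idelta alphaE BE gcdP Hpsi) => n n0.
  rewrite -[RHS](alphapsi_orth n0) -(ip_uni Ud La1 (Lm n b1 Ub1)).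
  apply: ip_ae.
  - by apply: L2_meas; apply: L2M_Linf => //; exact: Uni_Linf.
  - exact: L2_meas.
  - by apply: L2_meas; apply: L2M_Linf; [exact: Uni_Linf|exact: Lm].
  - by apply: L2_meas; exact: Lm.
  - by apply: ae_circS alphaE => t ->; rewrite mulrA.
  - by apply: ae_circS BE => t ->; rewrite mulrA.
(* Since delta b1 = B, pairing conj(b1) psi with delta z^m amounts to pairing psi with B z^m. *)
exists (fun z => (b1 z)^* * psi z).
  apply: (modelKP idelta) => // m m0.
  rewrite ip_mulA -[RHS](psi_orth m0).
  apply: ip_ae.
  - exact: L2_meas.
  - exact: L2_meas.
  - apply: L2_meas; apply: L2M_Linf; last exact: Lm.
    exact/Uni_Linf/Uni_conj/Uni_conj.
  - by apply: L2_meas; exact: Lm.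
  - exact: aeq_refl.
  - by apply: ae_circS BE => t ->; rewrite conjCK mulrA [b1 _ * _]mulrC.
apply: ae_circS3 BE ((UniP _).1 Ub1).2 ((UniP _).1 Ud).2 => t -> ub ud.
have d0 : delta (circ t) != 0.
  by apply/eqP => d0; move/eqP: ud; rewrite d0 mul0r eq_sym oner_eq0.
rewrite [delta _ * _]mulrC mulfK// /psi.
have -> : (circ t)^* ^+ k.-1 = monomial (- (k%:Z - 1)) (circ t).
  rewrite -monomial_circ_conj /monomial -rmorphXn /=; congr (_^*).
  by rewrite (_ : k%:Z - 1 = k.-1%:Z)//; lia.
have := monomialD (- (k%:Z - 1)) (k%:Z - 1) t; rewrite addNr monomial0 => e.
rewrite -[LHS]mul1r e -[LHS]mul1r -ub; ring.
Qed.

End Necessity.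

(** * Sufficiency: operators with a symbol of the given form *)

Section Sufficiency.
Variables phi g : R[i] -> R[i].
Hypothesis Kg : modelK delta g.
Hypothesis phiE : aeq phi (fun z => (z^*) ^+ k.-1 * (Wadj k beta z / delta z) * g z).
Hypothesis ext : is_extension k alpha beta phi U.

Let Lphi : L2 phi. Proof. by case: ext. Qed.

Let phi_b1 : aeq phi (fun z => monomial (- (k%:Z - 1)) z * (b1 z * g z)).
Proof.
apply: ae_circS3 phiE BE ((UniP _).1 Ud).2 => t -> -> ud.
have d0 : delta (circ t) != 0.
  by apply/eqP => d0; move/eqP: ud; rewrite d0 mul0r eq_sym oner_eq0.
rewrite [delta _ * _]mulrC mulfK//.
have -> : (circ t)^* ^+ k.-1 = monomial (- (k%:Z - 1)) (circ t).
  rewrite -monomial_circ_conj /monomial -rmorphXn /=; congr (_^*).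
  by rewrite (_ : k%:Z - 1 = k.-1%:Z)//; lia.
by rewrite mulrA.
Qed.

Let psi z := monomial (k%:Z - 1) z * phi z.

Let Hpsi : H2 psi.
Proof.
have Hbg := H2M (inner_Hoo ib1) Kg.1.
apply: H2_ae Hbg; first exact: L2_monomialM.
apply: ae_circS phi_b1 => t; rewrite /psi => ->.
by rewrite mulrA -monomialD subrr mul1r.
Qed.

Let LphiM f : Linf f -> L2 (fun z => phi z * f z).
Proof. by move=> Lf; have := L2M_Linf Lf Lphi; under eq_fun do rewrite mulrC. Qed.

Let LphiX n : L2 (fun z => phi z * monomial n z).
Proof. by apply: LphiM; exact/Uni_Linf/Uni_monomial. Qed.

(** On a monomial s = z^n, only an exponent n - (k-1) divisible by k contributes. It exceeds -k, so
    it is a nonnegative multiple q k, and h is orthogonal to beta z^q. *)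
Let orthB s h : H2 s -> Kb h ->
  ip (fun z => monomial (- (k%:Z - 1)) z * (B z * s z)) (Wadj k h) = 0.
Proof.
move=> Hs Kh; have Lh := modelK_L2 Kh; have LWh := L2_Wadj k0 Lh.
have Lc p : H2 p -> L2 (fun z => monomial (- (k%:Z - 1)) z * (B z * p z)).
  move=> Hp; apply: L2_monomialM; apply: L2M_Linf; first exact: Uni_Linf.
  exact: H2_L2.
apply: (@H2_functional_eq0 _
  (fun s => ip (fun z => monomial (- (k%:Z - 1)) z * (B z * s z)) (Wadj k h))
  (norm2 (Wadj k h))) Hs.
- move=> a p q Hp Hq; rewrite -(ip_lin a (Lc _ Hp) (Lc _ Hq) LWh).
  by congr ip; apply/funext => z; ring.
- move=> p Hp; rewrite mulrC; apply: le_trans (ip_normc_le (Lc _ Hp) LWh) _.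
  rewrite (norm2_uni (Uni_monomial _)); last first.
    by apply: L2M_Linf; [exact: Uni_Linf|exact: H2_L2].
  by rewrite (norm2_uni UWB (H2_L2 Hp)).
- move=> n n0.
  have -> : ip (fun z => monomial (- (k%:Z - 1)) z * (B z * monomial n z)) (Wadj k h) =
     ip (fun z => monomial (n - (k%:Z - 1)) z * B z) (Wadj k h).
    by apply: cmean_eq => t; rewrite [monomial (n - _) _]monomialD; ring.
  rewrite ip_Wadj//; case: ifPn => // /dvdzP[q nq].
  rewrite nq mulzK; last by lia.
  have q0 : 0 <= q by nia.
  have Lq : L2 (fun z => beta z * monomial q z).
    by apply: L2M_Linf; [exact: Uni_Linf|exact: L2_monomial].
  rewrite -[RHS](ip_eq0_sym Lh Lq (Kh.2 _ (H2_monomial q0))).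
  by apply: cmean_eq => t; rewrite [monomial _ _ * _]mulrC.
Qed.

(** The symbol represents U only on bounded elements of K_alpha, here P_alpha z^n = z^n - alpha r.
    The correction phi alpha r equals conj(z)^(k-1) B (r a1 g), to which [orthB] applies. *)
Let U_proj n : 0 <= n ->
  aeq (U (Pa (monomial n))) (Pb (W (fun z => phi z * monomial n z))).
Proof.
move=> n0; have [Kn Hn] := proj_monomial ialpha n0.
have [_ _ UE] := ext; apply: aeq_trans (UE _ (conj Kn Hn)) _.
rewrite /Uop; have Lpn := LphiM (Hoo_Linf Hn).
have LW1 := Wop_L2 k0 Lpn; have LW2 := Wop_L2 k0 (LphiX n).
rewrite (_ : Pb _ = Pb (W (fun z => phi z * monomial n z))); first exact: aeq_refl.
apply: proj_eq => // h Kh; have Lh := modelK_L2 Kh; have LWh := L2_Wadj k0 Lh.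
rewrite !ip_Wop//; apply/eqP; rewrite eq_sym -subr_eq0 -ipB//; apply/eqP.
have [r [Hr rP _]] := proj_repr ialpha (H2_monomial n0).
have ua := ((UniP _).1 (inner_Uni ialpha)).2.
(* Boundedness is read off from r = conj(alpha) (z^n - P_alpha z^n); it puts r a1 g in H^2. *)
have br : Hoo r.
  split => //; have := proj2 (LinfM (Linf_conj (Uni_Linf (inner_Uni ialpha)))
    (LinfB (Uni_Linf (Uni_monomial n)) (Hoo_Linf Hn))).
  apply: essentially_bounded_ae; apply: ae_circS2 rP ua => t -> ua.
  by rewrite opprB addrC subrK mulrA [_^* * _]mulrC ua mul1r.
have Hs : H2 (fun z => r z * (a1 z * g z)).
  by apply: H2M => //; apply: H2M; [exact: inner_Hoo|exact: Kg.1].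
rewrite -(orthB Hs Kh); apply: (ip_ael _ _ LWh).
- exact: L2B.
- apply: L2_monomialM; apply: L2M_Linf; first exact: Uni_Linf.
  exact: H2_L2.
apply: ae_circS2 (ae_circI rP phi_b1) (ae_circI alphaE BE) => t [-> ->] [-> ->].
ring.
Qed.

(** Analyticity is what lets [proj_mul] absorb P_beta after the shift. It holds because
    conj(z)^(k-1) cannot bring an analytic function down to the frequency -k. *)
Let H2_Wphi n : 0 <= n -> H2 (W (fun z => phi z * monomial n z)).
Proof.
move=> n0; split; first exact: Wop_L2.
move=> m m0; rewrite Wop_fourier//.
have -> : fourier (fun z => phi z * monomial n z) (k%:Z * m) =
   fourier psi (k%:Z * m + k%:Z - 1 - n).
  apply: cmean_eq => t; rewrite !monomial_circ_conj /psi.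
  rewrite (_ : - (k%:Z * m + k%:Z - 1 - n) = - (k%:Z * m) + n + - (k%:Z - 1)); last by lia.
  rewrite !monomialD.
  have := monomialD (k%:Z - 1) (- (k%:Z - 1)) t; rewrite subrr monomial0 => e.
  rewrite -[LHS]mulr1 e !monomialD; ring.
apply: Hpsi.2.
have : k%:Z * m <= - k%:Z by nia.
lia.
Qed.

Let intertwine_monomial n : 0 <= n ->
  aeq (Pb (fun z => z * U (Pa (monomial n)) z))
      (U (Pa (fun z => z ^+ k * Pa (monomial n) z))).
Proof.
move=> n0; have Hn : H2 (@monomial R n) := H2_monomial n0.
rewrite (proj_mul ialpha (Hoo_X k) Hn).
have -> : Pa (fun z => z ^+ k * monomial n z) = Pa (monomial (n + k%:Z)).
  apply: proj_eq.
  - exact: (L2_monomialM k%:Z (L2_monomial n)).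
  - exact: L2_monomial.
  - move=> h Kh; apply: cmean_eq => t.
    by rewrite monomialD [monomial n _ * _]mulrC.
have nk0 : 0 <= n + k%:Z by lia.
apply: aeq_trans (aeq_sym (U_proj nk0)).
have LWn := Wop_L2 k0 (LphiX n).
have LU : L2 (U (Pa (monomial n))).
  by apply: modelK_L2; apply: UK; apply: PaK; exact: L2_monomial.
have LPW := modelK_L2 (PbK LWn).
have Lz f : L2 f -> L2 (fun z => z * f z) by exact: (L2_monomialM 1).
have -> : Pb (fun z => z * U (Pa (monomial n)) z) =
   Pb (fun z => z * Pb (W (fun z => phi z * monomial n z)) z).
  apply: proj_eq; [exact: Lz|exact: Lz|].
  move=> h Kh; apply: (ip_ael (Lz _ LU) (Lz _ LPW) (modelK_L2 Kh)).
  by apply: ae_circS (U_proj n0) => t ->.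
rewrite (proj_mul ibeta (b := fun z => z) (Hoo_X 1) (H2_Wphi n0)).
rewrite (_ : Pb _ = Pb (W (fun z => phi z * monomial (n + k%:Z) z))); first exact: aeq_refl.
have LWnk := Wop_L2 k0 (LphiX (n + k%:Z)).
apply: proj_eq; [exact: Lz|exact: LWnk|].
move=> h Kh; apply: (ip_ael (Lz _ LWn) LWnk (modelK_L2 Kh)).
apply: aeq_trans (aeq_sym (Wop_monomial k0 1 (LphiX n))) _.
have Lkn := L2_monomialM (k%:Z * 1) (LphiX n).
apply: fourier_aeq; [exact: Wop_L2|exact: LWnk|].
move=> m; rewrite (Wop_fourier k0 _ Lkn) (Wop_fourier k0 _ (LphiX (n + k%:Z))).
apply: cmean_eq => t; rewrite mulr1 [monomial (n + _) _]monomialD; ring.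
Qed.

Lemma sufficiency : op_eq Ka (fun f => shift_op beta (U f))
    (fun f => U (iter k (shift_op alpha) f)).
Proof.
move=> f Kf; have Hf := Kf.1; have KPf := PaK (modelK_L2 Kf).
have Uz : Uni (fun z => z : R[i]) := Uni_monomial 1.
(* With P_alpha inserted both sides become bounded operators on H^2, to be compared on monomials
   only; for f in K_alpha the inserted projection is removed at the end, as P_alpha f = f almost
   everywhere. *)
have bl1 : bounded_linear H2 Kb (fun f => Pb (fun z => z * U (Pa f) z)).
  apply: (bounded_linear_comp _ _ _ _ blUPa (mul_proj_bounded_linear ibeta Uz (Hoo_X 1))).
  - by move=> h; exact: modelK_L2.
  - by move=> h; exact: modelK_L2.
  - by move=> a p q; exact: modelK_lin.
  - by move=> a p q; exact: H2_lin.
have bl2 : bounded_linear H2 Ka (fun f => Pa (fun z => z ^+ k * Pa f z)).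
  apply: (bounded_linear_comp _ _ _ _ blPa (mul_proj_bounded_linear ialpha (Uni_monomial k%:Z) (Hoo_X k))).
  - by move=> h; exact: modelK_L2.
  - by move=> h; exact: modelK_L2.
  - by move=> a p q; exact: modelK_lin.
  - by move=> a p q; exact: H2_lin.
have bl3 : bounded_linear H2 Kb (fun f => U (Pa (fun z => z ^+ k * Pa f z))).
  apply: (bounded_linear_comp _ _ _ _ bl2 blU).
  - by move=> h; exact: modelK_L2.
  - by move=> h; exact: modelK_L2.
  - by move=> a p q; exact: modelK_lin.
  - by move=> a p q; exact: H2_lin.
have KbL2 : Kb `<=` L2 by move=> h; exact: modelK_L2.
have := H2_bounded_linear_eq KbL2 bl1 bl3 intertwine_monomial Hf.
rewrite (proj_mul ialpha (Hoo_X k) Hf).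
have -> : iter k (shift_op alpha) f = Pa (fun z => z ^+ k * f z).
  by rewrite -(prednK k0) (iter_shift ialpha _ Kf).
have LU := modelK_L2 (UK Kf); have LUP := modelK_L2 (UK KPf).
have Lz (p : R[i] -> R[i]) : L2 p -> L2 (fun z => z * p z) by exact: (L2_monomialM 1).
rewrite /shift_op (_ : Pb (fun z => z * U (Pa f) z) = Pb (fun z => z * U f z))//.
apply: proj_eq; [exact: Lz|exact: Lz|].
move=> h Kh; apply: (ip_ael (Lz _ LUP) (Lz _ LU) (modelK_L2 Kh)).
have := U_ae KPf Kf (proj_id ialpha Kf).
by apply: ae_circS => t ->.
Qed.

End Sufficiency.
End Intertwining.

Theorem theorem3p4 (R : realType) (k : nat) (alpha beta delta : R[i] -> R[i])
    (U : (R[i] -> R[i]) -> (R[i] -> R[i])) :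
  (0 < k)%N ->
  inner alpha -> nonconstant alpha ->
  inner beta -> nonconstant beta ->
  dim_ge k (modelK alpha) ->
  is_inner_gcd delta alpha (Wadj k beta) ->
  bounded_linear (modelK alpha) (modelK beta) U ->
  op_eq (modelK alpha)
    (fun f => shift_op beta (U f))
    (fun f => U (iter k (shift_op alpha) f))
  <->
  Sclass k alpha beta U /\
  exists2 phi, symbol_space k beta delta phi & is_extension k alpha beta phi U.
Proof.
move=> k0 ialpha _ ibeta _ _ [idelta [a1 [ia1 alphaE]] [b1 [ib1 BE]] gcdP] blU.
split=> [SU|[_ [phi [g Kg phiE] ext]]].
  have [phi phiS ext] := necessity k0 ialpha ibeta idelta ia1 ib1 alphaE BE gcdP blU SU.
  by split; exists phi.
move=> f; exact: (sufficiency k0 ialpha ibeta idelta ia1 ib1 alphaE BE blU Kg phiE ext).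
Qed.
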